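(* Let $V$ be a real vector space of dimension $n\ge 3$ and let $1\le k\le n-2$. The set $$\Xi=\{f\in C^\infty(G_k(V),M)\ :\ \phi_f\text{ extends by continuity in the Hausdorff metric to }\mathcal{K}(V)\}$$ is a closed $GL(V)$-invariant linear subspace of $C^\infty(G_k(V),M)$.
   Context: $\mathcal{P}(V)$ is the family of convex compact polytopes in $V$; $\mathcal{K}(V)$ is the family of non-empty convex compact subsets of $V$, with the Hausdorff metric. $Gr_k(V)$ is the Grassmannian of $k$-dimensional linear subspaces of $V$. $G_k(V)$ is the manifold of pairs $(E,l)$ with $E\in Gr_k(V)$ and $l$ a line contained in the annihilator $E^\perp\subset V^*$; $p\colon G_k(V)\to Gr_k(V)$, $p(E,l)=E$, so $p^{-1}(E)=\mathbb{P}(E^\perp)$ (the set of lines in $E^\perp$). $L\to Gr_k(V)$ is the complex line bundle whose fiber over $E$ is the space of ($\mathbb{C}$-valued) Lebesgue measures on $E$. $|\omega_{G_k/Gr_k}|$ is the line bundle over $G_k(V)$ of relative densities: its fiber at $x$ is the space of Lebesgue measures on the tangent space at $x$ of the fiber $p^{-1}(p(x))$. Set $M:=p^*L\otimes|\omega_{G_k/Gr_k}|$, a $GL(V)$-equivariant line bundle; $C^\infty(G_k(V),M)$ is its space of smooth sections with the usual Fréchet topology and the natural $GL(V)$-action. For $P\in\mathcal{P}(V)$ and a $k$-face $F\in\mathcal{F}_k(P)$ let $\bar F\in Gr_k(V)$ be the linear subspace containing a translate of $F$, and let $\gamma_F\subset\mathbb{P}_+(\bar F^\perp)$ (the manifold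 of oriented lines in $\bar F^\perp\subset V^*$) be the set of oriented lines spanned by those nonzero $\xi\in\bar F^\perp$ with $\xi(y-x)\le 0$ for all $y\in P$, $x$ being any point of the relative interior of $F$. For $f\in C^\infty(G_k(V),M)$, the restriction of $f$ to $p^{-1}(\bar F)=\mathbb{P}(\bar F^\perp)$ is a density with values in $L|_{\bar F}$; $\int_{\gamma_F}f\in L|_{\bar F}$ denotes one half of the integral over $\gamma_F$ of the pull-back of this density under the double covering $\mathbb{P}_+(\bar F^\perp)\to\mathbb{P}(\bar F^\perp)$. It is a Lebesgue measure on $\bar F$, hence (by translation) on the affine span of $F$. Define $$\phi_f(P)=\sum_{F\in\mathcal{F}_k(P)}\int_F\Big(\int_{\gamma_F}f\Big).$$ ''$\phi_f$ extends by continuity to $\mathcal{K}(V)$'' means that there is a functional on $\mathcal{K}(V)$, continuous in the Hausdorff metric, whose restriction to $\mathcal{P}(V)$ is $\phi_f$. *)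

(* Defs.v *)
From HB Require Import structures.
From mathcomp Require Import all_boot all_order all_algebra.
From mathcomp Require Import all_classical all_reals all_analysis.
From mathcomp Require Import complex.

Set Implicit Arguments.
Unset Strict Implicit.
Unset Printing Implicit Defensive.

Import Order.TTheory GRing.Theory Num.Theory.
Import numFieldNormedType.Exports.

Local Open Scope classical_set_scope.
Local Open Scope ring_scope.

Fixpoint lebesgue_tuple (R : realType) (d : nat) :
    set (d.-tuple (measurableTypeR R)) -> \bar R :=
  match d with
  | 0 => \d_[tuple]
  | d'.+1 => pushforward (@lebesgue_measure R \x @lebesgue_tuple R d')%E
      (fun p : measurableTypeR R * d'.-tuple (measurableTypeR R) =>
         [tuple of p.1 :: p.2])
  end.

Definition cintegral (R : realType) (d : nat)
    (D : set (d.-tuple (measurableTypeR R)))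
    (h : d.-tuple (measurableTypeR R) -> R[i]) : R[i] :=
  Complex (fine (\int[@lebesgue_tuple R d]_(t in D) (complex.Re (h t))%:E)%E)
          (fine (\int[@lebesgue_tuple R d]_(t in D) (complex.Im (h t))%:E)%E).

Section smooth.
Variables (R : realType) (U : normedModType R).
Implicit Types (f g : U -> R) (vs : seq U).

Definition iter_derive vs f : U -> R := foldr (fun v h x => 'D_v h x) f vs.

(* All iterated directional derivatives exist and are continuous; in finite
   dimension this is C^oo. *)
Definition smooth f := forall vs,
  (forall x v, derivable (iter_derive vs f) x v) /\ continuous (iter_derive vs f).

Lemma iter_derive_lin (a b : R) f g vs : smooth f -> smooth g ->
  iter_derive vs (a *: f + b *: g) =
  a *: iter_derive vs f + b *: iter_derive vs g.
Proof.
move=> sf sg; elim: vs => //= v vs ->; apply/funext => x.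
have [df _] := sf vs; have [dg _] := sg vs.
by rewrite deriveD ?deriveZ//; exact: derivableZ.
Qed.

Lemma smooth_lin (a b : R) f g :
  smooth f -> smooth g -> smooth (a *: f + b *: g).
Proof.
move=> sf sg vs; rewrite (iter_derive_lin a b vs sf sg).
have [df cf] := sf vs; have [dg cg] := sg vs; split.
  by move=> x v; apply: derivableD; exact: derivableZ.
by move=> x; apply: cvgD; apply: cvgZ (cvg_cst _) _; [exact: cf|exact: cg].
Qed.

End smooth.

Section linear_algebra.
Variables (R : realType) (V : vectType R).
Local Notation "V '" := ('Hom(V, R^o)) (at level 8, format "V '").

Definition eval_at (v : V) (xi : V ') : R^o := xi v.

Fact eval_at_linear v : linear (eval_at v).
Proof. by move=> a xi zeta; rewrite /eval_at add_lfunE scale_lfunE. Qed.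
HB.instance Definition _ v :=
  GRing.isLinear.Build R V ' R^o *:%R (eval_at v) (eval_at_linear v).

Definition annihilator (E : {vspace V}) : {vspace V '} :=
  (\bigcap_(i < \dim E) lker (linfun (eval_at (vbasis E)`_i)))%VS.

Lemma annihilatorP (E : {vspace V}) (xi : V ') :
  reflect (forall v, v \in E -> xi v = 0) (xi \in annihilator E).
Proof.
apply: (iffP idP) => [xiE v /coord_vbasis -> | xiE].
  rewrite linear_sum big1// => i _; rewrite linearZ /=.
  move: xiE; rewrite memvE => /subv_bigcapP/(_ i isT).
  by rewrite -memvE memv_ker lfunE /= /eval_at => /eqP ->; rewrite scaler0.
rewrite memvE; apply/subv_bigcapP => i _; rewrite -memvE memv_ker lfunE /=.
by apply/eqP/xiE/vbasis_mem/mem_nth; rewrite size_tuple.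
Qed.

Definition GL := {g : 'End(V) | lker g == 0%VS}.

Definition GLinv (g : GL) : 'End(V) := (sval g)^-1%VF.

(* The action of g^-1 on the dual space, g acting on it by xi |-> xi o g^-1. *)
Definition transpose (g : 'End(V)) (xi : V ') : V ' := (xi \o g)%VF.

Fact transpose_linear g : linear (transpose g).
Proof. by move=> a xi zeta; rewrite /transpose comp_lfunDl -comp_lfunZl. Qed.
HB.instance Definition _ g :=
  GRing.isLinear.Build R V ' V ' *:%R (transpose g) (transpose_linear g).

End linear_algebra.

Section bundle.
Variables (R : realType) (V : vectType R) (k r : nat).
Local Notation "V '" := ('Hom(V, R^o)) (at level 8, format "V '").

Definition in_Gk (E : {vspace V}) (l : {vspace V '}) : Prop :=
  [/\ \dim E = k, \dim l = 1 & (l <= annihilator E)%VS].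

Definition lin_comb (U : lmodType R) d (A : 'M[R]_d) (u : 'I_d -> U) : 'I_d -> U :=
  fun i => \sum_j A i j *: u j.

(* Complex Lebesgue measures on the quotient E / K (K <= E) of dimension d:
   [mu u] is the measure of the parallelepiped spanned by the classes of
   u_1, .., u_d.  Tuples with an entry outside E get the dummy value 0. *)
Record is_lebesgue d (U : vectType R) (E K : {vspace U}) (mu : ('I_d -> U) -> R[i])
    : Prop := IsLebesgue {
  lebesgue_out : forall u, ~ (forall i, u i \in E) -> mu u = 0 ;
  lebesgue_det : forall u (A : 'M[R]_d), (forall i, u i \in E) ->
    mu (lin_comb A u) = (`|\det A|)%:C%C * mu u ;
  lebesgue_quo : forall u c, (forall i, u i \in E) -> (forall i, c i \in K) ->
    mu (u + c) = mu u }.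

(* The fiber of M at (E, l).  A tangent vector at l of P(E^perp) is an element of
   Hom(l, E^perp / l); given a generator xi of l it is determined by its value at
   xi, the class modulo l of some eta in E^perp (it is the velocity at t = 0 of
   t |-> [xi + t eta]).  An element m of the fiber is a function of k vectors e of
   E and of r tangent vectors (xi, eta_1), .., (xi, eta_r), which is a Lebesgue
   measure in e and a Lebesgue measure in the tangent vectors.  The pairs
   (xi, eta_i) and (a xi, a eta_i) are the same tangent vector. *)
Definition frame := (('I_k -> V) * V ' * ('I_r -> V '))%type.

Record in_fiber (E : {vspace V}) (l : {vspace V '}) (m : frame -> R[i]) : Prop :=
  InFiber {
  fiber_out : forall e xi eta, ~ (xi \in l /\ xi <> 0) -> m (e, xi, eta) = 0 ;
  fiber_base : forall xi eta, is_lebesgue E 0%VS (fun e => m (e, xi, eta)) ;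
  fiber_tangent : forall e xi, xi \in l -> xi <> 0 ->
    is_lebesgue (annihilator E) l (fun eta => m (e, xi, eta)) ;
  fiber_scale : forall e xi eta (a : R), a != 0 ->
    m (e, a *: xi, a *: eta) = m (e, xi, eta) }.

(* Sections of M, extended by 0 outside of G_k(V). *)
Definition pre_section := {vspace V} * {vspace V '} -> frame -> R[i].

(* Coordinates (X, Y) on G_k(V) given by a basis b of V with dual basis beta:
   E is the graph of the map of matrix X from span (b_i)_(i < k) to
   span (b_j)_(k <= j), E^perp has basis c_0, .., c_r, and l is spanned by
   c_0 + sum_j Y_j c_(j+1).  The coordinate tangent vectors of the fiber P(E^perp)
   are (xi, c_(j+1)). *)
Definition chart_dom := ('M[R]_(k, r.+1) * 'rV[R]_r)%type.

Section chart.
Variables (b : (k + r.+1).-tuple V) (z : chart_dom).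

Definition dual_vec (i : 'I_(k + r.+1)) : V ' := linfun (coord b i : V -> R^o).

Definition chart_e (i : 'I_k) : V :=
  tnth b (lshift r.+1 i) + \sum_j z.1 i j *: tnth b (rshift k j).

Definition chart_c (j : 'I_r.+1) : V ' :=
  dual_vec (rshift k j) - \sum_i z.1 i j *: dual_vec (lshift r.+1 i).

Definition chart_eta (j : 'I_r) : V ' := chart_c (lift ord0 j).

Definition chart_xi : V ' := chart_c ord0 + \sum_j z.2 0 j *: chart_eta j.

Definition local_rep (f : pre_section) : R[i] :=
  f (<<[seq chart_e i | i : 'I_k]>>%VS, <[chart_xi]>%VS)
    (chart_e, chart_xi, chart_eta).

End chart.

Definition basis_tuple := {b : (k + r.+1).-tuple V | basis_of {:V} b}.

Record is_smooth_section (f : pre_section) : Prop := IsSmoothSection {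
  section_out : forall E l, ~ in_Gk E l -> f (E, l) = 0 ;
  section_fiber : forall E l, in_Gk E l -> in_fiber E l (f (E, l)) ;
  section_smooth : forall b : basis_tuple,
    smooth (fun z => complex.Re (local_rep (sval b) z f)) /\
    smooth (fun z => complex.Im (local_rep (sval b) z f)) }.

Definition smooth_section_pred : {pred pre_section} :=
  fun f => `[< is_smooth_section f >].

Lemma is_lebesgue_lin d (U : vectType R) (E K : {vspace U}) (c : R[i])
    (mu nu : ('I_d -> U) -> R[i]) : is_lebesgue E K mu -> is_lebesgue E K nu ->
  is_lebesgue E K (c *: mu + nu).
Proof.
move=> [mo md mq] [no nd nq]; split.
- by move=> u uE; rewrite fctE/= !fctE mo// no// scaler0 addr0.
- move=> u A uE; rewrite !fctE md// nd// mulrDr; congr (_ + _).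
  have sE (a b : R[i]) : a *: b = a * b by [].
  by rewrite !sE mulrCA.
- by move=> u v uE vK; rewrite !fctE mq// nq.
Qed.

Lemma in_fiber_lin E l (c : R[i]) (m n : frame -> R[i]) :
  in_fiber E l m -> in_fiber E l n -> in_fiber E l (c *: m + n).
Proof.
move=> [mo mb mt ms] [no nb nt ns]; split.
- by move=> e xi eta h; rewrite !fctE mo// no// scaler0 addr0.
- move=> xi eta; have := is_lebesgue_lin c (mb xi eta) (nb xi eta).
  by congr is_lebesgue.
- move=> e xi h1 h2; have := is_lebesgue_lin c (mt e _ h1 h2) (nt e _ h1 h2).
  by congr is_lebesgue.
- by move=> e xi eta a a0; rewrite !fctE ms// ns.
Qed.

Lemma ReM (x y : R[i]) : complex.Re (x * y) =
  complex.Re x * complex.Re y + - complex.Im x * complex.Im y.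
Proof. by case: x => a b; case: y => c d /=; rewrite mulNr. Qed.

Lemma ImM (x y : R[i]) : complex.Im (x * y) =
  complex.Re x * complex.Im y + complex.Im x * complex.Re y.
Proof. by case: x => a b; case: y => c d. Qed.

Lemma ReD (x y : R[i]) : complex.Re (x + y) = complex.Re x + complex.Re y.
Proof. by case: x => a b; case: y. Qed.

Lemma ImD (x y : R[i]) : complex.Im (x + y) = complex.Im x + complex.Im y.
Proof. by case: x => a b; case: y. Qed.

Lemma pre_section_linE (c : R[i]) (f g : pre_section) E l :
  (c *: f + g) (E, l) = c *: f (E, l) + g (E, l).
Proof. by []. Qed.

Lemma local_rep_lin b z (c : R[i]) (f g : pre_section) :
  local_rep b z (c *: f + g) = c * local_rep b z f + local_rep b z g.
Proof. by []. Qed.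

Lemma smooth0 : smooth (fun _ : chart_dom => 0 : R).
Proof.
move=> vs; have -> : iter_derive vs (fun _ : chart_dom => 0 : R) = fun=> 0.
  by elim: vs => //= v vs ->; apply/funext => x; rewrite derive_cst.
split; first by move=> x v; exact: derivable_cst.
by move=> x; exact: cvg_cst.
Qed.

Fact smooth_section0 : (0 : pre_section) \in smooth_section_pred.
Proof.
apply/asboolP; split => // [E l _|b]; last by split; exact: smooth0.
split=> // [xi eta|e xi _ _].
  by split=> // u A _; rewrite mulr0.
by split=> // u A _; rewrite mulr0.
Qed.

Fact smooth_section_submod : submod_closed smooth_section_pred.
Proof.
split=> [|c f g /asboolP[fo ff fs] /asboolP[go gf gs]].
  exact: smooth_section0.
apply/asboolP; split.
- by move=> E l El; rewrite pre_section_linE fo// go// scaler0 addr0.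
- by move=> E l El; apply: in_fiber_lin; [exact: ff|exact: gf].
- move=> b; have [f1 f2] := fs b; have [g1 g2] := gs b; split.
    have := smooth_lin 1 1 (smooth_lin (complex.Re c) (- complex.Im c) f1 f2) g1.
    congr smooth; apply/funext => z.
    by rewrite local_rep_lin ReD ReM !fctE !scale1r.
  have := smooth_lin 1 1 (smooth_lin (complex.Re c) (complex.Im c) f2 f1) g2.
  congr smooth; apply/funext => z.
  by rewrite local_rep_lin ImD ImM !fctE !scale1r.
Qed.

HB.instance Definition _ := GRing.isSubmodClosed.Build R[i] pre_section
  smooth_section_pred smooth_section_submod.

Record smooth_section := SmoothSection {
  section_val :> pre_section ;
  _ : section_val \in smooth_section_pred }.

HB.instance Definition _ := [isSub for section_val].
HB.instance Definition _ := [Choice of smooth_section by <:].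
HB.instance Definition _ := [SubChoice_isSubLmodule of smooth_section by <:].

(* The C^oo topology: uniform convergence on compact sets, in all charts, of all
   iterated derivatives (real and imaginary parts). *)
Definition jets (f : smooth_section) :
    prod_topology (fun _ : basis_tuple * seq chart_dom =>
      {family compact, chart_dom -> (R * R)%type}) :=
  fun bv z =>
    (iter_derive bv.2 (fun z => complex.Re (local_rep (sval bv.1) z f)) z,
     iter_derive bv.2 (fun z => complex.Im (local_rep (sval bv.1) z f)) z).

HB.instance Definition _ :=
  Topological.copy smooth_section (initial_topology jets).

End bundle.

Section action.
Variables (R : realType) (V : vectType R) (k r : nat) (g : GL V).
Local Notation "V '" := ('Hom(V, R^o)) (at level 8, format "V '").
Local Notation h := (GLinv g).
Local Notation tg := (transpose (sval g)).

Definition pre_act (f : pre_section V k r) : pre_section V k r :=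
  fun '(E, l) '(e, xi, eta) =>
    f ((h @: E)%VS, (linfun tg @: l)%VS) (h \o e, tg xi, tg \o eta).

Let gK : cancel h (sval g).
Proof. exact: lker0_lfunVK (svalP g). Qed.

Let hK : cancel (sval g) h.
Proof. exact: lker0_lfunK (svalP g). Qed.

Let ker_h : lker h == 0%VS.
Proof. by apply/lker0P; exact: can_inj gK. Qed.

Let tgK : cancel tg (transpose h).
Proof. by move=> xi; apply/lfunP => v; rewrite !comp_lfunE gK. Qed.

Let ker_tg : lker (linfun tg) == 0%VS.
Proof. by apply/lker0P => x y; rewrite !lfunE => /(can_inj tgK). Qed.

Let mem_h (E : {vspace V}) v : (h v \in (h @: E)%VS) = (v \in E).
Proof. by rewrite !memvE -limg_line limg_ker0. Qed.

Let mem_tg (l : {vspace V '}) xi : (tg xi \in (linfun tg @: l)%VS) = (xi \in l).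
Proof.
have -> : tg xi = linfun tg xi by rewrite (lfunE (tg : {linear _ -> _})).
by rewrite !memvE -limg_line limg_ker0.
Qed.

Let mem_annihilator (E : {vspace V}) xi :
  (tg xi \in annihilator (h @: E)) = (xi \in annihilator E).
Proof.
apply/annihilatorP/annihilatorP => xiE v => [vE|/memv_imgP[w wE ->]].
  by rewrite -(gK v) -comp_lfunE; apply: xiE; rewrite mem_h.
by rewrite comp_lfunE gK xiE.
Qed.

Let annihilator_h (E : {vspace V}) :
  annihilator (h @: E) = (linfun tg @: annihilator E)%VS.
Proof.
apply/vspaceP => xi; have -> : xi = tg (transpose h xi).
  by apply/lfunP => v; rewrite !comp_lfunE hK.
by rewrite mem_annihilator mem_tg.
Qed.

Let in_Gk_act (E : {vspace V}) (l : {vspace V '}) :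
  in_Gk k (h @: E)%VS (linfun tg @: l)%VS <-> in_Gk k E l.
Proof.
rewrite /in_Gk annihilator_h limg_ker0// !limg_dim_eq//.
  by rewrite (eqP ker_tg) capv0.
by rewrite (eqP ker_h) capv0.
Qed.

Let is_lebesgue_comp d (U : vectType R) (phi : {linear U -> U})
    (E K E' K' : {vspace U}) (mu : ('I_d -> U) -> R[i]) :
  (forall u, (phi u \in E') = (u \in E)) ->
  (forall u, u \in K -> phi u \in K') ->
  is_lebesgue E' K' mu -> is_lebesgue E K (fun u => mu (phi \o u)).
Proof.
move=> phiE phiK [mo md mq]; split.
- by move=> u uE; apply: mo => /= phiu; apply: uE => i; rewrite -phiE.
- move=> u A uE; rewrite -md => [|i]; last by rewrite /= phiE.
  congr mu; apply/funext => i; rewrite /lin_comb /= linear_sum.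
  by apply: eq_bigr => j _; rewrite linearZ.
- move=> u c uE cK; rewrite -(mq (phi \o u) (phi \o c)) => [|i|i] /=.
  + by congr mu; apply/funext => i /=; rewrite linearD.
  + by rewrite phiE.
  + exact: phiK.
Qed.

Let basis_act (b : (k + r.+1).-tuple V) :
  basis_of {:V} b -> basis_of {:V} (map_tuple h b).
Proof.
move=> bB; have -> : fullv = (h @: fullv)%VS by rewrite lker0_limgf.
by rewrite limg_basis_of// (eqP ker_h) capv0.
Qed.

Let dual_vec_act (b : (k + r.+1).-tuple V) i : basis_of {:V} b ->
  dual_vec (map_tuple h b) i = tg (dual_vec b i).
Proof.
move=> bB; apply/lfunP => v; rewrite comp_lfunE !lfunE /=.
rewrite -[v in LHS]gK -[v in LHS]hK.
have bf : free (map_tuple h b) := basis_free (basis_act bB).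
rewrite gK hK [in LHS](_ : v = \sum_j coord b j (sval g v) *: (map_tuple h b)`_j).
  by rewrite coord_sum_free.
rewrite -[LHS]hK [in LHS](coord_basis bB (memvf (sval g v))) linear_sum.
apply: eq_bigr => j _; rewrite linearZ /= (nth_map 0) ?size_tuple//.
Qed.

Let local_rep_act (b : (k + r.+1).-tuple V) z f : basis_of {:V} b ->
  local_rep b z (pre_act f) = local_rep (map_tuple h b) z f.
Proof.
move=> bB.
have eE : chart_e (map_tuple h b) z = h \o chart_e b z.
  apply/funext => i; rewrite /chart_e /= linearD linear_sum tnth_map.
  by congr (_ + _); apply: eq_bigr => j _; rewrite linearZ tnth_map.
have cE : chart_c (map_tuple h b) z = tg \o chart_c b z.
  apply/funext => j; rewrite /chart_c /= dual_vec_act// [RHS]raddfB.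
  congr (_ - _); rewrite [RHS]raddf_sum; apply: eq_bigr => i _.
  by rewrite dual_vec_act// /transpose comp_lfunZl.
have etaE : chart_eta (map_tuple h b) z = tg \o chart_eta b z.
  by apply/funext => j; rewrite /chart_eta cE.
have xiE : chart_xi (map_tuple h b) z = tg (chart_xi b z).
  rewrite /chart_xi [RHS]raddfD cE; congr (_ + _).
  by rewrite [RHS]raddf_sum; apply: eq_bigr => j _; rewrite etaE /= /transpose comp_lfunZl.
rewrite /local_rep eE etaE xiE /pre_act; congr (f (_, _) _).
  rewrite limg_span -map_comp; congr (<<_>>)%VS.
by rewrite limg_line lfunE.
Qed.

Fact pre_act_smooth (f : pre_section V k r) :
  is_smooth_section f -> is_smooth_section (pre_act f).
Proof.
move=> [fo ff fs]; split.
- by move=> E l El; apply/funext => -[[e xi] eta] /=; rewrite fo// in_Gk_act.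
- move=> E l /in_Gk_act /ff[mo mb mt ms]; split.
  + move=> e xi eta xil; apply: mo; apply: contra_not xil => -[+ xi0].
    rewrite mem_tg => xil; split=> // xi00; apply: xi0.
    by rewrite xi00 [LHS]raddf0.
  + move=> xi eta; apply: is_lebesgue_comp (mb (tg xi) (tg \o eta)).
      exact: mem_h.
    by move=> u; rewrite !memv0 => /eqP ->; rewrite linear0.
  + move=> e xi xil xi0; apply: is_lebesgue_comp (mt (h \o e) (tg xi) _ _).
    * exact: mem_annihilator.
    * by move=> u; rewrite mem_tg.
    * by rewrite mem_tg.
    * by move=> txi0; apply: xi0; apply: (can_inj tgK); rewrite txi0 [RHS]raddf0.
  + move=> e xi eta a a0 /=; rewrite -(ms _ _ (tg \o eta) _ a0).
    have -> : tg (a *: xi) = a *: tg xi by rewrite /transpose comp_lfunZl.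
    have -> // : tg \o (a *: eta) = a *: (tg \o eta).
    by apply/funext => i; exact: linearZ.
- move=> b; have [fr fi] := fs
    (exist (fun b : _.-tuple V => basis_of {:V} b) _ (basis_act (svalP b))).
  by split; [move: fr|move: fi]; congr smooth; apply/funext => z;
    rewrite local_rep_act// (svalP b).
Qed.

Definition act (f : smooth_section V k r) : smooth_section V k r :=
  SmoothSection (asboolT (pre_act_smooth (asboolW (valP f)))).

End action.

Section convex_bodies.
Variables (R : realType) (V : vectType R).
Local Notation "V '" := ('Hom(V, R^o)) (at level 8, format "V '").
Implicit Types (A B P F : set V).

(* The topology of V is that of its coordinates; Hausdorff distances are taken for
   the sup norm of the coordinates, any other norm giving an equivalent metric. *)
Definition coords (v : V) : 'rV[R]_(\dim {:V}) := passmx.rVof (vbasis {:V}) v.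

Definition convex_body A :=
  [/\ A !=set0, convex_set (A : set (convex_lmodType V)) & compact (coords @` A)].

Definition polytope P := exists2 s : seq V, s != [::] &
  P = smallest (fun A : set (convex_lmodType V) => convex_set A) [set` s].

Definition hausdorff_dist A B : R := inf [set eps | [/\ 0 <= eps,
  forall a, A a -> exists2 b, B b & `|coords (a - b)| <= eps &
  forall b, B b -> exists2 a, A a & `|coords (a - b)| <= eps]].

Definition hausdorff_continuous (Phi : set V -> R[i]) :=
  forall A, convex_body A -> forall eps : R, 0 < eps ->
  exists2 delta : R, 0 < delta & forall B, convex_body B ->
    hausdorff_dist A B < delta -> `|Phi B - Phi A| < eps%:C%C.

Definition extends_by_continuity (phi : set V -> R[i]) :=
  exists2 Phi, hausdorff_continuous Phi & forall P, polytope P -> Phi P = phi P.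

(* The linear subspace parallel to F: the smallest one containing all x - y. *)
Definition is_direction F (E : {vspace V}) :=
  (forall x y, F x -> F y -> x - y \in E) /\
  (forall E' : {vspace V}, (forall x y, F x -> F y -> x - y \in E') -> (E <= E')%VS).

Definition direction F : {vspace V} := xget 0%VS (is_direction F).

(* The faces of P are its intersections with supporting hyperplanes, and P itself
   (the case xi = 0). *)
Definition face P F := exists xi : V ',
  F = [set x | P x /\ forall y, P y -> xi y <= xi x].

Definition kfaces k P : set (set V) := [set F | face P F /\ \dim (direction F) = k].

Definition relint F : set V := [set x | F x /\ exists2 eps : R, 0 < eps &
  forall v, v \in direction F -> `|coords v| < eps -> F (x + v)].

(* A set of oriented lines is represented by the nonzero vectors spanning them. *)
Definition gamma P F : set V ' := [set xi | [/\ xi != 0,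
  xi \in annihilator (direction F) &
  forall x, relint F x -> forall y, P y -> xi (y - x) <= 0]].

End convex_bodies.

Section functional.
Variables (R : realType) (V : vectType R) (k r : nat).
Local Notation "V '" := ('Hom(V, R^o)) (at level 8, format "V '").
Implicit Types (f : smooth_section V k r) (P F : set V).

(* Affine coordinates t |-> w_0 + sum_j t_j w_(j+1) for a basis w of W; they cover
   the projective space of W up to a null set. *)
Definition affine_chart (W : {vspace V '}) (t : r.-tuple (measurableTypeR R)) : V ' :=
  (vbasis W)`_0 + \sum_(j < r) (tnth t j : R) *: (vbasis W)`_j.+1.

(* One half of the integral over the set [c] of oriented lines in E^perp of the
   pull-back of the density f restricted to P(E^perp), computed in the affine charts
   t |-> [+- (w_0 + sum_j t_j w_(j+1))] of the two halves of the double cover. *)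
Definition fiber_integral f (E : {vspace V}) (c : set V ') (e : 'I_k -> V) : R[i] :=
  let W := annihilator E in
  2^-1 * \sum_(s : bool)
    cintegral [set t | c ((-1) ^+ s *: affine_chart W t)]
      (fun t => section_val f (E, <[affine_chart W t]>%VS)
                    (e, affine_chart W t, fun j : 'I_r => (vbasis W)`_j.+1)).

(* The measure of F for the translate to the affine span of F of a Lebesgue measure
   mu on the direction of F. *)
Definition face_measure (mu : ('I_k -> V) -> R[i]) F : R[i] :=
  let e := fun i : 'I_k => (vbasis (direction F))`_i in
  let x := xget 0 F in
  mu e * (fine (@lebesgue_tuple R k [set t | F (x + \sum_(i < k) tnth t i *: e i)]))%:C%C.

Definition phi f P : R[i] :=
  \sum_(F \in kfaces k P) face_measure (fiber_integral f (direction F) (gamma P F)) F.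

Definition Xi : set (smooth_section V k r) :=
  [set f | extends_by_continuity (phi f)].

End functional.

Arguments Xi {R} V k r _.

(* Main.v *)
(* For a section f with |f| <= K in the unit cubes of the charts given by the
   permutations of a fixed basis, one has |phi_f(P)| <= C K vol(box of radius rho + 2)
   for every polytope P in the box of radius rho.  Indeed such unit cubes cover G_k(V)
   (choose a maximal minor), so that f is bounded by a multiple of the Euclidean
   density; the contribution of a face F is then at most a constant times the volume
   of the set of points x + xi with x in F, xi an outer normal of P along F, and
   1 <= |xi| <= 2.  These sets are disjoint up to null sets, x being the point of P
   nearest to x + xi, and lie in the larger box.
   Hence if f is a limit of sections g_m in Xi, the functionals phi_(g_m) converge to
   phi_f uniformly on the polytopes in a given box, and so do their extensions on the
   convex bodies in that box; the limit is a continuous extension of phi_f.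
   Linearity of Xi follows from linearity of phi in f, and invariance from
   phi_(g f)(P) = phi_f(g^-1 P), which rests on the independence of the fiber
   integrals of the bases used to compute them. *)
From HB Require Import structures.
Require Import Defs.
From mathcomp Require Import all_boot all_order all_algebra.
From mathcomp Require Import all_classical all_reals all_analysis.
From mathcomp Require Import measurable_realfun complex.
From mathcomp Require Import perm ring lra.
Set Implicit Arguments.
Unset Strict Implicit.
Unset Printing Implicit Defensive.
Import Order.TTheory GRing.Theory Num.Theory.
Import numFieldNormedType.Exports.
Local Open Scope classical_set_scope.
Local Open Scope ring_scope.

(** * Lebesgue measure on tuples *)

Section lebesgue_tuple_measure.
Variable R : realType.
Local Open Scope ereal_scope.

(** The fiber integrals are computed in affine charts of P(E^perp) given by [vbasis], a choice that
    linear maps do not respect, and a change of such charts is projective, with denominators. The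
    remedy is to pass to the cone: a density on an r-dimensional projective space lifts to a
    function homogeneous of degree - r - 1, whose integral over a shell 1 <= N <= 2 is log 2 times
    the integral of the density over oriented lines, whatever the norm N. A change of basis then
    becomes linear. The volume bound comes from the same identity, the shell being the normal factor
    of the set of points x + xi. A basis [b0] and its dual identify V and V* with one R^n, in which
    E and E^perp are orthogonal: nearest points refer to this Euclidean structure, shells and boxes
    to the sup norm. The identity for nonnegative densities is applied to the positive and negative
    parts of the real and imaginary parts of a section. The bound involves values of sections and no
    derivatives, so closedness uses only uniform convergence on finitely many compact cubes. *)

Definition tcons d (p : measurableTypeR R * d.-tuple (measurableTypeR R)) :
  d.+1.-tuple (measurableTypeR R) := [tuple of p.1 :: p.2].

Lemma measurable_tcons d : measurable_fun setT (@tcons d).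
Proof. by apply: measurable_cons; [exact: measurable_fst|exact: measurable_snd]. Qed.

Definition tuncons d (t : d.+1.-tuple (measurableTypeR R)) :
  measurableTypeR R * d.-tuple (measurableTypeR R) := (thead t, [tuple of behead t]).

Lemma measurable_tuncons d : measurable_fun setT (@tuncons d).
Proof.
apply/measurable_fun_pairP; split; last exact: measurable_behead.
exact: measurable_tnth.
Qed.

Lemma tconsK d : cancel (@tcons d) (@tuncons d).
Proof. by case=> a t; congr (_, _); apply/val_inj. Qed.

Lemma tunconsK d : cancel (@tuncons d) (@tcons d).
Proof. by move=> t; rewrite [RHS]tuple_eta. Qed.

Section step.
Variables (d : nat) (m : {sigma_finite_measure set (d.-tuple (measurableTypeR R)) -> \bar R}).

Let lm : {sigma_finite_measure set (measurableTypeR R) -> \bar R} := @lebesgue_measure R.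
Let m1 : {measure set (measurableTypeR R * d.-tuple (measurableTypeR R))%type -> \bar R} :=
  lm \x m.

Let cons_measure := pushforward m1 (@tcons d).

Let mcons := @measurable_tcons d.

Let cons0 : cons_measure set0 = 0.
Proof. exact: measure0. Qed.

Let cons_ge0 A : 0 <= cons_measure A.
Proof. exact: measure_ge0. Qed.

Let cons_sigma_additive : semi_sigma_additive cons_measure.
Proof. exact: measure_semi_sigma_additive. Qed.

HB.instance Definition _ := isMeasure.Build _ _ _ cons_measure
  cons0 cons_ge0 cons_sigma_additive.

Let cons_sigma_finite : sigma_finite setT cons_measure.
Proof.
have /sigma_finiteP[F [TF ndF Foo]] := sigma_finiteT lm.
have /sigma_finiteP[G [TG ndG Goo]] := sigma_finiteT m.
(* Both exhaustions are nondecreasing, so a point with head in [F a] and tail in [G b] lies in the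
   product of index [maxn a b]. *)
exists (fun n => @tuncons d @^-1` (F n `*` G n)).
  apply/seteqP; split => // t _.
  have [a _ Fa] : (\bigcup_n F n) (tuncons t).1 by rewrite -TF.
  have [b _ Gb] : (\bigcup_n G n) (tuncons t).2 by rewrite -TG.
  exists (maxn a b) => //; split.
    by move: Fa; exact/subsetPset/ndF/leq_maxl.
  by move: Gb; exact/subsetPset/ndG/leq_maxr.
move=> n; have [mF Fn] := Foo n; have [mG Gn] := Goo n; split.
  by rewrite -[X in measurable X]setTI; apply: measurable_tuncons => //; exact: measurableX.
rewrite /cons_measure /pushforward (_ : _ @^-1` _ = F n `*` G n); last first.
  rewrite -comp_preimage (_ : _ \o _ = idfun)//.
  by apply/funext => t /=; exact: tconsK.
by rewrite /m1/= product_measure1E// lte_mul_pinfty// ge0_fin_numE.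
Qed.

HB.instance Definition _ := Measure_isSigmaFinite.Build _ _ _ cons_measure
  cons_sigma_finite.

Lemma cons_measureP : exists m' : {sigma_finite_measure set (d.+1.-tuple (measurableTypeR R)) -> \bar R},
  m' = pushforward (@lebesgue_measure R \x m) (@tcons d) :> (set _ -> \bar R).
Proof. by exists cons_measure. Qed.

End step.

(** [lebesgue_tuple] is a recursive family of bare set functions. Induction provides a sigma-finite
    measure with the same underlying function, from which the structure is transported. *)
Lemma lebesgue_tupleP d :
  exists m : {sigma_finite_measure set (d.-tuple (measurableTypeR R)) -> \bar R},
    m = lebesgue_tuple (R := R) (d := d) :> (set _ -> \bar R).
Proof.
elim: d => [|d [m mE]].
  by exists (\d_([tuple] : 0.-tuple (measurableTypeR R))).
by have [m' m'E] := cons_measureP m; exists m'; rewrite m'E/= mE.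
Qed.

Section instances.
Variable d : nat.

Let lt0 : lebesgue_tuple (R := R) (d := d) set0 = 0.
Proof. by have [m <-] := lebesgue_tupleP d. Qed.

Let lt_ge0 A : 0 <= lebesgue_tuple (R := R) (d := d) A.
Proof. by have [m <-] := lebesgue_tupleP d. Qed.

Let lt_sigma_additive : semi_sigma_additive (lebesgue_tuple (R := R) (d := d)).
Proof.
by have [m <-] := lebesgue_tupleP d; exact: measure_semi_sigma_additive.
Qed.

HB.instance Definition _ := isMeasure.Build _ _ _ (lebesgue_tuple (R := R) (d := d))
  lt0 lt_ge0 lt_sigma_additive.

Let lt_sigma_finite : sigma_finite setT (lebesgue_tuple (R := R) (d := d)).
Proof. by have [m <-] := lebesgue_tupleP d; exact: sigma_finiteT. Qed.

HB.instance Definition _ := Measure_isSigmaFinite.Build _ _ _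
  (lebesgue_tuple (R := R) (d := d)) lt_sigma_finite.

End instances.

Local Notation rtuple d := (d.-tuple (measurableTypeR R)).
Local Notation lam d := (@lebesgue_tuple R d).

Lemma ge0_integral_tcons d (f : rtuple d.+1 -> \bar R) :
  measurable_fun setT f -> (forall t, 0 <= f t) ->
  \int[lam d.+1]_t f t =
  \int[@lebesgue_measure R]_x \int[lam d]_t f (tcons (x, t)).
Proof.
move=> mf f0.
rewrite /= (ge0_integral_pushforward (@measurable_tcons d) _ _ mf)//.
rewrite preimage_setT (fubini_tonelli1 (m2 := lam d))//.
  exact: (measurableT_comp mf (@measurable_tcons d)).
by move=> p; exact: f0.
Qed.

Lemma ge0_measurable_tcons d (f : rtuple d.+1 -> \bar R) :
  measurable_fun setT f -> (forall t, 0 <= f t) ->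
  measurable_fun setT (fun x => \int[lam d]_t f (tcons (x, t))).
Proof.
move=> mf f0.
apply: (measurable_fun_fubini_tonelli_F (m2 := lam d) (fun p => f (tcons p))) => //.
exact: (measurableT_comp mf (@measurable_tcons d)).
Qed.

Lemma ge0_integral_tconsC d (f : rtuple d.+1 -> \bar R) :
  measurable_fun setT f -> (forall t, 0 <= f t) ->
  \int[lam d.+1]_t f t =
  \int[lam d]_t \int[@lebesgue_measure R]_x f (tcons (x, t)).
Proof.
move=> mf f0; rewrite ge0_integral_tcons//.
rewrite (fubini_tonelli (m2 := lam d) (fun p => f (tcons p)))//.
exact: (measurableT_comp mf (@measurable_tcons d)).
Qed.

End lebesgue_tuple_measure.

(** * Change of variables under affine maps *)

Section linear_change.
Variable R : realType.
Local Open Scope ereal_scope.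
Local Notation rtuple d := (d.-tuple (measurableTypeR R)).
Local Notation lam d := (@lebesgue_tuple R d).
Local Notation leb := (@lebesgue_measure R).

Lemma measurable_affine (a b : R) :
  measurable_fun [set: measurableTypeR R] (fun x => (a * x + b)%R : measurableTypeR R).
Proof.
by apply: measurable_funD => //; exact: measurable_funM.
Qed.

Section affine_measure.
Variables (a b : R).
Let phi (x : measurableTypeR R) : measurableTypeR R := (a * x + b)%R.
Let mphi : measurable_fun setT phi := measurable_affine a b.
Let m1 := pushforward leb phi.
Let m10 : m1 set0 = 0. Proof. exact: measure0. Qed.
Let m1_ge0 A : 0 <= m1 A. Proof. exact: measure_ge0. Qed.
Let m1_sadd : semi_sigma_additive m1. Proof. exact: measure_semi_sigma_additive. Qed.
HB.instance Definition _ := isMeasure.Build _ _ _ m1 m10 m1_ge0 m1_sadd.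

Hypothesis a0 : a != 0%R.
Let nu := mscale (`|a|%:nng)%R m1.

(** By uniqueness of Lebesgue measure it suffices to compare the two measures on half-open
    intervals. *)
Let nuE A : measurable A -> leb A = nu A.
Proof.
apply: lebesgue_measure_unique => _ [[c d]] _ <-.
rewrite [RHS](_ : _ = `|a|%:E * leb (phi @^-1` `]c, d]%classic))//.
rewrite lebesgue_measure_itv/= lte_fin.
have [cd|dc] := ltP c d; last first.
  rewrite set_itv_ge ?bnd_simp -?leNgt// preimage_set0 measure0 mule0//.
have [a_gt0|a_le0] := ltP 0%R a.
  rewrite (_ : _ @^-1` _ = `](c - b) / a, (d - b) / a]%classic)%R.
    rewrite lebesgue_measure_itv/= lte_fin ltr_pM2r ?invr_gt0// ltrD2r cd.
    rewrite gtr0_norm// -!EFinD -EFinM -mulrBl mulrCA divff// mulr1.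
    by congr (_%:E); ring.
  apply/seteqP; split => x; rewrite /= !in_itv/= /phi;
    by rewrite ltr_pdivrMr// ler_pdivlMr// ltrBlDr lerBrDr mulrC.
(* For negative [a] the preimage of ]c, d] is closed on the left and open on the right, which does
   not affect its length. *)
have a_lt0 : (a < 0)%R by rewrite lt_neqAle a0.
rewrite (_ : _ @^-1` _ = `[(d - b) / a, (c - b) / a[%classic)%R.
  rewrite lebesgue_measure_itv/= lte_fin ltr_nM2r ?invr_lt0// ltrD2r cd.
  rewrite ltr0_norm// -!EFinD -EFinM -mulrBl mulrCA mulNr divff// mulrN1.
  by congr (_%:E); ring.
apply/seteqP; split => x; rewrite /= !in_itv/= /phi;
  by rewrite ltr_ndivlMr// ler_ndivrMr// ltrBlDr lerBrDr mulrC andbC.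
Qed.

Lemma ge0_integral_affine (f : measurableTypeR R -> \bar R) :
  measurable_fun setT f -> (forall x, 0 <= f x) ->
  \int[leb]_x f (a * x + b)%R = (`|a|^-1)%:E * \int[leb]_x f x.
Proof.
move=> mf f0.
rewrite [in RHS](eq_measure_integral nu)//; last by move=> A mA _; exact: nuE.
rewrite ge0_integral_mscale// ge0_integral_pushforward// preimage_setT.
rewrite muleA -EFinM mulVf ?mul1e//=.
by rewrite normr_eq0.
Qed.
End affine_measure.

Lemma ge0_integral_shift (b : R) (f : measurableTypeR R -> \bar R) :
  measurable_fun setT f -> (forall x, 0 <= f x) ->
  \int[leb]_x f (x + b)%R = \int[leb]_x f x.
Proof.
move=> mf f0; have := ge0_integral_affine b (oner_neq0 R) mf f0.
rewrite normr1 invr1 mul1e => <-.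
by apply: eq_integral => x _; rewrite mul1r.
Qed.

Definition rV_of d (t : rtuple d) : 'rV[R]_d := \row_i tnth t i.
Definition t_of d (x : 'rV[R]_d) : rtuple d := [tuple x ord0 i | i < d].

Lemma rV_ofK d : cancel (@rV_of d) (@t_of d).
Proof. by move=> t; apply: eq_from_tnth => i; rewrite tnth_mktuple mxE. Qed.

Lemma t_ofK d : cancel (@t_of d) (@rV_of d).
Proof. by move=> x; apply/rowP => i; rewrite mxE tnth_mktuple. Qed.

Lemma rV_of_tcons d (x : R) (t : rtuple d) :
  rV_of (tcons (x, t)) = row_mx x%:M (rV_of t) :> 'rV[R]_(1 + d).
Proof.
apply/rowP => i; rewrite !mxE; case: splitP => j ij.
  rewrite ord1 !mxE eqxx mulr1n /tcons (_ : i = ord0) ?tnth0//.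
  by apply/val_inj; rewrite /= ij ord1.
rewrite mxE /tcons (_ : i = lift ord0 j) ?tnthS//.
by apply/val_inj; rewrite /= ij.
Qed.

Lemma t_of_row_mx d (x : 'M[R]_1) (y : 'rV[R]_d) :
  t_of (row_mx x y : 'rV[R]_(1 + d)) = tcons (x ord0 ord0, t_of y).
Proof.
apply: (can_inj (@rV_ofK _)); rewrite t_ofK rV_of_tcons t_ofK.
by congr row_mx; apply/matrixP => i j; rewrite !ord1 !mxE eqxx mulr1n.
Qed.

Definition taff d (A : 'M[R]_d) (v : 'rV[R]_d) (t : rtuple d) : rtuple d :=
  t_of (rV_of t *m A + v).

Lemma measurable_rV_of d m (A : 'M[R]_(d, m)) j :
  measurable_fun [set: rtuple d] (fun t => (rV_of t *m A) ord0 j : measurableTypeR R).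
Proof.
rewrite (_ : (fun _ => _) = (fun t => \sum_i tnth t i * A i j)%R); last first.
  by apply/funext => t; rewrite mxE; apply: eq_bigr => i _; rewrite mxE.
apply: measurable_sum => i.
by apply: measurable_funM => //; exact: measurable_tnth.
Qed.

Lemma measurable_to_rtuple d0 (T : measurableType d0) d (h : T -> rtuple d) :
  (forall i, measurable_fun [set: T] (fun x => tnth (h x) i)) ->
  measurable_fun setT h.
Proof. by move=> H; apply/measurable_fun_tnthP => i; exact: H. Qed.

Lemma measurable_taff d (A : 'M[R]_d) v : measurable_fun setT (@taff d A v).
Proof.
apply: measurable_to_rtuple => i.
under eq_fun do rewrite tnth_mktuple mxE.
by apply: measurable_funD => //; exact: measurable_rV_of.
Qed.

Lemma measurable_tconsr d (x : R) : measurable_fun [set: rtuple d] (fun t => tcons (x, t)).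
Proof.
exact: (measurableT_comp (@measurable_tcons R d) (pair1_measurable (x : measurableTypeR R))).
Qed.

Lemma measurable_tconsl d (t : rtuple d) :
  measurable_fun [set: measurableTypeR R] (fun x => tcons (x, t)).
Proof. exact: (measurableT_comp (@measurable_tcons R d) (pair2_measurable t)). Qed.

Lemma taff_tcons d (a : R) (v u' : 'rV[R]_d) (u : 'cV[R]_d) (B : 'M[R]_d) (s x : R) t :
  taff (block_mx a%:M v u B : 'M[R]_(1 + d)) (row_mx s%:M u') (tcons (x, t)) =
  tcons (x * a + (rV_of t *m u) ord0 ord0 + s,
         taff B (x *: v + u') t)%R.
Proof.
rewrite /taff rV_of_tcons mul_row_block add_row_mx t_of_row_mx.
rewrite -scalar_mxM mul_scalar_mx addrA.
congr tcons; congr pair; last by rewrite [X in (X + u')%R]addrC.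
by rewrite mxE [X in (X + _)%R]mxE [X in (X + _ + _)%R]mxE [X in (_ + _ + X)%R]mxE eqxx !mulr1n.
Qed.

Lemma ge0_integral_tshift d (v : 'rV[R]_d) (f : rtuple d -> \bar R) :
  measurable_fun setT f -> (forall x, 0 <= f x) ->
  \int[lam d]_t f (taff 1%:M v t) = \int[lam d]_t f t.
Proof.
elim: d v f => [|d IH] v f mf f0.
  by apply: eq_integral => t _; congr f; rewrite [LHS]tuple0 [RHS]tuple0.
have mf' w : measurable_fun setT (fun t : rtuple d.+1 => f (taff 1%:M w t)).
  by apply: measurableT_comp => //; exact: measurable_taff.
rewrite ge0_integral_tcons// [RHS]ge0_integral_tcons//.
pose v' : 'rV[R]_(1 + d) := v.
transitivity (\int[leb]_x (fun y => \int[lam d]_t f (tcons (y, t))) (x + lsubmx v' ord0 ord0)%R).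
  apply: eq_integral => x _.
  rewrite -(IH (rsubmx v') _ (measurableT_comp mf (measurable_tconsr _)) (fun t => f0 _)).
  apply: eq_integral => t _; congr f.
  rewrite -[v in LHS](@hsubmxK _ 1 1 d v').
  rewrite -[lsubmx v' in LHS](_ : (lsubmx v' ord0 ord0)%:M = _); last first.
    by apply/matrixP => i j; rewrite !ord1 mxE eqxx mulr1n.
  rewrite (_ : 1%:M = block_mx 1%:M 0 0 1%:M :> 'M[R]_(1 + d)) ?taff_tcons; last first.
    exact: (@scalar_mx_block _ 1 d).
  by rewrite mulr1 mulmx0 mxE addr0 scaler0 add0r.
by rewrite (@ge0_integral_shift _ (fun y => \int[lam d]_t f (tcons (y, t))))//;
  [exact: ge0_measurable_tcons|move=> x; exact: integral_ge0].
Qed.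

(** The linear change of variables formula is stated as a property of [A] because it is
    multiplicative in [A]: the general case follows by factorization into triangular blocks. *)
Definition haar d (A : 'M[R]_d) := forall f : rtuple d -> \bar R,
  measurable_fun setT f -> (forall x, 0 <= f x) ->
  \int[lam d]_t f (taff A 0 t) = (`|\det A|^-1)%:E * \int[lam d]_t f t.

Lemma row_mx0s d : row_mx 0%:M 0%R = 0%R :> 'rV[R]_(1 + d).
Proof. by rewrite raddf0 row_mx0. Qed.

Lemma taffM d (A B : 'M[R]_d) v w t : taff B w (taff A v t) = taff (A *m B) (v *m B + w) t.
Proof. by rewrite /taff t_ofK mulmxDl mulmxA addrA. Qed.

Lemma haarM d (A B : 'M[R]_d) : haar A -> haar B -> haar (A *m B).
Proof.
move=> hA hB f mf f0.
have AB t : taff (A *m B) 0 t = taff B 0 (taff A 0 t) by rewrite taffM mul0mx addr0.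
under eq_integral do rewrite AB.
rewrite (hA (fun t => f (taff B 0 t)))//; last first.
  by apply: measurableT_comp => //; exact: measurable_taff.
by rewrite hB// muleA -EFinM det_mulmx normrM invfM.
Qed.

(** Integrating over the first coordinate first, the map is a translation for each fixed tail
    [t]. *)
Lemma haar_lower d (u : 'cV[R]_d) : haar (block_mx 1%:M 0 u 1%:M : 'M[R]_(1 + d)).
Proof.
move=> f mf f0; rewrite det_lblock !det1 mulr1 normr1 invr1 mul1e.
have E x t : taff (block_mx 1%:M 0 u 1%:M : 'M[R]_(1 + d)) 0 (tcons (x, t)) =
    tcons (x + (rV_of t *m u) ord0 ord0, t)%R.
  rewrite -[X in taff _ X](row_mx0s d).
  rewrite (taff_tcons 1 0 0 u 1%:M) mulr1 addr0 scaler0 addr0.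
  by rewrite /taff mulmx1 addr0 rV_ofK.
have mA : measurable_fun setT (fun t : rtuple d.+1 => f (taff (block_mx 1%:M 0 u 1%:M : 'M[R]_(1 + d)) 0 t)).
  by apply: measurableT_comp => //; exact: (@measurable_taff d.+1).
rewrite ge0_integral_tconsC// [RHS]ge0_integral_tconsC//.
apply: eq_integral => t _.
under eq_integral do rewrite E.
rewrite (@ge0_integral_shift _ (fun x => f (tcons (x, t))))//.
exact: (measurableT_comp mf (measurable_tconsl _)).
Qed.

(** For a fixed head [x] the tail undergoes [B] and then a translation by x v; afterwards the head
    is rescaled by [a]. *)
Lemma haar_upper d (a : R) (v : 'rV[R]_d) (B : 'M[R]_d) : a != 0%R -> haar B ->
  haar (block_mx a%:M v 0 B : 'M[R]_(1 + d)).
Proof.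
move=> a0 hB f mf f0.
have E x t : taff (block_mx a%:M v 0 B : 'M[R]_(1 + d)) 0 (tcons (x, t)) =
    tcons (a * x + 0, taff 1%:M (x *: v) (taff B 0 t))%R.
  rewrite -[X in taff _ X](row_mx0s d).
  rewrite (taff_tcons a v 0 0 B) taffM mulmx1 mul0mx add0r addr0.
  by rewrite mulmx0 mxE !addr0 mulrC.
have mA : measurable_fun setT (fun t : rtuple d.+1 => f (taff (block_mx a%:M v 0 B : 'M[R]_(1 + d)) 0 t)).
  by apply: measurableT_comp => //; exact: (@measurable_taff d.+1).
rewrite ge0_integral_tcons// [in RHS]ge0_integral_tcons//.
pose g x := \int[lam d]_t f (tcons (x, t)).
have mg : measurable_fun setT g by exact: ge0_measurable_tcons.
have g0 x : 0 <= g x by exact: integral_ge0.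
transitivity (\int[leb]_x ((`|\det B|^-1)%:E * g (a * x + 0)%R)).
  apply: eq_integral => x _.
  under eq_integral do rewrite E.
  have mx : measurable_fun setT (fun t => f (tcons ((a * x + 0)%R, t))).
    exact: (measurableT_comp mf (measurable_tconsr _)).
  rewrite (hB (fun t => f (tcons ((a * x + 0)%R, taff 1%:M (x *: v) t))))//.
    by rewrite (ge0_integral_tshift (x *: v) mx).
  exact: (measurableT_comp mx (@measurable_taff d 1%:M (x *: v))).
rewrite ge0_integralZl_EFin; last 4 first.
- exact: measurableT.
- by move=> x _; exact: g0.
- exact: (measurableT_comp mg (measurable_affine a 0)).
- by rewrite invr_ge0.
rewrite ge0_integral_affine// muleA -EFinM.
by rewrite det_ublock det_scalar1 normrM invfM mulrC.
Qed.

(** Gaussian elimination by induction on the dimension: if the corner entry is nonzero, the matrix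
    is a lower shear times an upper block matrix whose lower block is the Schur complement. *)
Lemma haar_unit d (A : 'M[R]_d) : \det A != 0%R -> haar A.
Proof.
elim: d A => [|d IH] A A0 f mf f0.
  rewrite det_mx00 normr1 invr1 mul1e.
  by apply: eq_integral => t _; congr f; rewrite [LHS]tuple0 [RHS]tuple0.
suff H (a : R) v u (B : 'M[R]_d) : a != 0%R -> \det (block_mx a%:M v u B : 'M[R]_(1 + d)) != 0%R ->
    haar (block_mx a%:M v u B : 'M[R]_(1 + d)).
  have scE (M : 'M[R]_1) : M = (M ord0 ord0)%:M.
    by apply/matrixP => i j; rewrite !ord1 mxE eqxx mulr1n.
  suff : haar A by apply.
  pose A' : 'M[R]_(1 + d) := A.
  rewrite (_ : A = A')// -[A']submxK [ulsubmx A']scE.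
  have [a0|a0] := eqVneq (ulsubmx A' ord0 ord0) 0%R; last first.
    by apply: H => //; rewrite -scE submxK.
  have [i ui] : exists i, dlsubmx A' i ord0 != 0%R.
    apply/existsP; apply: contraNT A0; rewrite negb_exists => /forallP u0.
    have {}u0 : dlsubmx A' = 0%R.
      by apply/matrixP => i j; rewrite ord1 [RHS]mxE; apply/eqP; have := u0 i; rewrite negbK.
    have := @det_ublock R 1 d (ulsubmx A') (ursubmx A') (drsubmx A').
    rewrite -[X in block_mx _ _ X _]u0 submxK [ulsubmx A']scE a0 det_scalar1 mul0r => /eqP.
    exact.
  (* The corner entry vanishes. [T'] adds to the first row a row with nonzero first entry, and [T]
     is its inverse. *)
  pose T := block_mx 1%:M (- delta_mx ord0 i) 0 1%:M : 'M[R]_(1 + d).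
  pose T' := block_mx 1%:M (delta_mx ord0 i) 0 1%:M : 'M[R]_(1 + d).
  have hT : haar T.
    apply: haar_upper; first exact: oner_neq0.
    by apply: IH; rewrite det1 oner_neq0.
  have -> : block_mx (ulsubmx A' ord0 ord0)%:M (ursubmx A') (dlsubmx A') (drsubmx A') =
      T *m (T' *m A').
    rewrite -scE submxK mulmxA [T *m T']mulmx_block.
    rewrite !mul1mx !mulmx1 !mul0mx !mulmx0 !addr0 !add0r subrr.
    by rewrite -(@scalar_mx_block _ 1 d) mul1mx.
  apply: (haarM hT).
  rewrite -[A']submxK mulmx_block !mul1mx !mul0mx !add0r.
  rewrite [X in block_mx X](scE).
  apply: H.
    by rewrite mxE a0 add0r -rowE mxE.
  rewrite -scE.
  have -> : block_mx (ulsubmx A' + delta_mx ord0 i *m dlsubmx A')%R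
     (ursubmx A' + delta_mx ord0 i *m drsubmx A')%R (dlsubmx A') (drsubmx A') = T' *m A'.
    by rewrite -[in RHS](submxK A') mulmx_block !mul1mx !mul0mx !add0r.
  by rewrite det_mulmx det_ublock !det1 !mul1r.
move=> a0.
have -> : block_mx a%:M v u B = (block_mx 1%:M 0 (a^-1 *: u) 1%:M : 'M[R]_(1 + d)) *m
   (block_mx a%:M v 0 (B - (a^-1 *: u) *m v) : 'M[R]_(1 + d)).
  rewrite mulmx_block !mul1mx !mul0mx !addr0 mul_mx_scalar scalerA divff// scale1r.
  by rewrite addrCA subrr addr0.
rewrite det_mulmx det_lblock !det1 !mul1r det_ublock mulf_eq0 negb_or => /andP[_ dB].
apply: haarM; first exact: haar_lower.
by apply: haar_upper => //; exact: IH.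
Qed.

Lemma ge0_integral_taff d (A : 'M[R]_d) (v : 'rV[R]_d) (f : rtuple d -> \bar R) :
  \det A != 0%R -> measurable_fun setT f -> (forall x, 0 <= f x) ->
  \int[lam d]_t f (taff A v t) = (`|\det A|^-1)%:E * \int[lam d]_t f t.
Proof.
move=> A0 mf f0.
rewrite -(ge0_integral_tshift v mf f0) -(haar_unit A0)//; last first.
  exact: (measurableT_comp mf (@measurable_taff d 1%:M v)).
by apply: eq_integral => t _; rewrite taffM mulmx1 mul0mx add0r.
Qed.

End linear_change.

(** * Measurable and null sets of tuples *)

Section measurable_sets.
Variable R : realType.
Local Notation rtuple d := (d.-tuple (measurableTypeR R)).
Local Notation lam d := (@lebesgue_tuple R d).
Local Notation leb := (@lebesgue_measure R).

Lemma measurable_tnth_preimage d (i : 'I_d) (A : set (measurableTypeR R)) : measurable A ->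
  measurable [set t : rtuple d | A (tnth t i)].
Proof. by move=> mA; rewrite -[X in measurable X]setTI; exact: measurable_tnth. Qed.

(** An open set is the union of the countably many boxes with rational center and side parameter
    1/(q+1) that it contains, and boxes are measurable coordinatewise. *)
Lemma measurable_rV_of_open d (U : set 'rV[R]_d) : open U ->
  measurable [set t : rtuple d | U (rV_of t)].
Proof.
move=> oU.
pose box (q : 'rV[rat]_d * nat) := [set t : rtuple d | forall i,
   `](ratr (q.1 ord0 i) - q.2.+1%:R^-1), (ratr (q.1 ord0 i) + q.2.+1%:R^-1)[%classic (tnth t i)].
pose F q := if `[< forall t, box q t -> U (rV_of t) >] then box q else set0.
have -> : [set t : rtuple d | U (rV_of t)] = \bigcup_q F q.
  apply/seteqP; split => [t Ut|t [q _]]; last first.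
    by rewrite /F; case: asboolP => // H /H.
  have [e /= e0 eU] : exists2 e : R, 0 < e & ball (rV_of t) e `<=` U.
    by have /nbhs_ballP[e /= e0 eU] := open_nbhs_nbhs (conj oU Ut); exists e.
  (* A box of radius 1/(n+1) whose center is within 1/(n+1) of the point stays within 2/(n+1), hence
     the bound e / 2. *)
  have [n _ ne] : \forall n \near \oo, (n.+1%:R^-1 : R) < e / 2.
    by apply: near_infty_natSinv_lt (PosNum (divr_gt0 e0 _)).
  have {ne} /= ne := ne n (leqnn n).
  have n0 : (0 : R) < n.+1%:R^-1 by [].
  have Q i : {q : rat | ratr q \in `](tnth t i - n.+1%:R^-1), (tnth t i + n.+1%:R^-1)[}.
    by apply/cid; apply: rat_in_itvoo; rewrite ltrBlDr -addrA ltrDl addr_gt0.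
  pose q := (\row_i sval (Q i), n).
  exists q => //; rewrite /F; case: asboolP => [_ i /=|].
    rewrite mxE in_itv/=; have := svalP (Q i); rewrite in_itv/=.
    by rewrite ltrBlDr => /andP[h1 h2]; rewrite h1 ltrBlDr h2.
  case => s sq; apply: eU; rewrite mx_norm_ball /ball_/=.
  rewrite [ltLHS]mx_normrE; apply/bigmax_ltP; split => // -[a i] _ /=.
  rewrite !mxE ltr_norml.
  have := sq i; rewrite /= mxE in_itv/= => /andP[]; have := svalP (Q i); rewrite in_itv/= => /andP[].
  move: (tnth s i : R) (tnth t i : R) (ratr _ : R) => s' t' q' h1 h2 h3 h4.
  move: (n.+1%:R^-1 : R) => n' in ne h1 h2 h3 h4 *; lra.
apply: countable_bigcupT_measurable => // q; rewrite /F.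
case: asboolP => // _.
rewrite /box (_ : mkset _ = \bigcap_(i in [set: 'I_d]) [set t : rtuple d |
  `](ratr (q.1 ord0 i) - q.2.+1%:R^-1), (ratr (q.1 ord0 i) + q.2.+1%:R^-1)[%classic (tnth t i)]); last first.
  by apply/seteqP; split => t H i; [move=> _|]; exact: H.
apply: fin_bigcap_measurable => // i _; exact: measurable_tnth_preimage.
Qed.

Lemma measurable_rV_of_closed d (U : set 'rV[R]_d) : closed U ->
  measurable [set t : rtuple d | U (rV_of t)].
Proof.
move=> cU; rewrite -[X in measurable X]setCK; apply: measurableC.
by apply: (measurable_rV_of_open (U := ~` U)); rewrite openC.
Qed.

Lemma measurable_fun_rV_of d (f : 'rV[R]_d -> R) : continuous f ->
  measurable_fun [set: rtuple d] (fun t => f (rV_of t) : measurableTypeR R).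
Proof.
move=> cf; apply: (measurability _ (RGenOpens.measurableE R)).
move=> _ [_ [a [b ->] <-]]; rewrite setTI.
have O : open (f @^-1` `]a, b[%classic) by apply: open_comp => // x _; exact: cf.
exact: (measurable_rV_of_open O).
Qed.

Lemma lebesgue_tupleS d (A : set (rtuple d.+1)) :
  lam d.+1 A = (\int[leb]_x lam d [set t | A (tcons (x, t))])%E.
Proof.
apply: eq_integral => x _ /=; congr lebesgue_tuple.
by apply/seteqP; split => t; rewrite /xsection/= inE.
Qed.

Lemma measurable_preimage d1 d2 (T1 : measurableType d1) (T2 : measurableType d2)
  (f : T1 -> T2) A : measurable_fun setT f -> measurable A -> measurable (f @^-1` A).
Proof. by move=> mf mA; rewrite -[X in measurable X]setTI; exact: mf. Qed.

Lemma measurable_lebesgue_section d (A : set (rtuple d.+1)) : measurable A ->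
  measurable_fun setT (fun x => lam d [set t | A (tcons (x, t))]).
Proof.
move=> mA.
rewrite (_ : (fun x => _) = fun x => \int[lam d]_t (\1_A (tcons (x, t)))%:E)%E.
  apply: (@ge0_measurable_tcons _ _ (fun t => (\1_A t)%:E)) => //.
  exact/measurable_EFinP.
apply/funext => x; rewrite -[X in lam d X]setIT -integral_indic//.
exact: (measurable_preimage (measurable_tconsr x)).
Qed.

Definition tleft k m (z : rtuple (k + m)) : rtuple k := t_of (lsubmx (rV_of z)).
Definition tright k m (z : rtuple (k + m)) : rtuple m := t_of (rsubmx (rV_of z)).

Lemma measurable_tleft k m : measurable_fun setT (@tleft k m).
Proof.
apply: measurable_to_rtuple => i.
by under eq_fun do rewrite tnth_mktuple !mxE; exact: measurable_tnth.
Qed.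

Lemma measurable_tright k m : measurable_fun setT (@tright k m).
Proof.
apply: measurable_to_rtuple => i.
by under eq_fun do rewrite tnth_mktuple !mxE; exact: measurable_tnth.
Qed.

Lemma tleft_tcons k m x (z : rtuple (k + m)) :
  tleft (tcons (x, z) : rtuple (k.+1 + m)) = tcons (x, tleft z).
Proof.
apply: eq_from_tnth => i; rewrite tnth_mktuple !mxE.
case: (unliftP ord0 i) => [j ->|->]; last by rewrite tnth0 (tnth_nth 0).
by rewrite tnthS tnth_mktuple !mxE !(tnth_nth 0).
Qed.

Lemma tright_tcons k m x (z : rtuple (k + m)) :
  tright (tcons (x, z) : rtuple (k.+1 + m)) = tright z.
Proof.
apply: eq_from_tnth => i; rewrite !tnth_mktuple !mxE.
by rewrite !(tnth_nth 0).
Qed.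

(** Induction on [k], since the measure is defined by splitting off the first coordinate; for
    [k = 0] the left factor is the Dirac mass at the empty tuple. *)
Lemma lebesgue_tuple_prod k m (T : set (rtuple k)) (S : set (rtuple m)) :
  measurable T -> measurable S ->
  lam (k + m) [set z | T (tleft z) /\ S (tright z)] = (lam k T * lam m S)%E.
Proof.
elim: k T => [|k IH] T mT mS.
  have r0 (z : rtuple (0 + m)) : tright z = z.
    apply: eq_from_tnth => i; rewrite tnth_mktuple !mxE.
    by congr tnth; exact/val_inj.
  rewrite /= diracE; case: (boolP ([tuple] \in T)) => [|] /=; rewrite ?inE ?notin_setE => T0.
    rewrite mul1e; congr lebesgue_tuple; apply/seteqP; split => z /=; rewrite r0.
      by case.
    by split => //; rewrite [tleft z]tuple0.
  rewrite mul0e -(@measure0 _ _ _ (lam m)); congr lebesgue_tuple.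
  by apply/seteqP; split => z //= []; rewrite [tleft z]tuple0.
rewrite (@lebesgue_tupleS (k + m)).
transitivity (\int[leb]_x (lam k [set t | T (tcons (x, t))] * lam m S))%E.
  apply: eq_integral => x _; rewrite -IH//.
    congr lebesgue_tuple; apply/seteqP; split => z /=;
      by rewrite (tleft_tcons x z) (tright_tcons x z).
  exact: (measurable_preimage (measurable_tconsr x)).
rewrite ge0_integralZr//; first by rewrite -lebesgue_tupleS.
  exact: measurable_lebesgue_section.
Qed.

Definition tbox d (M : R) : set (rtuple d) := [set t | forall i, `|tnth t i| <= M].

Lemma measurable_tbox d M : measurable (@tbox d M).
Proof.
rewrite /tbox (_ : mkset _ = \bigcap_(i in [set: 'I_d]) [set t : rtuple d |
  `[- M, M]%classic (tnth t i)]); last first.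
  apply/seteqP; split => t H i; first by move=> _ /=; rewrite in_itv/= -ler_norml.
  by have := H i I; rewrite /= in_itv/= -ler_norml.
by apply: fin_bigcap_measurable => // i _; exact: measurable_tnth_preimage.
Qed.

Lemma lebesgue_tbox d M : (lam d (@tbox d M) < +oo)%E.
Proof.
elim: d => [|d IH]; first by rewrite /= diracE; case: (_ \in _) => /=; exact: ltry.
rewrite lebesgue_tupleS.
apply: (@le_lt_trans _ _ (\int[leb]_x ((\1_`[- M, M]%classic x)%:E * lam d (@tbox d M)))%E).
  apply: ge0_le_integral => //.
  - exact: measurable_lebesgue_section (@measurable_tbox d.+1 M).
  - by apply: emeasurable_funM => //; exact/measurable_EFinP/measurable_indic.
  move=> x _; rewrite indicE; case: (boolP (x \in _)) => /=.
    rewrite mul1e => _; apply: le_measure; rewrite ?inE.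
    - exact: (measurable_preimage (measurable_tconsr x) (@measurable_tbox d.+1 M)).
    - exact: measurable_tbox.
    - by move=> t H i; have := H (lift ord0 i); rewrite tnthS.
  rewrite notin_setE/= in_itv/= -ler_norml => Mx.
  rewrite mul0e (_ : mkset _ = set0) ?measure0//.
  by apply/seteqP; split => // t H; have := H (@ord0 d); rewrite tnth0.
rewrite ge0_integralZr//; last exact/measurable_EFinP/measurable_indic.
rewrite integral_indic// setIT lte_mul_pinfty//.
  by rewrite ge0_fin_numE//= lebesgue_measure_itv/=; case: ifP => _; rewrite ?ltry.
Qed.

(** Slicing by the first coordinate gives hyperplanes of lower dimension, unless only the first
    coefficient is nonzero; then all slices but one are empty. *)
Lemma lebesgue_hyperplane d (a : 'cV[R]_d) (c : R) : a != 0 ->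
  lam d [set t | (rV_of t *m a) ord0 ord0 = c] = 0%E.
Proof.
elim: d a c => [|d IH] a c; first by rewrite [a]flatmx0 eqxx.
move=> a0; rewrite lebesgue_tupleS.
pose a' : 'cV[R]_(1 + d) := a.
have E x t : (rV_of (tcons (x, t)) *m a) ord0 ord0 =
   x * usubmx a' ord0 ord0 + (rV_of t *m dsubmx a') ord0 ord0.
  rewrite (_ : a = a')// -{1}[a']vsubmxK rV_of_tcons (@mul_row_col _ 1 1 d) mul_scalar_mx !mxE.
  by [].
have [d0|d0] := eqVneq (dsubmx a') 0; last first.
  apply: integral0_eq => x _.
  rewrite -(IH (dsubmx a') (c - x * usubmx a' ord0 ord0) d0).
  by congr lebesgue_tuple; apply/seteqP; split => t /=; rewrite E; lra.
have u0 : usubmx a' ord0 ord0 != 0.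
  apply: contra_neq a0 => u0; rewrite (_ : a = a')// -[a']vsubmxK d0.
  rewrite (_ : usubmx a' = 0) ?col_mx0//.
  by apply/matrixP => i j; rewrite !ord1 u0 [RHS]mxE.
rewrite -(@integral_set1 R (fun=> lam d setT) (c / usubmx a' ord0 ord0)).
rewrite [RHS]integral_mkcond; apply: eq_integral => x _.
rewrite patchE; case: ifPn; rewrite ?inE ?notin_setE => /= xc.
  congr lebesgue_tuple; apply/seteqP; split => t //= _.
  by rewrite E d0 mulmx0 [X in _ + X]mxE addr0 xc divfK.
rewrite (_ : mkset _ = set0) ?measure0//.
apply/seteqP; split => // t /=; rewrite E d0 mulmx0 [X in _ + X]mxE addr0 => xE.
by apply: xc; rewrite -xE mulfK.
Qed.

End measurable_sets.

(** * Densities on projective spaces *)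

Section homogeneous.
Variable R : realType.
Local Notation rtuple d := (d.-tuple (measurableTypeR R)).
Local Notation lam d := (@lebesgue_tuple R d).
Local Notation leb := (@lebesgue_measure R).

(** The multiplicative Haar measure ds/s restricted to [1, 2], of total mass log 2. Its invariance
    under scaling makes the radial integral over 1 <= s N <= 2 independent of N. *)
Definition log_density (s : R) : R := s^-1 * \1_`[1, 2]%classic s.

Definition log_mass : \bar R := \int[leb]_s (log_density s)%:E.

Lemma measurable_inv : measurable_fun [set: measurableTypeR R] (fun s : R => s^-1 : measurableTypeR R).
Proof.
rewrite -(setvU [set 0]); apply/measurable_funU => //; first exact: measurableC.
split; last exact: measurable_fun_set1.
apply: open_continuous_measurable_fun; first by rewrite openC; exact: (accessible_closed_set1 (hausdorff_accessible (@Rhausdorff R))).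
by move=> x; rewrite inE => x0; apply: inv_continuous; exact/eqP.
Qed.

Lemma log_density_ge0 s : 0 <= log_density s.
Proof.
rewrite /log_density indicE; case: (boolP (_ \in _)) => /=; rewrite ?mulr0//.
by rewrite inE/= in_itv/= => /andP[s1 _]; rewrite mulr1 invr_ge0 (le_trans _ s1).
Qed.

Lemma measurable_log_density : measurable_fun setT (log_density : _ -> measurableTypeR R).
Proof.
by apply: measurable_funM; [exact: measurable_inv|exact: measurable_indic].
Qed.

Lemma log_mass_gt0 : (0 < log_mass)%E.
Proof.
apply: (@lt_le_trans _ _ (\int[leb]_s (2^-1 * \1_`[1, 2]%classic s)%:E)%E); last first.
  apply: ge0_le_integral => //.
  - by apply/measurable_EFinP/measurable_funM => //; exact: measurable_indic.
  - by apply/measurable_EFinP; exact: measurable_log_density.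
  move=> s _; rewrite lee_fin /log_density indicE; case: (boolP (_ \in _)) => /=; rewrite ?mulr0//.
  rewrite inE/= in_itv/= => /andP[s1 s2]; rewrite !mulr1 lef_pV2 ?posrE// (lt_le_trans _ s1)//.
under eq_integral do rewrite EFinM.
rewrite ge0_integralZl_EFin//; last exact/measurable_EFinP/measurable_indic.
rewrite integral_indic// setIT /= lebesgue_measure_itv/= lte_fin ltr1n.
by rewrite -EFinB -EFinM lte_fin mulr_gt0// subr_gt0 ltr1n.
Qed.

Lemma log_mass_lty : (log_mass < +oo)%E.
Proof.
apply: (@le_lt_trans _ _ (\int[leb]_s (\1_`[(1:R), 2]%classic s)%:E)%E).
  apply: ge0_le_integral => //.
  - by move=> x _; rewrite lee_fin log_density_ge0.
  - by apply/measurable_EFinP; exact: measurable_log_density.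
  - exact/measurable_EFinP/measurable_indic.
  move=> s _; rewrite lee_fin /log_density indicE; case: (boolP (_ \in _)) => /=; rewrite ?mulr0//.
  by rewrite inE/= in_itv/= => /andP[s1 s2]; rewrite mulr1 invf_le1// (lt_le_trans _ s1).
rewrite integral_indic// setIT /= lebesgue_measure_itv/= lte_fin ltr1n.
by rewrite -EFinB ltry.
Qed.

Lemma log_mass_scale (a : R) : a != 0 ->
  (\int[leb]_s (`|a| * log_density (a * s))%:E = log_mass)%E.
Proof.
move=> a0; under eq_integral do rewrite EFinM.
have m : measurable_fun setT (fun s : measurableTypeR R => (log_density s)%:E).
  by apply/measurable_EFinP; exact: measurable_log_density.
rewrite ge0_integralZl_EFin//.
- under eq_integral do rewrite -[X in log_density X]addr0.
  rewrite (ge0_integral_affine 0 a0 m) ?muleA -?EFinM ?divff ?mul1e ?normr_eq0//.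
  by move=> s; rewrite lee_fin log_density_ge0.
- by move=> s _; rewrite lee_fin log_density_ge0.
- apply: (measurableT_comp m (g := fun s => a * s)).
  by apply: measurable_funM.
Qed.

Variables (r : nat) (G : rtuple r -> R) (S : set (rtuple r.+1)) (n : rtuple r -> R)
  (Cp Cn : set (rtuple r)).
Hypotheses (mG : measurable_fun setT (G : _ -> measurableTypeR R)) (G0 : forall t, 0 <= G t)
  (mS : measurable S) (n0 : forall t, 0 < n t) (mCp : measurable Cp) (mCn : measurable Cn).
Hypothesis SE : forall s t, s != 0 -> S (tcons (s, taff s%:M 0 t)) <->
  [/\ 1 <= `|s| * n t <= 2, 0 < s -> Cp t & s < 0 -> Cn t].

(** The slice with first coordinate 0, where polar coordinates are undefined, is taken out. *)
Let S' : set (rtuple r.+1) := S `&` [set z | thead z != 0].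

(* The extension of [G] to the cone over the affine chart, homogeneous of degree
   - r - 1: integrating it over the shell [S] in polar form splits off the factor
   [log_mass]. *)
Definition homog (z : rtuple r.+1) : R :=
  `|thead z| ^- r.+1 * G (taff (thead z)^-1%:M 0 [tuple of behead z]) * \1_S' z.

Let spol (z : rtuple r.+1) : rtuple r.+1 :=
  tcons (thead z, taff (thead z)%:M 0 [tuple of behead z]).

Let mS' : measurable S'.
Proof.
apply: measurableI => //.
apply: (@measurable_tnth_preimage R r.+1 ord0 [set x | x != 0]).
rewrite (_ : mkset _ = ~` [set 0]); first exact: measurableC.
by apply/seteqP; split => x /= /eqP.
Qed.

Lemma measurable_thead d : measurable_fun setT (fun z : rtuple d.+1 => thead z).
Proof. exact: measurable_tnth. Qed.

Lemma measurable_tscale_behead (f : rtuple r.+1 -> R) :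
  measurable_fun setT (f : _ -> measurableTypeR R) ->
  measurable_fun setT (fun z : rtuple r.+1 => taff (f z)%:M 0 [tuple of behead z]).
Proof.
move=> mf; apply: measurable_to_rtuple => i.
rewrite (_ : (fun x => _) = fun z => (tnth z (lift ord0 i) * f z : measurableTypeR R)).
  by apply: measurable_funM => //; exact: measurable_tnth.
apply/funext => z; rewrite tnth_mktuple addr0 mul_mx_scalar !mxE mulrC.
by congr (_ * _); rewrite [in RHS](tuple_eta z) tnthS.
Qed.

Lemma measurable_homog : measurable_fun setT (homog : _ -> measurableTypeR R).
Proof.
apply: measurable_funM; last exact: measurable_indic.
apply: measurable_funM.
  apply: (measurableT_comp measurable_inv); apply: measurable_funX.
  by apply: measurableT_comp => //; exact: measurable_thead.
apply: (measurableT_comp mG); apply: measurable_tscale_behead.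
by apply: (measurableT_comp measurable_inv); exact: measurable_thead.
Qed.

Lemma homog_ge0 z : 0 <= homog z.
Proof. by rewrite /homog !mulr_ge0// invr_ge0 exprn_ge0. Qed.

Let kappa (z : rtuple r.+1) : R :=
  `|thead z|^-1 * G [tuple of behead z] * \1_S' (spol z).

Let theadE (s : R) (t : rtuple r) : thead (tcons (s, t)) = s.
Proof. by []. Qed.

Let tbeheadE (s : R) (t : rtuple r) : [tuple of behead (tcons (s, t))] = t.
Proof. exact/val_inj. Qed.

Let mspol : measurable_fun setT spol.
Proof.
apply: (measurableT_comp (@measurable_tcons R r) (g := fun z => (_, _))).
apply/measurable_fun_pairP; split => /=; first exact: measurable_thead.
by apply: measurable_tscale_behead; exact: measurable_thead.
Qed.

Let mkappa : measurable_fun setT (kappa : _ -> measurableTypeR R).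
Proof.
apply: measurable_funM.
  apply: measurable_funM; last first.
    by apply: measurableT_comp => //; exact: measurable_behead.
  apply: (measurableT_comp measurable_inv).
  by apply: measurableT_comp => //; exact: measurable_thead.
by apply: measurableT_comp => //; exact: measurable_indic.
Qed.

Let kappa_ge0 z : 0 <= kappa z.
Proof. by rewrite /kappa !mulr_ge0. Qed.

Lemma tscaleK (s : R) (t : rtuple r) : s != 0 -> taff s^-1%:M 0 (taff s%:M 0 t) = t.
Proof.
by move=> s0; rewrite taffM mul0mx addr0 -scalar_mxM divff// /taff mulmx1 addr0 rV_ofK.
Qed.

(* Substituting y = s t in the fiber over the first coordinate s. *)
Let homog_kappa (s : R) :
  (\int[lam r]_y (homog (tcons (s, y)))%:E = \int[lam r]_t (kappa (tcons (s, t)))%:E)%E.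
Proof.
have [->|s0] := eqVneq s 0.
  rewrite !integral0_eq// => t _; rewrite /homog /kappa indicE memNset ?mulr0//.
    by case=> _ /=; rewrite theadE eqxx.
  by case=> _; rewrite /spol /= !theadE eqxx.
have mh : measurable_fun setT (fun y => (homog (tcons (s, y)))%:E).
  apply/measurable_EFinP.
  exact: (measurableT_comp measurable_homog (measurable_tconsr s)).
have h0 y : (0 <= (homog (tcons (s, y)))%:E)%E by rewrite lee_fin homog_ge0.
have d0 : \det (s%:M : 'M[R]_r) != 0 by rewrite det_scalar expf_neq0.
rewrite -[LHS]mul1e -[1%E]/(1%:E) -(@divff _ (`|s| ^+ r)) ?expf_neq0 ?normr_eq0//.
rewrite EFinM -muleA -normrX -det_scalar -(ge0_integral_taff 0 d0 mh h0).
rewrite -ge0_integralZl_EFin//; last first.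
  exact: (measurableT_comp mh (@measurable_taff R r s%:M 0)).
apply: eq_integral => t _; rewrite -EFinM; congr EFin.
rewrite /homog /kappa /spol !theadE !tbeheadE tscaleK// det_scalar normrX mulrA mulrA.
congr (_ * _ * _).
by rewrite exprS invfM mulrCA divff ?mulr1// expf_neq0// normr_eq0.
Qed.

Lemma indicM_set0 (T : Type) (A : set T) x : x \notin A -> \1_A x = 0 :> R.
Proof. by rewrite indicE => /negbTE ->. Qed.

Let kappaE (s : R) t : kappa (tcons (s, t)) =
  G t * (\1_Cp t * (`|n t| * log_density (n t * s)) + \1_Cn t * (`|- n t| * log_density (- n t * s))).
Proof.
rewrite /kappa /spol theadE tbeheadE normrN (gtr0_norm (n0 t)).
rewrite mulrAC mulrC; congr (_ * _).
have [->|s0] := eqVneq s 0.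
  by rewrite normr0 invr0 mul0r /log_density !mulr0 invr0 !mul0r !mulr0 addr0.
have S'E : S' (tcons (s, taff s%:M 0 t)) <-> S (tcons (s, taff s%:M 0 t)).
  by split => [[]//|H]; split.
have L (a : R) : 0 < a -> n t * log_density (n t * a) = a^-1 * \1_`[1, 2]%classic (n t * a).
  by move=> a0; rewrite /log_density invfM !mulrA divff ?mul1r// gt_eqF.
have L0 (a : R) : a < 0 -> log_density (n t * a) = 0.
  move=> a0; rewrite /log_density indicM_set0 ?mulr0//.
  rewrite notin_setE/= in_itv/= => /andP[h _].
  by have := le_lt_trans h (_ : n t * a < 0); rewrite nmulr_llt0// n0 ltr10 => /(_ isT).
have I (C : set (rtuple r)) (a : R) : (S' (tcons (s, taff s%:M 0 t)) <-> (1 <= a <= 2 /\ C t)) ->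
    \1_S' (tcons (s, taff s%:M 0 t)) = \1_C t * \1_`[1, 2]%classic a :> R.
  move=> H; rewrite !indicE -natrM mulnb; congr (_%:R); congr nat_of_bool.
  apply/idP/andP; rewrite !inE /= in_itv/=.
    by case/(H.1) => ? ?.
  by case=> ? ?; exact/(H.2).
case: (ltgtP s 0) => [sn|sp|se]; last by rewrite se eqxx in s0.
- rewrite L0// mulr0 mulr0 add0r mulNr -mulrN L ?oppr_gt0// ltr0_norm//.
  rewrite (I Cn (n t * - s)); first by rewrite mulrCA mulrA.
  apply: (iff_trans S'E); apply: (iff_trans (SE t s0)); rewrite ltr0_norm// mulrC; split => [[? _ /(_ sn)]//|[? ?]].
  by split => // h; have := lt_trans sn h; rewrite ltxx.
- rewrite mulNr -mulrN (L0 (- s)) ?oppr_lt0// mulr0 mulr0 addr0 L// gtr0_norm//.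
  rewrite (I Cp (n t * s)); first by rewrite mulrCA mulrA.
  apply: (iff_trans S'E); apply: (iff_trans (SE t s0)); rewrite gtr0_norm// mulrC; split => [[? /(_ sp) ? _]//|[? ?]].
  by split => // h; have := lt_trans sp h; rewrite ltxx.
Qed.

(** In polar form z = s (1, t) the Jacobian |s|^r and the homogeneity of degree - r - 1 leave
    ds/|s|. For each [t] the condition 1 <= |s| n(t) <= 2 then contributes [log_mass], once for s >
    0 when [t] is in [Cp] and once for s < 0 when [t] is in [Cn]. *)
Lemma integral_homog :
  (\int[lam r.+1]_z (homog z)%:E =
   log_mass * (\int[lam r]_(t in Cp) (G t)%:E + \int[lam r]_(t in Cn) (G t)%:E))%E.
Proof.
rewrite ge0_integral_tcons; last 2 first.
- by apply/measurable_EFinP; exact: measurable_homog.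
- by move=> z; rewrite lee_fin homog_ge0.
under eq_integral do rewrite homog_kappa.
have mk : measurable_fun setT (fun z => (kappa z)%:E) by exact/measurable_EFinP.
have k0 z : (0 <= (kappa z)%:E)%E by rewrite lee_fin.
rewrite -(@ge0_integral_tcons R r (fun z => (kappa z)%:E))// ge0_integral_tconsC//.
have mI (C : set (rtuple r)) : measurable C ->
    measurable_fun setT (fun t => (G t * \1_C t)%:E).
  by move=> mC; apply/measurable_EFinP; apply: measurable_funM => //; exact: measurable_indic.
have E t : (\int[leb]_s (kappa (tcons (s, t)))%:E =
    log_mass * ((G t * \1_Cp t)%:E + (G t * \1_Cn t)%:E))%E.
  under eq_integral do rewrite kappaE mulrDr EFinD !mulrA -!(mulrA (G t * _)) !EFinM.
  have nt0 : n t != 0 by rewrite gt_eqF.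
  have mL (a : R) : measurable_fun setT (fun s : measurableTypeR R => (`|a| * log_density (a * s))%:E).
    apply/measurable_EFinP; apply: measurable_funM => //.
    by apply: (measurableT_comp measurable_log_density (g := fun s => a * s)); exact: measurable_funM.
  have L0 (a s : R) : (0 <= (`|a| * log_density (a * s))%:E)%E.
    by rewrite lee_fin mulr_ge0// log_density_ge0.
  under eq_integral do rewrite -!EFinM -!mulrA.
  have P (C : set (rtuple r)) a s : (G t * (\1_C t * (`|a| * log_density (a * s))))%:E =
    ((G t * \1_C t)%:E * (`|a| * log_density (a * s))%:E)%E by rewrite -EFinM mulrA.
  under eq_integral do rewrite !P.
  have c0 (C : set (rtuple r)) : (0 <= G t * \1_C t) by rewrite mulr_ge0.
  rewrite ge0_integralD//.
  - rewrite !ge0_integralZl_EFin// !log_mass_scale ?oppr_eq0//.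
    by rewrite [RHS]ge0_muleDr ?lee_fin// !(muleC log_mass).
  - by move=> s _; apply: mule_ge0; [rewrite lee_fin|exact: L0].
  - exact: emeasurable_funM.
  - by move=> s _; apply: mule_ge0; [rewrite lee_fin|exact: L0].
  - exact: emeasurable_funM.
under eq_integral do rewrite E.
have c0 (C : set (rtuple r)) t : (0 <= (G t * \1_C t)%:E)%E by rewrite lee_fin mulr_ge0.
rewrite ge0_integralZl//; last 3 first.
- by apply: emeasurable_funD; exact: mI.
- by move=> t _; rewrite adde_ge0.
- exact/ltW/log_mass_gt0.
rewrite ge0_integralD//; [|exact: mI|exact: mI].
congr (_ * (_ + _))%E; rewrite [RHS]integral_mkcond; apply: eq_integral => t _;
  by rewrite patchE indicE; case: ifPn => _; rewrite ?mulr1 ?mulr0.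
Qed.

End homogeneous.

Section projective_density.
Variables (R : realType) (U : vectType R) (r : nat) (W : {vspace U}).
Local Notation rtuple d := (d.-tuple (measurableTypeR R)).
Local Notation lam d := (@lebesgue_tuple R d).
Implicit Types (w : 'I_r.+1 -> U) (p : U -> ('I_r -> U) -> R).

Definition lincomb d (w : 'I_d -> U) (x : 'rV[R]_d) : U := \sum_i x ord0 i *: w i.

Lemma lincombM d m (w : 'I_d -> U) (A : 'M[R]_(m, d)) (x : 'rV[R]_m) :
  \sum_i x ord0 i *: (\sum_j A i j *: w j) = lincomb w (x *m A).
Proof.
under eq_bigr do rewrite scaler_sumr; rewrite exchange_big /=.
apply: eq_bigr => j _; rewrite mxE scaler_suml.
by apply: eq_bigr => i _; rewrite scalerA.
Qed.

Lemma lincombZ d (w : 'I_d -> U) a x : lincomb w (a *: x) = a *: lincomb w x.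
Proof. by rewrite /lincomb scaler_sumr; apply: eq_bigr => i _; rewrite mxE scalerA. Qed.

Lemma lincombS d (w : 'I_d.+1 -> U) (x : 'rV[R]_d.+1) :
  lincomb w x = x ord0 ord0 *: w ord0 + \sum_j x ord0 (lift ord0 j) *: w (lift ord0 j).
Proof. by rewrite /lincomb big_ord_recl. Qed.

Definition tail w : 'I_r -> U := fun j => w (lift ord0 j).

Definition affine w (t : rtuple r) : U := w ord0 + \sum_j (tnth t j : R) *: tail w j.

Lemma affineE w t : affine w t = lincomb w (rV_of (tcons (1, t))).
Proof.
rewrite lincombS mxE [tnth _ _]/(1 : R) scale1r; congr (_ + _).
by apply: eq_bigr => j _; rewrite mxE tnthS.
Qed.

Lemma lincomb_tscale w (s : R) t : lincomb w (rV_of (tcons (s, taff s%:M 0 t))) = s *: affine w t.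
Proof.
rewrite affineE -lincombZ; congr lincomb; apply/rowP => i; rewrite !mxE.
case: (unliftP ord0 i) => [j ->|->]; last by rewrite [RHS]mulr1.
by rewrite !tnthS tnth_mktuple addr0 mul_mx_scalar !mxE.
Qed.

(** The rules of [fiber_tangent] and [fiber_scale] for nonnegative real values, so that Tonelli's
    theorem applies before any integrability is known. *)
Record is_density p : Prop := IsDensity {
  density_ge0 : forall xi u, 0 <= p xi u ;
  density_det : forall xi u (A : 'M[R]_r), xi \in W -> xi != 0 -> (forall i, u i \in W) ->
    p xi (lin_comb A u) = `|\det A| * p xi u ;
  density_quo : forall xi u c, xi \in W -> xi != 0 -> (forall i, u i \in W) ->
    (forall i, c i \in <[xi]>%VS) -> p xi (u + c) = p xi u ;
  density_scale : forall xi u (a : R), a != 0 -> p (a *: xi) (a *: u) = p xi u }.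

Record is_frame d (w : 'I_d -> U) : Prop := IsFrame {
  frame_mem : forall i, w i \in W ;
  frame_free : forall x, lincomb w x = 0 -> x = 0 }.

Definition cone (C : set U) := forall a xi, 0 < a -> C (a *: xi) <-> C xi.

Definition homogeneous (N : U -> R) :=
  (forall a xi, N (a *: xi) = `|a| * N xi) /\ (forall xi, xi != 0 -> 0 < N xi).

Definition shell (N : U -> R) (C : set U) w : set (rtuple r.+1) :=
  [set z | 1 <= N (lincomb w (rV_of z)) <= 2 /\ C (lincomb w (rV_of z))].

(** The integral over both halves of the double cover. The values are extended reals, finiteness
    being proved later, and the factor one half is left out. *)
Definition projective_integral p (C : set U) w : \bar R :=
  (\int[lam r]_(t in [set t | C (affine w t)]) (p (affine w t) (tail w))%:E +
   \int[lam r]_(t in [set t | C (- affine w t)%R]) (p (affine w t) (tail w))%:E)%E.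

Lemma lincomb_mem d (w : 'I_d -> U) x : is_frame w -> lincomb w x \in W.
Proof. by move=> [wW _]; apply: rpred_sum => i _; apply: rpredZ. Qed.

Lemma affine_neq0 w t : is_frame w -> affine w t != 0.
Proof.
move=> [_ wf]; apply/eqP; rewrite affineE => /wf /rowP/(_ ord0); rewrite !mxE => /eqP.
by rewrite [tnth _ _]/(1 : R) oner_eq0.
Qed.

Lemma affine_mem w t : is_frame w -> affine w t \in W.
Proof. by move=> fw; rewrite affineE lincomb_mem. Qed.

Section integral.
Variables (p : U -> ('I_r -> U) -> R) (N : U -> R) (C : set U).
Hypotheses (dp : is_density p) (hN : homogeneous N) (cC : cone C).

Definition chart_measurable w := [/\ is_frame w,
  measurable_fun setT (fun t : rtuple r => p (affine w t) (tail w) : measurableTypeR R),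
  measurable [set t : rtuple r | C (affine w t)],
  measurable [set t : rtuple r | C (- affine w t)] &
  measurable (shell N C w)].

Let G w t := p (affine w t) (tail w).
Let hom w := homog (G w) (shell N C w).

Let shellE w s t : s != 0 -> shell N C w (tcons (s, taff s%:M 0 t)) <->
  [/\ 1 <= `|s| * N (affine w t) <= 2, 0 < s -> C (affine w t) & s < 0 -> C (- affine w t)].
Proof.
move=> s0; rewrite /shell /= lincomb_tscale hN.1.
split => [[? Cs]|[? Cp Cn]]; split => //.
- by move=> sp; apply/(cC _ sp).
- move=> sn; apply/(cC (a := - s)); rewrite ?oppr_gt0//.
  by rewrite scalerN scaleNr opprK.
- case: (ltgtP s 0) => [sn|sp|se]; last by rewrite se eqxx in s0.
    by rewrite -[s]opprK scaleNr -scalerN; apply/cC; [rewrite oppr_gt0|exact: Cn].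
  by apply/cC => //; exact: Cp.
Qed.

Let homE w : chart_measurable w ->
  (\int[lam r.+1]_z (hom w z)%:E = log_mass R * projective_integral p C w)%E.
Proof.
move=> [fw mG mC1 mC2 mS].
apply: (integral_homog (n := fun t => N (affine w t))) => //.
- by move=> t; exact: density_ge0 dp _ _.
- by move=> t; apply: hN.2; exact: affine_neq0.
- exact: shellE.
Qed.

(** The covectors [tail w] at s xi represent 1/s times the tangent vectors that they represent at
    xi. This accounts for |s|^-r, and a single factor 1/|s| remains. *)
Let homogE w z : is_frame w -> thead z != 0 ->
  hom w z = p (lincomb w (rV_of z)) (tail w) / `|thead z| * \1_(shell N C w) z.
Proof.
move=> fw z0; rewrite /hom /homog /G.
congr (_ * _); last first.
  rewrite !indicE; congr (nat_of_bool _)%:R; apply/idP/idP; rewrite !inE; first by case.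
  by split.
set s := thead z; set t := taff _ _ _.
have zE : z = tcons (s, taff s%:M 0 t).
  rewrite /t taffM mul0mx addr0 -scalar_mxM mulVf// /taff mulmx1 addr0 rV_ofK.
  by rewrite [LHS]tuple_eta.
rewrite [in RHS]zE lincomb_tscale.
have -> : p (s *: affine w t) (tail w) = `|s| ^- r * p (affine w t) (tail w).
  rewrite -[in RHS](density_scale dp _ _ z0).
  have -> : s *: tail w = lin_comb s%:M (tail w).
    apply/funext => i; rewrite /lin_comb (bigD1 i)//= mxE eqxx mulr1n big1 ?addr0// => j ji.
    by rewrite mxE eq_sym (negbTE ji) mulr0n scale0r.
  rewrite (density_det dp); [|by apply: rpredZ; exact: affine_mem| |by move=> i; exact: (frame_mem fw)].
    by rewrite det_scalar normrX mulKf// expf_neq0// normr_eq0.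
  by rewrite scaler_eq0 negb_or z0 affine_neq0.
by rewrite exprS invfM -mulrA mulrC.
Qed.

(** The Jacobian of the projective change of charts: modulo the line through [xi] the new tangent
    vectors are [B] applied to the old ones, and [B] is a Schur complement. *)
Let tail_change w (A : 'M[R]_(1 + r)) (x : 'rV[R]_(1 + r)) :
  is_frame w -> \det A != 0 ->
  let y := x *m A in let w' := lin_comb A w in
  x ord0 ord0 != 0 -> y ord0 ord0 != 0 ->
  p (lincomb w y) (tail w') / `|x ord0 ord0| = `|\det A| * (p (lincomb w y) (tail w) / `|y ord0 ord0|).
Proof.
move=> fw A0 y w' x0 y0; set xi := lincomb w y.
have scE (M : 'M[R]_1) : M = (M ord0 ord0)%:M.
  by apply/matrixP => i j; rewrite !ord1 mxE eqxx mulr1n.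
have xi0 : xi != 0.
  apply/eqP => /(frame_free fw) /rowP/(_ ord0); rewrite !mxE => y00.
  by move: y0; rewrite mxE y00 eqxx.
pose a := dlsubmx A; pose A' := drsubmx A; pose y' := rsubmx y.
pose B := A' - (y ord0 ord0)^-1 *: (a *m y').
(* Replacing the first row of [A] by y = x A multiplies the determinant by x_0; clearing the first
   column below y_0 then leaves the block [B]. *)
have detB : x ord0 ord0 * \det A = y ord0 ord0 * \det B.
  have -> : x ord0 ord0 * \det A = \det (col_mx y (dsubmx A)).
    have -> : col_mx y (dsubmx A) = block_mx (x ord0 ord0)%:M (rsubmx x) 0 1%:M *m A.
      rewrite -[in RHS](vsubmxK A) mul_block_col mul0mx add0r mul1mx; congr col_mx.
      rewrite /y -[in LHS](hsubmxK x) -[in LHS](vsubmxK A) mul_row_col; congr (_ *m _ + _).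
      by rewrite [LHS]scE mxE; congr (x _ _)%:M; exact/val_inj.
    by rewrite det_mulmx det_ublock det1 mulr1 det_scalar1.
  have -> : col_mx y (dsubmx A) = block_mx 1%:M 0 ((y ord0 ord0)^-1 *: a) 1%:M *m
      block_mx (y ord0 ord0)%:M y' 0 B.
    rewrite mulmx_block !mul1mx !mul0mx !addr0 ?mulmx0 mul_mx_scalar scalerA divff// scale1r.
    rewrite -scalemxAl addrCA subrr addr0.
    rewrite /block_mx; congr col_mx.
      rewrite -[LHS](hsubmxK y); congr row_mx.
      by rewrite [LHS]scE mxE; congr (y _ _)%:M; exact/val_inj.
    by rewrite -[LHS](hsubmxK (dsubmx A)).
  by rewrite det_mulmx det_lblock !det1 !mul1r det_ublock det_scalar1.
(* Since xi = y_0 w_0 + (terms in [tail w]), the multiple a_i / y_0 of [xi] is the one that removes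
   the component along w_0. *)
have tE : tail w' = lin_comb B (tail w) + (fun i => (a i ord0 / y ord0 ord0) *: xi).
  apply/funext => i; rewrite [RHS]/GRing.add /= /tail /w' /lin_comb big_ord_recl.
  rewrite /xi lincombS scalerDr scalerA divfK//.
  rewrite addrCA; congr (_ + _).
    by congr (_ *: _); rewrite !mxE; congr (A _ _); exact/val_inj.
  rewrite scaler_sumr -big_split; apply: eq_bigr => j _ /=; rewrite scalerA -scalerDl.
  congr (_ *: _); rewrite !mxE big_ord1 !mxE.
  have -> : lift ord0 j = rshift 1 j by exact/val_inj.
  have -> : lift ord0 i = rshift 1 i by exact/val_inj.
  by rewrite -addrA mulrCA mulrA [X in _ + X](_ : _ = 0) ?addr0// mulrAC -mulrA addNr.
rewrite tE (density_quo dp); first last.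
- by move=> i; apply: rpredZ; exact: memv_line.
- by move=> i; rewrite /lin_comb; apply: rpred_sum => j _; apply: rpredZ; exact: (frame_mem fw).
- by [].
- exact: lincomb_mem.
rewrite (density_det dp)//; [|exact: lincomb_mem|by move=> i; exact: (frame_mem fw)].
have -> : `|\det B| = `|x ord0 ord0| * `|\det A| / `|y ord0 ord0|.
  by rewrite -normrM detB normrM mulrAC divff ?mul1r// normr_eq0.
have nx : `|x ord0 ord0| != 0 by rewrite normr_eq0.
have ny : `|y ord0 ord0| != 0 by rewrite normr_eq0.
have F (c d e f : R) : c != 0 -> e != 0 -> c * d / e * f / c = d * (f / e).
  by move=> c0 f0; field; rewrite ?c0 ?f0.
exact: F.
Qed.

Lemma frame_change d (w : 'I_d -> U) (A : 'M[R]_d) : is_frame w -> \det A != 0 -> is_frame (lin_comb A w).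
Proof.
move=> [wW wf] A0; split=> [i|x].
  by apply: rpred_sum => j _; apply: rpredZ.
rewrite /lincomb lincombM => /wf xA; have uA : A \in unitmx by rewrite unitmxE unitfE.
by rewrite -[x](mulmxK uA) xA mul0mx.
Qed.

(* Both sides are, up to [log_mass], integrals of one homogeneous function over a
   shell, so that a projective change of charts becomes a linear one. *)
Lemma projective_integral_basis w (A : 'M[R]_r.+1) : \det A != 0 ->
  chart_measurable w -> chart_measurable (lin_comb A w) ->
  projective_integral p C (lin_comb A w) = projective_integral p C w.
Proof.
move=> A0 mw mw'.
have [fw mG _ _ mS] := mw; have [fw' mG' _ _ mS'] := mw'.
have mh w0 : chart_measurable w0 -> measurable_fun setT (fun z => (hom w0 z)%:E).
  by move=> [? ? ? ? ?]; apply/measurable_EFinP; exact: measurable_homog.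
have h0 w0 z : (0 <= (hom w0 z)%:E)%E.
  by rewrite lee_fin homog_ge0// => t; exact: density_ge0 dp _ _.
suff E : (\int[lam r.+1]_z (hom (lin_comb A w) z)%:E = \int[lam r.+1]_z (hom w z)%:E)%E.
  move: E; rewrite !homE// => /(congr1 (fun x => (fine (log_mass R))^-1%:E * x)%E).
  have c0 : (0 < fine (log_mass R))%R.
    by apply: fine_gt0; rewrite log_mass_gt0 log_mass_lty.
  have cE : log_mass R = (fine (log_mass R))%:E.
    by rewrite fineK// ge0_fin_numE ?log_mass_lty// ltW// log_mass_gt0.
  by rewrite [in X in X -> _]cE !muleA -!EFinM mulVf ?gt_eqF// !mul1e.
transitivity (\int[lam r.+1]_z (`|\det A|%:E * (hom w (taff A 0 z))%:E))%E; last first.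
  have mt : measurable_fun setT (fun z => (hom w (taff A 0 z))%:E).
    by apply: (measurableT_comp (mh _ mw)); exact: measurable_taff.
  rewrite ge0_integralZl_EFin// (ge0_integral_taff 0 A0 (mh _ mw))// muleA -EFinM.
  by rewrite divff ?mul1e// normr_eq0.
(* The two homogeneous functions are compared off the hyperplanes z_0 = 0 and (z A)_0 = 0, where one
   of the affine charts is not defined; [col0] is the normal of the second. *)
pose col0 := col (ord0 : 'I_(1 + r)) (A : 'M[R]_(1 + r)).
pose e0 : 'cV[R]_(1 + r) := delta_mx ord0 ord0.
pose H a := [set z : rtuple r.+1 | (rV_of z *m (a : 'cV[R]_(1 + r))) ord0 ord0 = 0].
apply: ge0_ae_eq_integral => //.
- exact: mh.
- apply: emeasurable_funM => //.
  by apply: (measurableT_comp (mh _ mw)); exact: measurable_taff.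
- by move=> z _; rewrite mule_ge0.
have HN a : a != 0 -> (lam r.+1).-negligible (H a).
  move=> a0; exists (H a); split => //; last exact: lebesgue_hyperplane.
  rewrite /H; apply: (@measurable_preimage _ _ _ (measurableTypeR R) (fun z => (rV_of z *m a) ord0 ord0) [set 0]) => //.
  exact: measurable_rV_of.
have e00 : e0 != 0.
  by apply/eqP => /matrixP/(_ ord0 ord0); rewrite !mxE !eqxx => /eqP; rewrite oner_eq0.
have c00 : col0 != 0.
  apply: contra_neq A0 => c0; rewrite (expand_det_col _ (ord0 : 'I_(1 + r))) big1// => i _.
  by move/colP: c0 => /(_ i); rewrite !mxE => ->; rewrite mul0r.
apply: (@negligibleS _ _ _ (lam r.+1) (H e0 `|` H col0)); last exact: negligibleU (HN _ e00) (HN _ c00).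
move=> z /= nz; apply: contrapT => /not_orP[n1 n2]; apply: nz => _.
have z0 : (rV_of z) ord0 ord0 != 0.
  by apply/eqP => z0; apply: n1; rewrite /H/= -[RHS]z0 -colE mxE; congr (rV_of z _ _).
have y0 : (rV_of z *m A) ord0 ord0 != 0.
  by apply/eqP => z0'; apply: n2; rewrite /H/= -[RHS]z0' /col0 colE mulmxA -colE mxE.
have zE : thead z = rV_of z ord0 ord0 by rewrite mxE.
have yE : thead (taff A 0 z) = (rV_of z *m A) ord0 ord0.
  by rewrite /thead tnth_mktuple addr0.
rewrite homogE ?zE// homogE ?yE// -EFinM; congr EFin; rewrite mulrA.
have xE : lincomb (lin_comb A w) (rV_of z) = lincomb w (rV_of (taff A 0 z)).
  by rewrite /lincomb lincombM /taff addr0 t_ofK.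
congr (_ * _); last first.
  by rewrite !indicE; congr (nat_of_bool _)%:R; apply/idP/idP; rewrite !inE /shell/= xE.
rewrite xE /taff addr0 t_ofK.
exact: (@tail_change w A (rV_of z)).
Qed.

(** The factor |z_0| in the assumed bound cancels the denominator in [homogE], so the homogeneous
    function is at most [K] on the shell. *)
Lemma projective_integral_le w (K : R) : chart_measurable w -> 0 <= K ->
  (forall z, 1 <= N (lincomb w (rV_of z)) -> p (lincomb w (rV_of z)) (tail w) <= K * `|thead z|) ->
  (log_mass R * projective_integral p C w <= K%:E * lam r.+1 (shell N C w))%E.
Proof.
move=> mw K0 bnd; rewrite -homE//; have [fw mG _ _ mS] := mw.
rewrite -[X in lam _ X]setIT -integral_indic// -ge0_integralZl_EFin//; last first.
  exact/measurable_EFinP/measurable_indic.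
apply: ge0_le_integral => //.
- by move=> z _; rewrite lee_fin homog_ge0// => t; exact: density_ge0 dp _ _.
- by apply/measurable_EFinP; exact: measurable_homog.
- by apply: emeasurable_funM => //; exact/measurable_EFinP/measurable_indic.
move=> z _; rewrite -EFinM lee_fin.
have [z0|z0] := eqVneq (thead z) 0.
  rewrite /hom /homog [X in _ * X <= _]indicE memNset ?mulr0 ?mulr_ge0//.
  by case=> _ /=; rewrite z0 eqxx.
rewrite homogE//; rewrite indicE; case: (boolP (z \in _)); rewrite ?mulr0// !mulr1 inE.
move=> [/andP[/bnd h _] _]; rewrite ler_pdivrMr// normr_gt0//.
Qed.

End integral.
End projective_density.

(** * Charts given by maximal minors *)

Section matrix_charts.
Variables (R : realFieldType).

(** The determinant of Cramer's rule: column [i] of the identity is replaced by [x], and row [i]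
    keeps only its diagonal entry. *)
Lemma det_row1_replaced k (i : 'I_k) (x : 'I_k -> R) :
  \det (\matrix_(a, b) (if b == i then x a else (a == b)%:R)) = x i.
Proof.
set M := \matrix_(a, b) _.
rewrite (expand_det_row M i) (bigD1 i)//= big1 ?addr0; last first.
  by move=> j ji; rewrite mxE (negbTE ji) eq_sym (negbTE ji) mul0r.
rewrite mxE eqxx /cofactor addnn -signr_odd odd_double expr0 mul1r.
rewrite (_ : row' i (col' i M) = 1%:M) ?det1 ?mulr1//.
apply/matrixP => a b; rewrite !mxE eq_sym (negbTE (neq_lift _ _)).
by rewrite (inj_eq lift_inj).
Qed.

Lemma perm_extends k m (f : 'I_k -> 'I_(k + m)) : injective f ->
  exists s : {perm 'I_(k + m)}, forall i, s (lshift m i) = f i.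
Proof.
move=> fI; pose B := [predC mem (codom f)].
have cB : #|B| = m.
  by have := cardC (mem (codom f)); rewrite card_codom// !card_ord => /addnI.
pose g (j : 'I_m) : 'I_(k + m) := enum_val (cast_ord (esym cB) j).
pose h (l : 'I_(k + m)) := match fintype.split l with inl i => f i | inr j => g j end.
have gB j : g j \in B by exact: enum_valP.
have fg i j : f i <> g j.
  by move=> fgE; have := gB j; rewrite -fgE !inE codom_f.
have hI : injective h.
  move=> a b; rewrite /h; case: splitP => i ai; case: splitP => j bj.
  - by move=> /fI ij; apply/val_inj; rewrite /= ai bj ij.
  - by move=> /fg.
  - by move=> /esym/fg.
  - move=> /enum_val_inj/cast_ord_inj ij; apply/val_inj.
    by rewrite /= ai bj ij.
exists (perm hI) => i; rewrite permE /h.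
by rewrite -[lshift m i]/(unsplit (inl i)) unsplitK.
Qed.

Section plucker.
Variables (k r : nat).
Local Notation n := (k + r.+1)%N.
Variable E : 'M[R]_(k, n).

Let minor (s : {perm 'I_n}) := \det (lsubmx (col_perm s E)).

(* The chart is selected by a k-minor of E of maximal absolute value: by Cramer's rule
   the entries of X are quotients of minors by it. *)
Lemma standard_chart (y : 'rV[R]_n) : row_free E -> y != 0 -> E *m y^T = 0 ->
  exists (s : {perm 'I_n}) (A : 'M[R]_k) (X : 'M[R]_(k, r.+1)) (a : R) (Y : 'rV[R]_r),
  [/\ \det A != 0 /\ a != 0, forall i j, `|X i j| <= 1, forall i j, `|Y i j| <= 1,
    col_perm s E = A *m row_mx 1%:M X &
    col_perm s y = a *: (row_mx 1%:M Y *m row_mx (- X^T) 1%:M : 'rV_n)].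
Proof.
move=> fE y0 Ey.
have [s0 ms0] : exists s, minor s != 0.
  have fET : row_full E^T by rewrite /row_full mxrank_tr.
  have [s sE] := perm_extends (@fullrankfun_inj _ _ _ _ fET).
  exists s; rewrite /minor -unitfE -unitmxE -unitmx_tr.
  rewrite (_ : _^T = rowsub (fullrankfun fET) E^T) ?fullrowsub_unit//.
  by apply/matrixP => i j; rewrite !mxE sE.
pose s1 := [arg max_(s > s0) `|minor s|]%O.
have s1P s : `|minor s| <= `|minor s1| by rewrite /s1; case: arg_maxP => //= i _; apply.
(* Ties between maximal minors are broken by the entry of [y] at the first complementary index.
   Exchanging complementary indices keeps the minor, so this entry dominates the other complementary
   ones; this gives the bound on [Y]. *)
have [s s_max] : exists2 s, `|minor s| = `|minor s1| & forall s', `|minor s'| = `|minor s1| ->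
    `|y ord0 (s' (rshift k ord0))| <= `|y ord0 (s (rshift k ord0))|.
  pose P := [pred s | `|minor s| == `|minor s1|].
  have P1 : P s1 by rewrite /= eqxx.
  case: (@arg_maxP _ _ _ s1 P (fun s : {perm 'I_n} => `|y ord0 (s (rshift k ord0))|) P1) => s /= /eqP sE sM.
  by exists s => // s' /eqP; exact: sM.
move=> s_y.
pose A := lsubmx (col_perm s E); pose B := rsubmx (col_perm s E).
have A0 : \det A != 0.
  rewrite -normr_eq0 -/(minor s) s_max gt_eqF//; apply: lt_le_trans (s1P s0).
  by rewrite normr_gt0.
have uA : A \in unitmx by rewrite unitmxE unitfE.
pose X := invmx A *m B.
have EE : col_perm s E = A *m row_mx 1%:M X.
  by rewrite mul_mx_row mulmx1 mulmxA mulmxV// mul1mx hsubmxK.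
pose z := col_perm s y; pose yr := rsubmx z.
(* Orthogonality of [y] to the rows of [E] expresses its first [k] permuted coordinates through the
   remaining ones. *)
have zE : z = yr *m row_mx (- X^T) 1%:M.
  rewrite mul_mx_row mulmx1 -[LHS]hsubmxK; congr row_mx.
  have : col_perm s E *m z^T = 0.
    rewrite /z !col_permE trmx_mul mulmxA -(mulmxA E).
    by rewrite tr_perm_mx invgK -perm_mxM mulVg perm_mx1 mulmx1.
  rewrite EE -[z]hsubmxK tr_row_mx -mulmxA mul_row_col mul1mx => /(congr1 (mulmx (invmx A))).
  rewrite mulmxA mulVmx// mul1mx mulmx0 => /eqP; rewrite addr_eq0 => /eqP/(congr1 trmx).
  by rewrite trmxK => ->; rewrite linearN /= trmx_mul trmxK row_mxKl mulmxN.
have yrE j : yr ord0 j = y ord0 (s (rshift k j)) by rewrite !mxE.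
have yr_max j : `|yr ord0 j| <= `|yr ord0 ord0|.
  rewrite !yrE.
  have := s_y (tperm (rshift k ord0) (rshift k j) * s)%g.
  rewrite permM tpermL; apply.
  rewrite -s_max /minor; congr (`|\det _|); apply/matrixP => a b; rewrite !mxE permM.
  by rewrite tpermD// -val_eqE/= gtn_eqF// ltn_addr.
have yr0 : yr ord0 ord0 != 0.
  apply: contra_neq y0 => yr0.
  have yr00 : yr = 0.
    apply/rowP => j; rewrite [RHS]mxE; apply/eqP; rewrite -normr_le0.
    by rewrite (le_trans (yr_max j))// yr0 normr0.
  have z0 : z = 0 by rewrite zE yr00 mul0mx.
  by apply/rowP => j; move/rowP: z0 => /(_ (s^-1%g j)); rewrite !mxE permKV.
exists s, A, X, (yr ord0 ord0), (\row_j (yr ord0 (lift ord0 j) / yr ord0 ord0)).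
split => //.
- move=> i j.
  pose M := \matrix_(a, b) (if b == i then X a j else (a == b)%:R) : 'M[R]_k.
  (* Exchanging the selected column [i] with the complementary column [j] produces a minor that is X
     i j times the maximal one. *)
  have E1 : lsubmx (col_perm (tperm (lshift r.+1 i) (rshift k j) * s)%g E) = A *m M.
    apply/matrixP => a b; rewrite !mxE permM.
    have BE : B = A *m X by rewrite mulmxA mulmxV// mul1mx.
    have [->|bi] := eqVneq b i.
      rewrite tpermL; move/matrixP: BE => /(_ a j); rewrite !mxE => ->.
      by apply: eq_bigr => c _; rewrite !mxE eqxx.
    rewrite tpermD; last 2 first.
    - by rewrite -val_eqE/= eq_sym.
    - by rewrite -val_eqE/= gtn_eqF// ltn_addr.
    rewrite (bigD1 b)//= big1 ?addr0; last first.
      by move=> c cb; rewrite !mxE (negbTE bi) (negbTE cb) mulr0.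
    by rewrite !mxE (negbTE bi) eqxx mulr1.
  have := s1P (tperm (lshift r.+1 i) (rshift k j) * s)%g.
  rewrite /minor E1 det_mulmx det_row1_replaced normrM -/(minor s1) -s_max -[X in _ <= X]mulr1.
  by rewrite ler_pM2l// normr_gt0.
- move=> i j; rewrite mxE normrM normfV ler_pdivrMr ?normr_gt0// mul1r.
  exact: yr_max.
- rewrite -/z zE scalemxAl; congr (_ *m _); move: yr yr0 {yrE yr_max zE} => yr yr0.
  apply/rowP => j; rewrite [RHS]mxE [X in _ * X]mxE.
  case: splitP => b jb.
    by rewrite !ord1 in jb *; rewrite (_ : j = ord0) ?mxE ?mulr1//; exact/val_inj.
  by rewrite mxE mulrC divfK//; congr (yr _ _); apply/val_inj; rewrite /= jb.
Qed.

End plucker.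

Lemma det_entries_le n (A : 'M[R]_n) : (forall i j, `|A i j| <= 1) -> `|\det A| <= n`!%:R.
Proof.
move=> A1; rewrite /determinant; apply: (le_trans (ler_norm_sum _ _ _)).
rewrite (_ : n`!%:R = \sum_(s : {perm 'I_n}) (1 : R)); last first.
  by rewrite sumr_const card_Sn.
apply: ler_sum => s _; rewrite normrM normr_sign mul1r normr_prod.
by apply: prodr_ile1 => i _; rewrite normr_ge0 A1.
Qed.

(* [T] does not decrease norms, so the entries of its inverse are at most 1. *)
Lemma det_skew_ge (n : nat) (T : 'M[R]_n) : (forall v : 'rV[R]_n, v *m T *m v^T = v *m v^T) ->
  1 <= n`!%:R * `|\det T|.
Proof.
move=> TE.
have vv (v : 'rV[R]_n) : (v *m v^T) ord0 ord0 = \sum_i v ord0 i ^+ 2.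
  by rewrite mxE; apply: eq_bigr => i _; rewrite mxE expr2.
have vv_ge (v : 'rV[R]_n) i : v ord0 i ^+ 2 <= (v *m v^T) ord0 ord0.
  by rewrite vv (bigD1 i)//= lerDl sumr_ge0// => j _; rewrite sqr_ge0.
have uT : T \in unitmx.
  rewrite -row_free_unit -kermx_eq0; apply/eqP/row_matrixP => i; rewrite row0.
  set v := row i _; have vT : v *m T = 0 by rewrite /v -row_mul mulmx_ker row0.
  apply/rowP => j; have := vv_ge v j; rewrite -TE vT mul0mx !mxE => h.
  by apply/eqP; rewrite -sqrf_eq0 eq_le h sqr_ge0.
have TV : forall i j, `|(invmx T) i j| <= 1.
  move=> i j; pose u := row i (invmx T).
  (* As u T is the i-th unit vector, |u|^2 = u T u^T = u_i; with u_i^2 <= |u|^2 this yields u_i <= 1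
     and hence |u| <= 1. *)
  have uTu : (u *m u^T) ord0 ord0 = u ord0 i.
    by rewrite -TE /u -row_mul mulVmx// row1 -rowE !mxE.
  have u1 : u ord0 i <= 1.
    have := vv_ge u i; rewrite uTu; move: (u ord0 i) => a; nra.
  have : u ord0 j ^+ 2 <= 1 by rewrite (le_trans (vv_ge u j))// uTu.
  by rewrite [u ord0 j]mxE ler_norml; move: (invmx T i j) => a h; apply/andP; split; nra.
have := det_entries_le TV; rewrite det_inv normfV => h.
have dT : 0 < `|\det T| by rewrite normr_gt0 -unitfE -unitmxE.
by rewrite -(ler_pM2r dT) mulVf ?gt_eqF// in h.
Qed.

(** The matrix is the identity plus a skew-symmetric one, so its quadratic form is the Euclidean
    one. It is the matrix of a chart frame up to column order, so the Euclidean density is bounded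
    below in the charts. *)
Lemma det_chart_ge k m (X : 'M[R]_(k, m)) :
  1 <= (k + m)`!%:R * `|\det (block_mx 1%:M X (- X^T) 1%:M)|.
Proof.
apply: det_skew_ge => v; rewrite -(hsubmxK v) tr_row_mx mul_row_block !mul_row_col.
rewrite !mulmx1 mulmxDl mulmxDl [X in _ + X = _]addrC addrACA; rewrite -[RHS]addr0; congr (_ + _).
set a := lsubmx v; set b := rsubmx v.
rewrite mulmxN mulNmx (_ : b *m X^T *m a^T = a *m X *m b^T) ?addNr//.
transitivity ((b *m X^T *m a^T)^T); first by apply/matrixP => i j; rewrite [RHS]mxE !ord1.
by rewrite !trmx_mul !trmxK mulmxA.
Qed.

End matrix_charts.

(** * Frames of a subspace and their changes *)

Section frames.
Variables (R : realType) (U : vectType R).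

Lemma frame_free_tuple d (W : {vspace U}) (w : 'I_d -> U) : is_frame W w ->
  free [tuple w i | i < d].
Proof.
move=> [_ wf]; apply/freeP => c cw i.
have := wf (\row_i c i); rewrite /lincomb => /(_ _)/rowP/(_ i); rewrite !mxE; apply.
rewrite -[RHS]cw; apply: eq_bigr => j _.
by rewrite mxE -(tnth_nth 0 [tuple w i | i < d] j) tnth_mktuple.
Qed.

Lemma frame_basis d (W : {vspace U}) (w : 'I_d -> U) : is_frame W w -> \dim W = d ->
  basis_of W [tuple w i | i < d].
Proof.
move=> fw dW; have ff := frame_free_tuple fw.
rewrite basisEfree ff size_tuple dW leqnn andbT.
by apply/span_subvP => v /tnthP[i ->]; rewrite tnth_mktuple; exact: frame_mem fw _.
Qed.

Lemma frame_span d (W : {vspace U}) (w : 'I_d -> U) u : is_frame W w -> \dim W = d ->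
  u \in W -> exists x, u = lincomb w x.
Proof.
move=> fw dW uW; have bw := frame_basis fw dW.
exists (\row_i coord [tuple w i | i < d] i u).
rewrite [LHS](coord_basis bw uW); apply: eq_bigr => j _.
by rewrite mxE -(tnth_nth 0 [tuple w i | i < d] j) tnth_mktuple.
Qed.

Lemma basis_frame d (W : {vspace U}) (b : d.-tuple U) : basis_of W b ->
  is_frame W (tnth b).
Proof.
move=> bW; split=> [i|x]; first exact/(basis_mem bW)/mem_tnth.
rewrite /lincomb; under eq_bigr do rewrite (tnth_nth 0).
by have /freeP bf := basis_free bW; move/bf => x0; apply/rowP => i; rewrite [LHS]x0 mxE.
Qed.

Lemma vbasis_frame d (W : {vspace U}) : \dim W = d ->
  is_frame W (fun i : 'I_d => (vbasis W)`_i).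
Proof.
move=> dW; have := basis_frame (vbasisP W); rewrite -dW.
by congr is_frame; apply/funext => i; rewrite (tnth_nth 0).
Qed.

Lemma frame_lin_comb d (W : {vspace U}) (w u : 'I_d -> U) : is_frame W w -> \dim W = d ->
  (forall i, u i \in W) -> exists A : 'M[R]_d, u = lin_comb A w.
Proof.
move=> fw dW uW.
have /choice[x xE] i : exists x, u i = lincomb w x by exact: (frame_span fw dW (uW i)).
exists (\matrix_(i, j) x i ord0 j); apply/funext => i; rewrite xE.
by apply: eq_bigr => j _; rewrite mxE.
Qed.

Lemma frame_lin_comb_det d (W : {vspace U}) (w : 'I_d -> U) (A : 'M[R]_d) :
  is_frame W w -> is_frame W (lin_comb A w) -> \det A != 0.
Proof.
move=> fw fw'; rewrite -unitfE -unitmxE -row_free_unit -kermx_eq0.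
apply/eqP/row_matrixP => i; rewrite row0; apply: (frame_free fw').
rewrite /lincomb /lin_comb lincombM -row_mul mulmx_ker row0.
by rewrite /lincomb big1// => j _; rewrite mxE scale0r.
Qed.

End frames.

(** * Bases adapted to a subspace and its annihilator *)

Section dual_bases.
Variables (R : realType) (V : vectType R).
Local Notation "V '" := ('Hom(V, R^o)) (at level 8, format "V '").

Lemma dual_vecE k r (b : (k + r.+1).-tuple V) l l' : basis_of {:V} b ->
  dual_vec b l (tnth b l') = (l == l')%:R.
Proof.
by move=> bB; rewrite lfunE /= (tnth_nth 0) coord_free ?(basis_free bB) 1?eq_sym.
Qed.

Lemma dual_ext d (b : d.-tuple V) (xi zeta : V ') : basis_of {:V} b ->
  (forall l, xi (tnth b l) = zeta (tnth b l)) -> xi = zeta.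
Proof.
move=> bB H; apply/lfunP => v; rewrite (coord_basis bB (memvf v)) !linear_sum.
by apply: eq_bigr => i _; rewrite !linearZ/= -(tnth_nth 0) H.
Qed.

Section chart.
Variables (k r : nat) (b : (k + r.+1).-tuple V) (bB : basis_of {:V} b) (z : chart_dom R k r).

Lemma chart_c_low j i : chart_c b z j (tnth b (lshift r.+1 i)) = - z.1 i j.
Proof.
rewrite /chart_c add_lfunE opp_lfunE dual_vecE// sum_lfunE.
rewrite eq_rlshift sub0r (bigD1 i)//= scale_lfunE dual_vecE// eqxx.
rewrite big1 ?addr0 ?[_ *: _]mulr1// => a ai.
by rewrite scale_lfunE dual_vecE// eq_lshift (negbTE ai) scaler0.
Qed.

Lemma chart_c_high j l : chart_c b z j (tnth b (rshift k l)) = (j == l)%:R.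
Proof.
rewrite /chart_c add_lfunE opp_lfunE dual_vecE// sum_lfunE eq_rshift.
rewrite big1 ?subr0// => a _.
by rewrite scale_lfunE dual_vecE// eq_lrshift scaler0.
Qed.

Lemma chart_c_chart_e j i : chart_c b z j (chart_e b z i) = 0.
Proof.
rewrite /chart_e linearD linear_sum /= chart_c_low (bigD1 j)//= linearZ/= chart_c_high eqxx.
rewrite big1 ?addr0 => [|l lj]; first by rewrite [_ *: _]mulr1 addNr.
by rewrite linearZ/= chart_c_high eq_sym (negbTE lj) scaler0.
Qed.

Lemma chart_annihilator (eta : V ') : (forall i, eta (chart_e b z i) = 0) ->
  eta = \sum_j eta (tnth b (rshift k j)) *: chart_c b z j.
Proof.
move=> eta0; apply: (dual_ext bB) => l; rewrite sum_lfunE.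
rewrite -[l]splitK; case: fintype.splitP => i _ /=.
  have := eta0 i; rewrite /chart_e linearD linear_sum => /eqP.
  rewrite addr_eq0 => /eqP ->; rewrite -sumrN; apply: eq_bigr => j _.
  by rewrite scale_lfunE chart_c_low linearZ/= [in RHS]/GRing.scale/= mulrN mulrC.
rewrite (bigD1 i)//= scale_lfunE chart_c_high eqxx [_ *: _]mulr1 big1 ?addr0// => j ji.
by rewrite scale_lfunE chart_c_high (negbTE ji) scaler0.
Qed.
End chart.

Lemma basis_extending k r (E : {vspace V}) : \dim {:V} = (k + r.+1)%N -> \dim E = k ->
  exists2 b : (k + r.+1).-tuple V, basis_of {:V} b &
    forall i, tnth b (lshift r.+1 i) = (vbasis E)`_i.
Proof.
move=> dV dE.
have e1 : (\dim E + \dim E^C)%N = (k + r.+1)%N by rewrite dimv_compl dE dV subnKC// leq_addr.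
exists (tcast e1 [tuple of vbasis E ++ vbasis (E^C)%VS]).
  rewrite val_tcast -(addv_complf E); apply: cat_basis; [|exact: vbasisP|exact: vbasisP].
  exact/directv_addP/capv_compl.
by move=> i; rewrite (tnth_nth 0) val_tcast nth_cat size_tuple [X in (_ < X)%N]dE /= ltn_ord.
Qed.

Section annihilator.
Variables (k r : nat) (E : {vspace V}).
Hypotheses (dV : \dim {:V} = (k + r.+1)%N) (dE : \dim E = k).

Lemma dim_annihilator : \dim (annihilator E) = r.+1.
Proof.
have [b bB be] := basis_extending dV dE.
(* At the origin of the chart E is spanned by the first [k] basis vectors, so [chart_c] is a basis
   of the annihilator of E. *)
pose z : chart_dom R k r := (0, 0).
have ce i : chart_e b z i = (vbasis E)`_i.
  by rewrite /chart_e be big1 ?addr0// => j _; rewrite mxE scale0r.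
have fc : is_frame (annihilator E) (chart_c b z).
  split=> [j|x xc].
    apply/annihilatorP => v /coord_vbasis ->; rewrite linear_sum big1// => i _.
    have iE : (i < k)%N by rewrite -dE.
    by rewrite linearZ/= -(ce (Ordinal iE)) chart_c_chart_e// scaler0.
  apply/rowP => j; have := congr1 (fun xi : V ' => xi (tnth b (rshift k j))) xc.
  rewrite /lincomb sum_lfunE zero_lfunE (bigD1 j)//= scale_lfunE chart_c_high// eqxx.
  rewrite [_ *: _]mulr1 big1 ?addr0 ?mxE// => i ij.
  by rewrite scale_lfunE chart_c_high// (negbTE ij) scaler0.
have : basis_of (annihilator E) [tuple chart_c b z j | j < r.+1].
  rewrite basisEdim; apply/andP; split.
    apply/subvP => eta /annihilatorP etaE.
    rewrite (@chart_annihilator k r b bB z eta); last first.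
      by move=> i; rewrite ce etaE// vbasis_mem// mem_nth// size_tuple dE.
    apply: rpred_sum => j _; apply: rpredZ; apply/memv_span/tnthP; exists j.
    by rewrite tnth_mktuple.
  rewrite size_tuple -(size_tuple [tuple chart_c b z j | j < r.+1]).
  rewrite -(eqP (frame_free_tuple fc)); apply/dimvS/span_subvP => v /tnthP[j ->].
  by rewrite tnth_mktuple; exact: frame_mem fc _.
by move/size_basis.
Qed.

(** Smoothness of a section is known only in charts coming from bases of V. This realizes arbitrary
    frames [e] and [w] as the chart frames at X = 0, so that continuity along the affine chart of
    [w] follows. *)
Lemma adapted_basis (e : 'I_k -> V) (w : 'I_r.+1 -> V ') :
  is_frame E e -> is_frame (annihilator E) w ->
  exists2 b : (k + r.+1).-tuple V, basis_of {:V} b &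
    (forall i, tnth b (lshift r.+1 i) = e i) /\ (forall j, dual_vec b (rshift k j) = w j).
Proof.
move=> fe fw; have [b1 b1B be] := basis_extending dV dE.
(* [M] evaluates [w] on a complement of E. It is invertible because a combination of the [w j]
   vanishing on E and on the complement is zero; its inverse gives vectors dual to [w]. *)
pose M : 'M[R]_r.+1 := \matrix_(j, l) w j (tnth b1 (rshift k l)).
have uM : M \in unitmx.
  rewrite -row_free_unit -kermx_eq0; apply/eqP/row_matrixP => i; rewrite row0.
  set y := row i _; have yM : y *m M = 0 by rewrite /y -row_mul mulmx_ker row0.
  apply: (frame_free fw); apply: (dual_ext b1B) => l; rewrite zero_lfunE.
  rewrite -[l]splitK; case: fintype.splitP => a _ /=.
    have /annihilatorP := lincomb_mem y fw; apply.
    by rewrite be vbasis_mem// mem_nth// size_tuple dE.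
  move/rowP: yM => /(_ a); rewrite !mxE => <-; rewrite /lincomb sum_lfunE.
  by apply: eq_bigr => j _; rewrite scale_lfunE !mxE.
pose v l := \sum_p (invmx M) p l *: tnth b1 (rshift k p).
have wv j l : w j (v l) = (j == l)%:R.
  have := mulmxV uM => /matrixP/(_ j l); rewrite !mxE => <-.
  by rewrite linear_sum; apply: eq_bigr => p _; rewrite linearZ/= mxE mulrC.
have we j i : w j (e i) = 0.
  by have /annihilatorP := frame_mem fw j; apply; exact: frame_mem fe i.
pose b := [tuple (match fintype.split l with inl i => e i | inr j => v j end) | l < k + r.+1].
have bl i : tnth b (lshift r.+1 i) = e i.
  by rewrite tnth_mktuple -[lshift _ i]/(unsplit (inl i)) unsplitK.
have br j : tnth b (rshift k j) = v j.
  by rewrite tnth_mktuple -[rshift _ j]/(unsplit (inr j)) unsplitK.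
have bB : basis_of {:V} b.
  rewrite basisEfree subvf size_tuple dV leqnn !andbT; apply/freeP => c.
  under eq_bigr do rewrite -tnth_nth.
  rewrite big_split_ord /=; under eq_bigr do rewrite bl.
  under [X in _ + X = _]eq_bigr do rewrite br.
  move=> c0.
  have cr j : c (rshift k j) = 0.
    have := congr1 (w j) c0; rewrite linearD !linear_sum linear0/=.
    rewrite big1 ?add0r => [|i _]; last by rewrite linearZ/= we scaler0.
    rewrite (bigD1 j)//= linearZ/= wv eqxx [_ *: _]mulr1 big1 ?addr0// => i ij.
    by rewrite linearZ/= wv eq_sym (negbTE ij) scaler0.
  have cl : \row_i c (lshift r.+1 i) = 0.
    apply: (frame_free fe); rewrite -[RHS]c0 [X in _ = _ + X]big1 ?addr0.
      by apply: eq_bigr => i _; rewrite mxE.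
    by move=> j _; rewrite cr scale0r.
  move=> l; rewrite -[l]splitK; case: fintype.splitP => a _ /=; last exact: cr.
  by move/rowP: cl => /(_ a); rewrite !mxE.
exists b => //; split=> // j; apply: (dual_ext bB) => l; rewrite dual_vecE//.
rewrite -[l]splitK; case: fintype.splitP => a _ /=.
  by rewrite bl we eq_rlshift.
by rewrite br wv eq_rshift.
Qed.

End annihilator.

Lemma section_affine k r (f : pre_section V k r) (E : {vspace V}) (e : 'I_k -> V) (w : 'I_r.+1 -> V ') :
  \dim {:V} = (k + r.+1)%N -> \dim E = k -> is_frame E e -> is_frame (annihilator E) w ->
  exists2 b : (k + r.+1).-tuple V, basis_of {:V} b & forall t : r.-tuple (measurableTypeR R),
    f (E, <[affine w t]>%VS) (e, affine w t, tail w) = local_rep b (0, rV_of t) f.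
Proof.
move=> dV dE fe fw; have [b bB [be bw]] := adapted_basis dV dE fe fw.
exists b => // t; rewrite /local_rep.
have ec : chart_e b (0, rV_of t) = e.
  by apply/funext => i; rewrite /chart_e be big1 ?addr0// => j _; rewrite mxE scale0r.
have cc j : chart_c b (0, rV_of t) j = w j.
  by rewrite /chart_c bw big1 ?subr0// => i _; rewrite mxE scale0r.
have etac : chart_eta b (0, rV_of t) = tail w by apply/funext => j; exact: cc.
have xic : chart_xi b (0, rV_of t) = affine w t.
  by rewrite /chart_xi cc; congr (_ + _); apply: eq_bigr => j _; rewrite etac mxE.
rewrite ec xic etac; congr (f (_, _) _).
rewrite (_ : [seq e i | i : 'I_k] = [tuple e i | i < k]) ?(span_basis (frame_basis fe dE))//.
Qed.

Definition part (b : bool) (c : R[i]) : R := if b then complex.Re c else complex.Im c.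

Lemma continuous_local_rep k r (f : smooth_section V k r) (c : (k + r.+1).-tuple V) (b : bool) :
  basis_of {:V} c -> continuous (fun z => part b (local_rep c z f)).
Proof.
move=> cB; have /asboolP fs := valP f.
have [sr si] := section_smooth fs (exist (fun c : _.-tuple V => basis_of {:V} c) c cB).
by case: b; [exact: (sr [::]).2|exact: (si [::]).2].
Qed.

Lemma measurable_section k r (f : smooth_section V k r) (E : {vspace V}) (e : 'I_k -> V)
    (w : 'I_r.+1 -> V ') (b : bool) :
  \dim {:V} = (k + r.+1)%N -> \dim E = k -> is_frame E e -> is_frame (annihilator E) w ->
  measurable_fun setT (fun t : r.-tuple (measurableTypeR R) =>
    part b (section_val f (E, <[affine w t]>%VS) (e, affine w t, tail w)) : measurableTypeR R).
Proof.
move=> dV dE fe fw.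
have [c cB fc] := section_affine (section_val f) dV dE fe fw.
under eq_fun do rewrite fc.
apply: (@measurable_fun_rV_of _ _ (fun Y => part b (local_rep c (0, Y) f))) => Y.
apply: (continuous_comp (f := fun Y => (0 : 'M[R]_(k, r.+1), Y)) (g := fun z => part b (local_rep c z f))).
  exact: (@cvg_pair _ _ _ (nbhs Y) (nbhs (0 : 'M[R]_(k, r.+1))) (nbhs Y) _ _ _ (fun=> 0) (fun x => x) (cvg_cst _) cvg_id).
exact: continuous_local_rep.
Qed.

End dual_bases.

Section lin_comb_theory.
Variables (R : realType) (U : lmodType R).

Lemma lin_combM d (A B : 'M[R]_d) (u : 'I_d -> U) : lin_comb A (lin_comb B u) = lin_comb (A *m B) u.
Proof.
apply/funext => i; rewrite /lin_comb; under eq_bigr do rewrite scaler_sumr.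
rewrite exchange_big /=; apply: eq_bigr => j _; rewrite mxE scaler_suml.
by apply: eq_bigr => l _; rewrite scalerA.
Qed.

Lemma lin_comb1 d (u : 'I_d -> U) : lin_comb 1%:M u = u.
Proof.
apply/funext => i; rewrite /lin_comb (bigD1 i)//= mxE eqxx scale1r big1 ?addr0// => j ji.
by rewrite mxE eq_sym (negbTE ji) scale0r.
Qed.

Lemma lin_comb_scalar d (a : R) (u : 'I_d -> U) : lin_comb a%:M u = a *: u.
Proof.
apply/funext => i; rewrite /lin_comb (bigD1 i)//= mxE eqxx mulr1n big1 ?addr0// => j ji.
by rewrite mxE eq_sym (negbTE ji) mulr0n scale0r.
Qed.

End lin_comb_theory.

Section part_theory.
Variable R : realType.
Implicit Types (a : R) (c : R[i]).

Lemma partZ b a c : part b (a%:C%C * c) = a * part b c.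
Proof.
by case: b; rewrite /part; case: c => x y /=; rewrite ?mul0r ?subr0 ?addr0.
Qed.

Lemma part0 b : part b (0 : R[i]) = 0.
Proof. by case: b. Qed.

Lemma part_norm_le b c : `|part b c|%:C%C <= `|c|.
Proof.
case: b; rewrite /part; case: c => x y /=; rewrite normc_def lecR;
  rewrite -sqrtr_sqr ler_wsqrtr// ?lerDl ?lerDr ?sqr_ge0//.
Qed.

End part_theory.

(** * Comparison of sections with the Euclidean density *)

Section coordinates.
Variables (R : realType) (V : vectType R) (k r : nat).
Local Notation "V '" := ('Hom(V, R^o)) (at level 8, format "V '").
Local Notation n := (k + r.+1)%N.
Variables (b0 : n.-tuple V) (b0B : basis_of {:V} b0).

Definition crd (v : V) : 'rV[R]_n := \row_i coord b0 i v.
Definition dcrd (xi : V ') : 'rV[R]_n := \row_i (xi (tnth b0 i) : R).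

Lemma crd_inj : injective crd.
Proof.
move=> u v uv; rewrite (coord_basis b0B (memvf u)) (coord_basis b0B (memvf v)).
by apply: eq_bigr => i _; move/rowP: uv => /(_ i); rewrite !mxE => ->.
Qed.

Lemma dcrd_inj : injective dcrd.
Proof.
move=> u v uv; apply: (dual_ext b0B) => l.
by move/rowP: uv => /(_ l); rewrite !mxE.
Qed.

Lemma crd_lincomb d (u : 'I_d -> V) x : crd (lincomb u x) = x *m \matrix_i crd (u i).
Proof.
apply/rowP => l; rewrite !mxE linear_sum; apply: eq_bigr => i _.
by rewrite linearZ/= !mxE.
Qed.

Lemma dcrd_lincomb d (u : 'I_d -> V ') x : dcrd (lincomb u x) = x *m \matrix_i dcrd (u i).
Proof.
apply/rowP => l; rewrite !mxE sum_lfunE; apply: eq_bigr => i _.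
by rewrite scale_lfunE !mxE.
Qed.

Lemma pairingE (xi : V ') v : (crd v *m (dcrd xi)^T) ord0 ord0 = xi v.
Proof.
rewrite mxE [in RHS](coord_basis b0B (memvf v)) linear_sum; apply: eq_bigr => i _.
by rewrite !mxE linearZ/= (tnth_nth 0).
Qed.

Lemma crd_lin_comb d (A : 'M[R]_d) (u : 'I_d -> V) :
  \matrix_i crd (lin_comb A u i) = A *m \matrix_i crd (u i).
Proof.
apply/row_matrixP => i; rewrite rowK row_mul -crd_lincomb /lincomb /lin_comb.
by congr crd; apply: eq_bigr => j _; rewrite mxE.
Qed.

Lemma dcrd_lin_comb d (A : 'M[R]_d) (u : 'I_d -> V ') :
  \matrix_i dcrd (lin_comb A u i) = A *m \matrix_i dcrd (u i).
Proof.
apply/row_matrixP => i; rewrite rowK row_mul -dcrd_lincomb /lincomb /lin_comb.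
by congr dcrd; apply: eq_bigr => j _; rewrite mxE.
Qed.

(** Vectors and covectors are rows of one square matrix, which amounts to identifying V with its
    dual through [b0]. The absolute value of its determinant is a Euclidean density in the two
    frames. *)
Definition frame_mx (e : 'I_k -> V) (w : 'I_r.+1 -> V ') : 'M[R]_n :=
  col_mx (\matrix_i crd (e i)) (\matrix_j dcrd (w j)).

Lemma frame_mx_lin_comb (A : 'M[R]_k) (B : 'M[R]_r.+1) e w :
  \det (frame_mx (lin_comb A e) (lin_comb B w)) = \det A * \det B * \det (frame_mx e w).
Proof.
rewrite /frame_mx crd_lin_comb dcrd_lin_comb.
rewrite -[X in col_mx X _]addr0 -[X in col_mx _ X]add0r -(mul0mx _ (\matrix_j dcrd (w j))) -[X in col_mx _ (X + _)](mul0mx _ (\matrix_i crd (e i))).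
by rewrite -mul_block_col det_mulmx det_ublock.
Qed.

Definition cons_frame (xi : V ') (eta : 'I_r -> V ') : 'I_r.+1 -> V ' :=
  fun j => oapp eta xi (unlift ord0 j).

Lemma cons_frame0 xi eta : cons_frame xi eta ord0 = xi.
Proof. by rewrite /cons_frame unlift_none. Qed.

Lemma cons_frameS xi eta j : cons_frame xi eta (lift ord0 j) = eta j.
Proof. by rewrite /cons_frame liftK. Qed.

Definition permuted (s : {perm 'I_n}) : n.-tuple V := [tuple tnth b0 (s l) | l < n].

Lemma permutedP s : basis_of {:V} (permuted s).
Proof.
suff : perm_eq (permuted s) b0 by move/perm_basis => ->.
have -> : tval (permuted s) = map (tnth b0) (map s (enum 'I_n)) by rewrite -map_comp.
rewrite -[X in perm_eq _ X](map_tnth_enum b0).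
apply: perm_map; apply: uniq_perm.
- by rewrite (map_inj_uniq (@perm_inj _ s)) enum_uniq.
- exact: enum_uniq.
move=> i; rewrite mem_enum inE; apply/mapP; exists (s^-1%g i); rewrite ?mem_enum//.
by rewrite permKV.
Qed.

Section chart.
Variables (s : {perm 'I_n}) (z : chart_dom R k r).
Local Notation c := (permuted s).

Lemma crd_permuted l l' : crd (tnth c l) ord0 (s l') = (l == l')%:R.
Proof.
rewrite mxE tnth_mktuple (tnth_nth 0) coord_free ?(basis_free b0B)//.
by rewrite -val_eqE /= -val_eqE/= (inj_eq val_inj) (inj_eq perm_inj).
Qed.

Lemma crd_chart_e : col_perm s (\matrix_i crd (chart_e c z i)) = row_mx 1%:M z.1.
Proof.
apply/matrixP => i l; rewrite !mxE /chart_e linearD linear_sum /=.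
have E l1 : coord b0 (s l) (tnth c l1) = (l1 == l)%:R.
  by rewrite -crd_permuted mxE.
rewrite E; under eq_bigr do rewrite linearZ/= E.
case: splitP => a la.
  have -> : l = lshift r.+1 a by exact/val_inj.
  rewrite mxE eq_lshift big1 ?addr0// => j _.
  by rewrite eq_rlshift mulr0.
have -> : l = rshift k a by exact/val_inj.
rewrite eq_lrshift add0r (bigD1 a)//= eqxx mulr1 big1 ?addr0// => j ja.
by rewrite eq_rshift (negbTE ja) mulr0.
Qed.

Lemma dcrd_chart_c : col_perm s (\matrix_j dcrd (chart_c c z j)) = row_mx (- z.1^T) 1%:M.
Proof.
apply/matrixP => j l; rewrite !mxE.
have -> : tnth b0 (s l) = tnth c l by rewrite tnth_mktuple.
case: splitP => a la.
  have -> : l = lshift r.+1 a by exact/val_inj.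
  by rewrite (chart_c_low (permutedP s)) !mxE.
have -> : l = rshift k a by exact/val_inj.
by rewrite (chart_c_high (permutedP s)) !mxE.
Qed.

Let Y1 : 'rV[R]_r.+1 := (row_mx 1%:M z.2 : 'rV[R]_(1 + r)).

Lemma chart_xiE : chart_xi c z = lincomb (chart_c c z) Y1.
Proof.
have E0 : Y1 ord0 ord0 = 1.
  rewrite /Y1 mxE; case: splitP => a /= la; last by [].
  by rewrite !ord1 mxE.
have ES j : Y1 ord0 (lift ord0 j) = z.2 ord0 j.
  rewrite /Y1 mxE; case: splitP => a la; first by rewrite ord1 in la.
  by congr (z.2 _ _); apply/val_inj; move: la => /= [].
rewrite lincombS E0 scale1r; congr (_ + _).
by apply: eq_bigr => j _; rewrite ES.
Qed.

(** Passing from [chart_c] to [chart_xi] and [chart_eta] is a unipotent row operation, and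
    reordering the columns by [s] changes only the sign. *)
Lemma det_frame_chart :
  `|\det (frame_mx (chart_e c z) (cons_frame (chart_xi c z) (chart_eta c z)))| =
  `|\det (block_mx 1%:M z.1 (- z.1^T) 1%:M)|.
Proof.
pose U : 'M[R]_r.+1 := (block_mx 1%:M z.2 0 1%:M : 'M[R]_(1 + r)).
have -> : cons_frame (chart_xi c z) (chart_eta c z) = lin_comb U (chart_c c z).
  apply/funext => j; case: (unliftP ord0 j) => [i ->|->].
    rewrite cons_frameS /lin_comb (bigD1 (lift ord0 i))//= big1 ?addr0; last first.
      move=> l li; rewrite (_ : U _ _ = 0) ?scale0r//.
      rewrite /U mxE; case: splitP => a la; first by rewrite ord1 in la.
      rewrite mxE; case: splitP => a' la'; rewrite ?mxE//.
      rewrite (_ : (a == a') = false)//; apply: contraNF li => /eqP aa.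
      by apply/eqP/val_inj; rewrite /= la' -aa -la.
    rewrite (_ : U _ _ = 1) ?scale1r//.
    rewrite /U mxE; case: splitP => a la; first by rewrite ord1 in la.
    rewrite mxE; case: splitP => a' la'; first by rewrite ord1 in la'.
    rewrite mxE (_ : a = a') ?eqxx//; apply/val_inj/eqP.
    by rewrite -(eqn_add2l 1) -la -la'.
  rewrite cons_frame0 chart_xiE; apply: eq_bigr => l _; congr (_ *: _).
  rewrite /U [RHS]mxE; case: splitP => a la; last by [].
  by rewrite [a]ord1.
rewrite -[X in frame_mx X _]lin_comb1 frame_mx_lin_comb det1 mul1r.
have -> : \det U = 1.
  by have := @det_ublock R 1 r 1%:M z.2 1%:M; rewrite !det1 mulr1.
rewrite mul1r.
have := det_mulmx (frame_mx (chart_e c z) (chart_c c z)) (perm_mx s^-1%g).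
rewrite -col_permE det_perm => /(congr1 (fun x => `|x|)).
rewrite normrM normr_sign mulr1 => <-; congr (`|\det _|).
rewrite /block_mx -crd_chart_e -dcrd_chart_c.
by apply/matrixP => i j; rewrite !mxE; case: splitP => a _; rewrite !mxE.
Qed.

(** Each coordinate is a sum of r + 1 products of two entries of absolute value at most 1. *)
Lemma dcrd_chart_xi_le : (forall i j, `|z.1 i j| <= 1) -> (forall j, `|z.2 ord0 j| <= 1) ->
  `|dcrd (chart_xi c z)| <= r.+1%:R.
Proof.
move=> X1 Y2; rewrite [leLHS]mx_normrE; apply/bigmax_leP; split => // -[i l] _ /=.
rewrite ord1 -[l](permKV s); set l' := (s^-1%g l).
have -> : dcrd (chart_xi c z) ord0 (s l') = (Y1 *m row_mx (- z.1^T) 1%:M) ord0 l'.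
  by rewrite chart_xiE dcrd_lincomb -dcrd_chart_c !mxE; apply: eq_bigr => j _; rewrite !mxE.
rewrite mxE; apply: (le_trans (ler_norm_sum _ _ _)).
rewrite -[X in _ <= X](_ : \sum_(j < r.+1) 1 = _); last by rewrite sumr_const card_ord.
apply: ler_sum => j _; rewrite normrM mulr_ile1//.
  rewrite /Y1 mxE; case: splitP => a _; last exact: Y2.
  by rewrite !ord1 mxE normr1.
rewrite mxE; case: splitP => a _; rewrite !mxE; first by rewrite normrN.
by case: (_ == _); rewrite ?normr1 ?normr0.
Qed.

End chart.

Definition unit_cube : set (chart_dom R k r) :=
  [set z : chart_dom R k r | (forall i j, `|z.1 i j| <= 1) /\ (forall j, `|z.2 ord0 j| <= 1)].

Lemma frame_row_free (E : {vspace V}) (e : 'I_k -> V) : is_frame E e ->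
  row_free (\matrix_i crd (e i)).
Proof.
move=> fe; rewrite -kermx_eq0; apply/eqP/row_matrixP => i; rewrite row0.
apply: (frame_free fe); apply: crd_inj; rewrite crd_lincomb -row_mul mulmx_ker row0.
by apply/rowP => j; rewrite !mxE linear0.
Qed.

Lemma col_perm_inj m (s : {perm 'I_n}) : injective (@col_perm R m n s).
Proof.
move=> A B AB; apply/matrixP => i j; move/matrixP: AB => /(_ i (s^-1%g j)).
by rewrite !mxE permKV.
Qed.

Lemma in_standard_chart (E : {vspace V}) (l : {vspace V '}) (xi : V ') :
  in_Gk k E l -> xi \in l -> xi != 0 ->
  exists (s : {perm 'I_n}) (z : chart_dom R k r) (a : R),
  [/\ unit_cube z, a != 0, is_frame E (chart_e (permuted s) z),
      xi = a *: chart_xi (permuted s) z &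
      forall i, chart_xi (permuted s) z (chart_e (permuted s) z i) = 0].
Proof.
move=> [dE dl lE] xil xi0.
pose eb i : V := (vbasis E)`_(i : 'I_k).
have fe : is_frame E eb by exact: vbasis_frame.
have rf := frame_row_free fe.
have y0 : dcrd xi != 0.
  apply: contra_neq xi0 => xi0; apply: dcrd_inj; rewrite xi0.
  by apply/rowP => j; rewrite !mxE zero_lfunE.
have xiE : xi \in annihilator E by apply: subvP lE _ xil.
have Ey : (\matrix_i crd (eb i)) *m (dcrd xi)^T = 0.
  apply/matrixP => i j; rewrite [RHS]mxE ord1.
  have /annihilatorP := xiE => /(_ _ (frame_mem fe i)); rewrite -pairingE => <-.
  by rewrite !mxE; apply: eq_bigr => a _; rewrite !mxE.
have [s [A [X [a [Y [[A0 a0] X1 Y1 EE yE]]]]]] := standard_chart rf y0 Ey.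
pose z : chart_dom R k r := (X, Y).
have ebE : eb = lin_comb A (chart_e (permuted s) z).
  apply/funext => i; apply: crd_inj.
  suff : \matrix_i crd (eb i) = A *m \matrix_i crd (chart_e (permuted s) z i).
    by rewrite -crd_lin_comb => /row_matrixP/(_ i); rewrite !rowK.
  apply: (@col_perm_inj _ s); rewrite EE -[in LHS](crd_chart_e s z).
  by rewrite !col_permE mulmxA.
have fc : is_frame E (chart_e (permuted s) z).
  have -> : chart_e (permuted s) z = lin_comb (invmx A) eb.
    by rewrite ebE lin_combM mulVmx ?lin_comb1// unitmxE unitfE.
  by apply: frame_change => //; rewrite det_inv invr_neq0.
exists s, z, a; split => //.
- apply: dcrd_inj; apply: (@col_perm_inj _ s); rewrite yE.
  rewrite chart_xiE -lincombZ dcrd_lincomb [RHS]col_permE -mulmxA -col_permE.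
  by rewrite dcrd_chart_c scalemxAl.
- move=> i; rewrite chart_xiE /lincomb sum_lfunE big1// => j _.
  by rewrite scale_lfunE (chart_c_chart_e (permutedP s)) scaler0.
Qed.

(** Both sides scale alike under changes of [e] and of [eta] modulo [xi], and also under xi -> a xi,
    where |a|^-r times |a|^(r+1) matches the factor |a| of the determinant. This reduces the claim
    to a chart frame in the unit cube, where the section is at most [K], |xi| at most r + 1, and the
    determinant at least 1 / n!. *)
Lemma section_bound (f : smooth_section V k r) (b : bool) (K : R) :
  \dim {:V} = n ->
  (forall s z, unit_cube z -> `|part b (local_rep (permuted s) z f)| <= K) ->
  forall E l e xi eta, in_Gk k E l -> (forall i, e i \in E) -> xi \in l -> xi != 0 ->
    (forall j, eta j \in annihilator E) ->
  `|part b (section_val f (E, l) (e, xi, eta))| * `|dcrd xi| ^+ r.+1 <=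
    (r.+1%:R ^+ r.+1 * n`!%:R * K) * `|\det (frame_mx e (cons_frame xi eta))|.
Proof.
move=> dV fK E l e xi eta El eE xil xi0 etaE.
have [s [z [a [z1 a0 fc xiE xc]]]] := in_standard_chart El xil xi0.
have [dE dl lE] := El.
set c := permuted s in fc xiE xc; have cB : basis_of {:V} c := permutedP s.
set e' := chart_e c z in fc xc; set xi' := chart_xi c z in xiE xc; set eta' := chart_eta c z.
have xi'E : xi' = a^-1 *: xi by rewrite xiE scalerA mulVf// scale1r.
have xi'0 : xi' != 0 by rewrite xi'E scaler_eq0 invr_eq0 negb_or a0.
have lxi : l = <[xi']>%VS.
  apply/esym/eqP; rewrite eqEdim dl dim_vline xi'0 andbT -memvE xi'E.
  exact: rpredZ.
have EE : E = <<[seq e' i | i : 'I_k]>>%VS.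
  rewrite (_ : [seq e' i | i : 'I_k] = [tuple e' i | i < k]) ?(span_basis (frame_basis fc dE))//.
have fE : section_val f (E, l) (e', xi', eta') = local_rep c z f by rewrite /local_rep -EE -lxi.
have /asboolP fs := valP f.
have [_ fb ft fsc] := section_fiber fs El.
have [A2 eA] := frame_lin_comb fc dE eE.
have etac j : exists x : 'rV[R]_r * R, eta j = lincomb eta' x.1 + x.2 *: xi'.
  have /annihilatorP etaj := etaE j.
  pose y : 'rV[R]_r.+1 := \row_l eta j (tnth c (rshift k l)).
  exists (\row_l (y ord0 (lift ord0 l) - y ord0 ord0 * z.2 ord0 l), y ord0 ord0).
  have -> : eta j = lincomb (chart_c c z) y.
    rewrite [LHS](@chart_annihilator _ _ k r c cB z); last by move=> i; exact: etaj (frame_mem fc i).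
    by apply: eq_bigr => l' _; rewrite mxE.
  have xi'c : xi' = chart_c c z ord0 + \sum_l' z.2 ord0 l' *: eta' l' by [].
  rewrite lincombS /= xi'c [X in _ = _ + X]scalerDr [X in _ = _ + (_ + X)]scaler_sumr [RHS]addrCA; congr (_ + _).
  rewrite /lincomb -big_split; apply: eq_bigr => l' _ /=.
  by rewrite mxE scalerA -scalerDl subrK.
have /choice[x xE] := etac.
pose B : 'M[R]_r := \matrix_(i, j) (x i).1 ord0 j.
have etaB : eta = lin_comb B eta' + (fun j => (x j).2 *: xi').
  apply/funext => j; rewrite xE; congr (_ + _).
  by apply: eq_bigr => l' _; rewrite mxE.
have eta'E j : eta' j \in annihilator E.
  apply/annihilatorP => v vE; have [y ->] := frame_span fc dE vE.
  rewrite /lincomb linear_sum big1// => i _.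
  by rewrite linearZ/= /eta' /chart_eta (chart_c_chart_e cB) scaler0.
have valE : section_val f (E, l) (e, xi, eta) =
    (`|\det A2| * `|\det B| * `|a| ^- r)%:C%C * local_rep c z f.
  have -> : section_val f (E, l) (e, xi, eta) = `|\det A2|%:C%C * section_val f (E, l) (e', xi, eta).
    by rewrite eA; apply: (lebesgue_det (fb xi eta)); exact: frame_mem fc.
  have tl := ft e' _ xil (elimN eqP xi0).
  have -> : section_val f (E, l) (e', xi, eta) = `|\det B|%:C%C * section_val f (E, l) (e', xi, eta').
    rewrite etaB (lebesgue_quo tl); first exact: (lebesgue_det tl).
      move=> i; apply: rpred_sum => j _; exact: rpredZ.
    by move=> i; rewrite lxi; apply: rpredZ; exact: memv_line.
  (* Here xi = a xi'. Scaling xi' and eta' together by [a] changes nothing, and undoing the scaling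
     of eta' costs |a|^-r. *)
  have -> : section_val f (E, l) (e', xi, eta') = (`|a| ^- r)%:C%C * section_val f (E, l) (e', xi', eta').
    have := lebesgue_det tl a%:M eta'E; rewrite lin_comb_scalar {1}xiE fsc// => ->.
    rewrite mulrA -rmorphM/= det_scalar normrX mulVf ?mul1r//.
    by rewrite expf_neq0// normr_eq0.
  by rewrite fE !mulrA -!rmorphM.
have detE : \det (frame_mx e (cons_frame xi eta)) =
    \det A2 * (a * \det B) * \det (frame_mx e' (cons_frame xi' eta')).
  pose Bm : 'M[R]_r.+1 := (block_mx a%:M 0 (\col_j (x j).2) B : 'M[R]_(1 + r)).
  have -> : cons_frame xi eta = lin_comb Bm (cons_frame xi' eta').
    have o0 : lshift r (ord0 : 'I_1) = ord0 :> 'I_r.+1 by exact/val_inj.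
    have oS i : rshift 1 i = lift ord0 i :> 'I_r.+1 by exact/val_inj.
    have B00 : Bm ord0 ord0 = a.
      by rewrite -o0 /Bm (@block_mxEul _ 1 r 1 r) mxE eqxx mulr1n.
    have B0S l' : Bm ord0 (lift ord0 l') = 0.
      by rewrite -oS -o0 /Bm (@block_mxEur _ 1 r 1 r) mxE.
    have BS0 i : Bm (lift ord0 i) ord0 = (x i).2.
      by rewrite -oS -o0 /Bm (@block_mxEdl _ 1 r 1 r) mxE.
    have BSS i l' : Bm (lift ord0 i) (lift ord0 l') = B i l'.
      by rewrite -!oS /Bm (@block_mxEdr _ 1 r 1 r).
    apply/funext => j; rewrite /lin_comb big_ord_recl cons_frame0.
    under eq_bigr do rewrite cons_frameS.
    case: (unliftP ord0 j) => [i ->|->].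
      rewrite cons_frameS BS0 etaB addrC; congr (_ + _).
      by apply: eq_bigr => l' _; rewrite BSS.
    by rewrite cons_frame0 B00 -xiE big1 ?addr0// => l' _; rewrite B0S scale0r.
  by rewrite eA frame_mx_lin_comb /Bm (@det_lblock R 1 r) det_scalar1.
have dn : `|dcrd xi| = `|a| * `|dcrd xi'|.
  rewrite xiE -normrZ; congr (`|_|); apply/rowP => i.
  by rewrite !mxE scale_lfunE.
rewrite valE partZ detE dn !normrM normfV normrX !normr_id det_frame_chart.
have na : 0 < `|a| by rewrite normr_gt0.
have fk := fK s z z1.
have n1 : `|dcrd xi'| ^+ r.+1 <= r.+1%:R ^+ r.+1.
  rewrite lerXn2r ?nnegrE//; apply: dcrd_chart_xi_le; [exact: z1.1|exact: z1.2].
have d1 := det_chart_ge z.1.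
set D := `|\det (block_mx _ _ _ _)| in d1 *.
have K0 : 0 <= K by exact: le_trans (normr_ge0 _) fk.
have step : `|part b (local_rep c z f)| * `|dcrd xi'| ^+ r.+1 <= K * r.+1%:R ^+ r.+1 * (n`!%:R * D).
  by rewrite -[leLHS]mulr1 !ler_pM// ?mulr_ge0// ?exprn_ge0.
have -> : `|\det A2| * `|\det B| * `|a| ^- r * `|part b (local_rep c z f)| * (`|a| * `|dcrd xi'|) ^+ r.+1 =
   (`|\det A2| * `|\det B| * `|a|) * (`|part b (local_rep c z f)| * `|dcrd xi'| ^+ r.+1).
  rewrite exprMn exprS; have ar : `|a| ^+ r != 0 by rewrite expf_neq0// gt_eqF.
  by field.
have -> : r.+1%:R ^+ r.+1 * n`!%:R * K * (`|\det A2| * (`|a| * `|\det B|) * D) =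
   (`|\det A2| * `|\det B| * `|a|) * (K * r.+1%:R ^+ r.+1 * (n`!%:R * D)) by ring.
by rewrite ler_wpM2l// !mulr_ge0.
Qed.

End coordinates.

(** * Fiber integrals *)

Section compact_cube.
Variables (R : realType) (k r : nat).

Lemma vec_mx_continuous m n : continuous (@vec_mx R m n).
Proof.
move=> v A /nbhs_ballP[e /= e0 eA]; apply/nbhs_ballP; exists e => //= w [_ vw].
by apply: eA; split => // i j; rewrite !mxE; exact: vw.
Qed.

Lemma compact_mx_cube m n : compact [set X : 'M[R]_(m, n) | forall i j, `|X i j| <= 1].
Proof.
have -> : [set X : 'M[R]_(m, n) | forall i j, `|X i j| <= 1] =
    (@vec_mx R m n) @` [set v : 'rV[R]_(m * n) | forall i, `[-1, 1]%classic (v ord0 i)].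
  apply/seteqP; split => [X X1|_ [v v1 <-] i j]; last first.
    by rewrite mxE; have := v1 (mxvec_index i j); rewrite /= in_itv/= -ler_norml.
  exists (mxvec X); rewrite ?mxvecK// => i.
  case/mxvec_indexP: i => i j; rewrite mxvecE /= in_itv/= -ler_norml.
  exact: X1.
apply: continuous_compact; first exact/continuous_subspaceT/vec_mx_continuous.
by apply: (@rV_compact _ _ (fun=> `[(- 1 : R), 1]%classic)) => _; exact: segment_compact.
Qed.

Lemma compact_unit_cube : compact (@unit_cube R k r).
Proof.
have -> : @unit_cube R k r = [set X : 'M[R]_(k, r.+1) | forall i j, `|X i j| <= 1] `*`
    [set Y : 'rV[R]_r | forall i j, `|Y i j| <= 1].
  apply/seteqP; split => -[X Y] [/= X1 Y1]; split => //=.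
  by move=> i j; rewrite ord1.
by apply: compact_setX; exact: compact_mx_cube.
Qed.

Lemma continuous_bounded_cube (g : chart_dom R k r -> R) : continuous g ->
  exists K, forall z, unit_cube z -> `|g z| <= K.
Proof.
move=> cg.
have /compact_bounded : compact (g @` @unit_cube R k r).
  by apply: continuous_compact; [exact: continuous_subspaceT|exact: compact_unit_cube].
case=> M [_ MP]; exists (M + 1) => z z1; apply: (MP (M + 1)); first by rewrite ltrDl.
by exists z.
Qed.

End compact_cube.

Section positive_functions.
Variable R : realType.

(** What the positive part, the negative part and the absolute value have in common. The rules for
    densities multiply by factors |det A|, so positive homogeneity is the property that preserves
    them. *)
Record absolute (phi : R -> R) : Prop := Absolute {
  absolute_ge0 : forall x, 0 <= phi x ;
  absolute_hom : forall a x, 0 <= a -> phi (a * x) = a * phi x ;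
  absolute_le : forall x, phi x <= `|x| ;
  absolute_measurable : measurable_fun setT (phi : measurableTypeR R -> measurableTypeR R) }.

Definition pospart (x : R) := Num.max x 0.
Definition negpart (x : R) := Num.max (- x) 0.

Lemma absolute_pos : absolute pospart.
Proof.
split=> [x|a x a0|x|]; first by rewrite le_max lexx orbT.
- by rewrite /pospart maxr_pMr// mulr0.
- by rewrite ge_max ler_norm normr_ge0.
- by apply: measurable_maxr => //; exact: measurable_id.
Qed.

Lemma absolute_neg : absolute negpart.
Proof.
split=> [x|a x a0|x|]; first by rewrite le_max lexx orbT.
- by rewrite /negpart -mulrN maxr_pMr// mulr0.
- by rewrite ge_max normr_ge0 -normrN ler_norm.
- apply: measurable_maxr => //; apply: measurableT_comp => //; exact: measurable_oppr.
Qed.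

Lemma absolute_norm : absolute Num.norm.
Proof.
split=> [x|a x a0|x|]; [exact: normr_ge0|by rewrite normrM ger0_norm|by []|].
exact: normr_measurable.
Qed.

Lemma pos_neg_part x : x = pospart x - negpart x.
Proof. by rewrite /pospart /negpart; case: (leP x 0) => h; case: (leP (- x) 0) => h'; lra. Qed.

Lemma part_ext (c c' : R[i]) : (forall b, part b c = part b c') -> c = c'.
Proof.
by move=> H; apply/eqP; rewrite eq_complex; apply/andP; split; apply/eqP; [exact: (H true)|exact: (H false)].
Qed.

Lemma partD b (c c' : R[i]) : part b (c + c') = part b c + part b c'.
Proof. by case: b; rewrite /part ?ReD ?ImD. Qed.

Lemma partM b (c c' : R[i]) : part b (c * c') = complex.Re c * part b c' +
  (if b then - complex.Im c else complex.Im c) * part (~~ b) c'.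
Proof. by case: b; case: c => x y; case: c' => x' y' /=; rewrite ?mulNr. Qed.

Lemma part_norm_ge (c : R[i]) : `|c| <= (`|part true c| + `|part false c|)%:C%C.
Proof.
case: c => x y; rewrite /part /= normc_def lecR -[leRHS]ger0_norm ?addr_ge0//.
rewrite -sqrtr_sqr ler_wsqrtr// sqrrD !real_normK ?num_real//.
by rewrite -addrA lerD2l -[X in X <= _]add0r lerD2r mulrn_wge0// mulr_ge0.
Qed.

End positive_functions.

Section fiber_integrals.
Variables (R : realType) (V : vectType R) (k r : nat).
Local Notation "V '" := ('Hom(V, R^o)) (at level 8, format "V '").
Local Notation n := (k + r.+1)%N.
Local Notation rtuple d := (d.-tuple (measurableTypeR R)).
Local Notation lam d := (@lebesgue_tuple R d).
Variables (b0 : n.-tuple V) (b0B : basis_of {:V} b0).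
Hypothesis dV : \dim {:V} = n.

Lemma section_bounded (f : smooth_section V k r) (b : bool) : exists2 K : R, 0 <= K &
  forall s z, unit_cube z -> `|part b (local_rep (permuted b0 s) z f)| <= K.
Proof.
have /choice[K KP] (s : {perm 'I_n}) : exists K : R, forall z, unit_cube z ->
    `|part b (local_rep (permuted b0 s) z f)| <= K.
  by apply: continuous_bounded_cube; apply: continuous_local_rep; exact: permutedP.
exists (\sum_s `|K s|) => [|s z zc]; first by rewrite sumr_ge0.
apply: (le_trans (KP s z zc)); apply: (le_trans (ler_norm _)).
by rewrite (bigD1 s)//= lerDl sumr_ge0.
Qed.

Definition dnorm (xi : V ') : R := `|dcrd b0 xi|.

Lemma dnorm_homogeneous : homogeneous dnorm.
Proof.
split=> [a xi|xi xi0].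
  by rewrite /dnorm -normrZ; congr (`|_|); apply/rowP => i; rewrite !mxE scale_lfunE.
rewrite normr_gt0; apply: contra_neq xi0 => h; apply: (dcrd_inj b0B); rewrite h.
by apply/rowP => i; rewrite !mxE zero_lfunE.
Qed.

Section fiber.
Variables (E : {vspace V}) (dE : \dim E = k).
Local Notation W := (annihilator E).

Let dW : \dim W = r.+1 := dim_annihilator dV dE.

Lemma in_Gk_line (xi : V ') : xi \in W -> xi != 0 -> in_Gk k E <[xi]>%VS.
Proof. by move=> xiW xi0; split; rewrite ?dim_vline ?xi0// -memvE. Qed.

Definition part_density (f : smooth_section V k r) (e : 'I_k -> V) b (phi : R -> R)
    (xi : V ') (eta : 'I_r -> V ') : R :=
  phi (part b (section_val f (E, <[xi]>%VS) (e, xi, eta))).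

Lemma is_density_part f e b phi : absolute phi -> is_density W (part_density f e b phi).
Proof.
move=> [absolute0 phiM _ _]; have /asboolP fs := valP f; split.
- by move=> *; exact: absolute0.
- move=> xi u A xiW xi0 uW; rewrite /part_density.
  have [_ _ ft _] := section_fiber fs (in_Gk_line xiW xi0).
  rewrite (lebesgue_det (ft e _ (memv_line _) (elimN eqP xi0)))//.
  by rewrite partZ phiM.
- move=> xi u c xiW xi0 uW cW; rewrite /part_density.
  have [_ _ ft _] := section_fiber fs (in_Gk_line xiW xi0).
  by rewrite (lebesgue_quo (ft e _ (memv_line _) (elimN eqP xi0))).
- move=> xi u a a0; rewrite /part_density.
  have -> : <[a *: xi]>%VS = <[xi]>%VS.
    apply/eqP; rewrite eqEsubv -!memvE memvZ ?memv_line//=.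
    by rewrite -[X in X \in _](scalerK a0) memvZ// memv_line.
  (* [density_scale] is required for every covector; outside of G_k both sides are the default value
     of the section. *)
  have [xiE|xiE] := pselect (in_Gk k E <[xi]>%VS); last by rewrite (section_out fs xiE).
  by have [_ _ _ ->] := section_fiber fs xiE.
Qed.

Lemma absolute0 (phi : R -> R) : absolute phi -> phi 0 = 0.
Proof. by move=> [_ h _ _]; have := h 0 0 (lexx _); rewrite !mul0r. Qed.

Definition measurable_cone (C : set (V ')) := cone C /\
  forall w : 'I_r.+1 -> V ', measurable [set z : rtuple r.+1 | C (lincomb w (rV_of z))].

Section chart.
Variables (C : set (V ')) (mC : measurable_cone C).
Variables (w : 'I_r.+1 -> V ') (fw : is_frame W w).

Lemma measurable_cone_affine :
  measurable [set t : rtuple r | C (affine w t)] /\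
  measurable [set t : rtuple r | C (- affine w t)].
Proof.
split.
  have -> : [set t : rtuple r | C (affine w t)] = (fun t => tcons (1, t)) @^-1` [set z : rtuple r.+1 | C (lincomb w (rV_of z))].
    by apply/seteqP; split => t; rewrite /= affineE.
  exact: (measurable_preimage (measurable_tconsr _) (mC.2 w)).
have -> : [set t : rtuple r | C (- affine w t)] = (fun t => tcons (1, t)) @^-1` [set z : rtuple r.+1 | C (lincomb (- w) (rV_of z))].
  have EN t : - affine w t = lincomb (- w) (rV_of (tcons (1, t))).
    by rewrite affineE /lincomb -sumrN; apply: eq_bigr => i _; rewrite scalerN.
  by apply/seteqP; split => t; rewrite /= EN.
exact: (measurable_preimage (measurable_tconsr _) (mC.2 (- w))).
Qed.

Let Wm := \matrix_j dcrd b0 (w j).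

Let dnormE (z : rtuple r.+1) : dnorm (lincomb w (rV_of z)) = `|rV_of z *m Wm|.
Proof. by rewrite /dnorm dcrd_lincomb. Qed.

Lemma mx_norm_leP (y : 'rV[R]_n) (a : R) : 0 <= a -> (`|y| <= a) <-> (forall i, `|y ord0 i| <= a).
Proof.
move=> a0; rewrite [X in X <= a]mx_normrE; split => [/bigmax_leP[_ H] i|H].
  exact: (H (ord0, i)).
by apply/bigmax_leP; split => // -[i j] _ /=; rewrite ord1.
Qed.

Lemma mx_norm_ltP (y : 'rV[R]_n) (a : R) : 0 < a -> (`|y| < a) <-> (forall i, `|y ord0 i| < a).
Proof.
move=> a0; rewrite [X in X < a]mx_normrE; split => [/bigmax_ltP[_ H] i|H].
  exact: (H (ord0, i)).
by apply/bigmax_ltP; split => // -[i j] _ /=; rewrite ord1.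
Qed.

Lemma measurable_shell : measurable (shell dnorm C w).
Proof.
have m i : measurable_fun setT (fun z : rtuple r.+1 => `|(rV_of z *m Wm) ord0 i| : measurableTypeR R).
  by apply: measurableT_comp => //; exact: measurable_rV_of.
have -> : shell dnorm C w =
  ((~` \bigcap_(i in [set: 'I_n]) (fun z : rtuple r.+1 => `|(rV_of z *m Wm) ord0 i|) @^-1` `]-oo, 1[%classic) `&`
   (\bigcap_(i in [set: 'I_n]) (fun z : rtuple r.+1 => `|(rV_of z *m Wm) ord0 i|) @^-1` `]-oo, 2]%classic)) `&`
   [set z : rtuple r.+1 | C (lincomb w (rV_of z))].
  apply/seteqP; split => z; rewrite /shell /= dnormE.
    move=> [/andP[h1 h2] Cz]; split => //; split.
      move=> H; move: h1; rewrite leNgt => /negP; apply; apply/mx_norm_ltP => // i.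
      by have := H i I; rewrite /= in_itv.
    by move=> i _ /=; rewrite in_itv/=; move/mx_norm_leP : h2; apply.
  move=> [[h1 h2] Cz]; split => //; apply/andP; split.
    rewrite leNgt; apply/negP => /(mx_norm_ltP _ ltr01) H; apply: h1 => i _ /=.
    by rewrite in_itv/=.
  by apply/mx_norm_leP => // i; have := h2 i I; rewrite /= in_itv.
apply: measurableI; last exact: mC.2.
apply: measurableI.
  by apply/measurableC/fin_bigcap_measurable => // i _; apply: measurable_preimage => //; exact: m.
by apply/fin_bigcap_measurable => // i _; apply: measurable_preimage => //; exact: m.
Qed.

Lemma dual_frame_row_free : row_free Wm.
Proof.
rewrite -kermx_eq0; apply/eqP/row_matrixP => i; rewrite row0.
apply: (frame_free fw); apply: (dcrd_inj b0B); rewrite dcrd_lincomb -row_mul mulmx_ker row0.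
by apply/rowP => j; rewrite !mxE zero_lfunE.
Qed.

Lemma lebesgue_shell_lty : (lam r.+1 (shell dnorm C w) < +oo)%E.
Proof.
have P1 : Wm *m pinvmx Wm = 1%:M by rewrite mulmxVp// dual_frame_row_free.
(* The pseudo-inverse recovers z from z Wm, whose entries are at most 2 on the shell; [M] is the
   resulting bound on the entries of z. *)
pose M := \sum_i \sum_j (2 * `|(pinvmx Wm) i j|).
have s : shell dnorm C w `<=` tbox M.
  move=> z [/andP[_ h2] _] i; rewrite dnormE in h2.
  have -> : tnth z i = (rV_of z *m Wm *m pinvmx Wm) ord0 i by rewrite -mulmxA P1 mulmx1 mxE.
  rewrite mxE; apply: (le_trans (ler_norm_sum _ _ _)); apply: ler_sum => j _.
  rewrite normrM (bigD1 i)//=; apply: ler_wpDr; first by rewrite sumr_ge0// => l _; rewrite mulr_ge0.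
  by rewrite ler_wpM2r//; move: h2 => /(mx_norm_leP _ (ltW (ltr0Sn _ 1))).
apply: le_lt_trans (lebesgue_tbox r.+1 M).
by apply: le_measure => //; rewrite inE; [exact: measurable_shell|exact: measurable_tbox].
Qed.

Variables (f : smooth_section V k r) (e : 'I_k -> V) (fe : is_frame E e).

Lemma measurable_part_density b phi : absolute phi ->
  measurable_fun setT (fun t : rtuple r => part_density f e b phi (affine w t) (tail w) : measurableTypeR R).
Proof.
move=> aphi; apply: (measurableT_comp (absolute_measurable aphi)).
exact: measurable_section.
Qed.

Lemma chart_measurable_part b phi : absolute phi ->
  chart_measurable W (part_density f e b phi) dnorm C w.
Proof.
move=> aphi; have [m1 m2] := measurable_cone_affine.
split => //; [exact: measurable_part_density|exact: measurable_shell].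
Qed.

Lemma projective_integral_bound b phi K : absolute phi ->
  (forall s z, unit_cube z -> `|part b (local_rep (permuted b0 s) z f)| <= K) ->
  (log_mass R * projective_integral (part_density f e b phi) C w <=
   ((r.+1%:R ^+ r.+1 * n`!%:R * K) * `|\det (frame_mx b0 e w)|)%:E * lam r.+1 (shell dnorm C w))%E.
Proof.
move=> aphi fK.
have K0 : 0 <= K.
  apply: le_trans (normr_ge0 _) (fK 1%g (0, 0) _).
  by split => [i j|j]; rewrite mxE normr0.
apply: (projective_integral_le (is_density_part f e b aphi) dnorm_homogeneous mC.1).
- exact: chart_measurable_part.
- by rewrite !mulr_ge0// exprn_ge0.
move=> z N1; set xi := lincomb w (rV_of z) in N1 *.
have xiW : xi \in W by exact: lincomb_mem.
have xi0 : xi != 0.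
  apply: contraTneq N1 => ->; rewrite -ltNge (_ : dnorm 0 = 0)//.
  by have := dnorm_homogeneous.1 0 0; rewrite scale0r normr0 mul0r.
have := section_bound b0B dV fK (in_Gk_line xiW xi0) (frame_mem fe) (memv_line xi) xi0
  (fun j => frame_mem fw (lift ord0 j)).
have -> : \det (frame_mx b0 e (cons_frame xi (fun j => w (lift ord0 j)))) =
    thead z * \det (frame_mx b0 e w).
  pose U : 'M[R]_r.+1 := block_mx (thead z)%:M (\row_j tnth z (lift ord0 j)) 0 1%:M : 'M[R]_(1 + r).
  have o0 : lshift r (ord0 : 'I_1) = ord0 :> 'I_r.+1 by exact/val_inj.
  have oS i : rshift 1 i = lift ord0 i :> 'I_r.+1 by exact/val_inj.
  have U00 : U ord0 ord0 = thead z.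
    by rewrite -o0 /U (@block_mxEul _ 1 r 1 r) mxE eqxx mulr1n.
  have U0S l' : U ord0 (lift ord0 l') = tnth z (lift ord0 l').
    by rewrite -[X in U _ X]oS -[X in U X _]o0 /U (@block_mxEur _ 1 r 1 r) mxE.
  have US0 i : U (lift ord0 i) ord0 = 0.
    by rewrite -oS -o0 /U (@block_mxEdl _ 1 r 1 r) mxE.
  have USS i l' : U (lift ord0 i) (lift ord0 l') = (i == l')%:R.
    by rewrite -!oS /U (@block_mxEdr _ 1 r 1 r) mxE.
  have -> : cons_frame xi (fun j => w (lift ord0 j)) = lin_comb U w.
    apply/funext => j; rewrite /lin_comb big_ord_recl.
    case: (unliftP ord0 j) => [i ->|->].
      rewrite cons_frameS US0 scale0r add0r (bigD1 i)//= USS eqxx scale1r big1 ?addr0// => l li.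
      by rewrite USS eq_sym (negbTE li) scale0r.
    rewrite cons_frame0 U00 /xi lincombS mxE; congr (_ + _).
    by apply: eq_bigr => l _; rewrite U0S mxE.
  rewrite -[X in frame_mx _ X _]lin_comb1 frame_mx_lin_comb det1 mul1r; congr (_ * _).
  by rewrite /U (@det_ublock R 1 r) det_scalar1 det1 mulr1.
rewrite normrM => H.
apply: (@le_trans _ _ (`|part b (section_val f (E, <[xi]>%VS) (e, xi, tail w))| * `|dcrd b0 xi| ^+ r.+1)).
  apply: (le_trans (absolute_le aphi _)); rewrite ler_peMr// exprn_ege1//.
by apply: (le_trans H); rewrite [`|thead z| * _]mulrC mulrA.
Qed.

(** The affine chart is not compact, so continuity of the section does not make it integrable;
    finiteness comes from the volume bound, the shell having finite measure. *)
Lemma projective_integral_lty b phi : absolute phi ->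
  (projective_integral (part_density f e b phi) C w < +oo)%E.
Proof.
move=> aphi; have [K K0 fK] := section_bounded f b.
have c0 : (0 < log_mass R)%E := log_mass_gt0 R.
have p0 : (0 <= projective_integral (part_density f e b phi) C w)%E.
  rewrite adde_ge0// integral_ge0// => t _; rewrite lee_fin; exact: absolute_ge0.
rewrite ltNge leye_eq; apply/negP => /eqP pE.
have := projective_integral_bound aphi fK; rewrite pE gt0_muley//.
rewrite leye_eq => /eqP h.
have : (((r.+1%:R ^+ r.+1 * n`!%:R * K) * `|\det (frame_mx b0 e w)|)%:E * lam r.+1 (shell dnorm C w) < +oo)%E.
  rewrite lte_mul_pinfty ?lee_fin//; first by rewrite !mulr_ge0// exprn_ge0.
  exact: lebesgue_shell_lty.
by rewrite h ltxx.
Qed.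

Let P b t := part b (section_val f (E, <[affine w t]>%VS) (e, affine w t, tail w)).

Lemma integrable_section b :
  (lam r).-integrable [set t | C (affine w t)] (EFin \o P b) /\
  (lam r).-integrable [set t | C (- affine w t)] (EFin \o P b).
Proof.
have := projective_integral_lty b (absolute_norm R).
have [m1 m2] := measurable_cone_affine.
have mP D : measurable_fun D (EFin \o P b).
  by apply/measurable_EFinP/measurable_funTS; exact: measurable_section.
have i0 (D : set (rtuple r)) : (0 <= \int[lam r]_(t in D) (part_density f e b Num.norm (affine w t) (tail w))%:E)%E.
  by apply: integral_ge0 => t _; rewrite lee_fin normr_ge0.
rewrite /projective_integral => h; split; apply/integrableP; split => //.
  by apply: le_lt_trans h; rewrite leeDl.
by apply: le_lt_trans h; rewrite leeDr.
Qed.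

Lemma integrable_part (D : set (rtuple r)) phi b : absolute phi -> measurable D ->
  (lam r).-integrable D (EFin \o P b) -> (lam r).-integrable D (EFin \o (phi \o P b)).
Proof.
move=> aphi mD; apply: le_integrable => //.
  apply/measurable_EFinP/measurable_funTS.
  exact: (measurable_part_density b aphi).
move=> t _ /=; rewrite lee_fin (ger0_norm (absolute_ge0 aphi _)).
exact: absolute_le.
Qed.

Lemma fine_projective_integral phi b : absolute phi ->
  fine (projective_integral (part_density f e b phi) C w) =
  \int[lam r]_(t in [set t | C (affine w t)]) phi (P b t) +
  \int[lam r]_(t in [set t | C (- affine w t)]) phi (P b t).
Proof.
move=> aphi; have [i1 i2] := integrable_section b; have [m1 m2] := measurable_cone_affine.
by rewrite /projective_integral fineD//; apply: integrable_fin_num => //; exact: integrable_part.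
Qed.

End chart.

(** This is [fiber_integral] with arbitrary frames [e] and [w] in place of the ones from [vbasis],
    so that the dependence on them can be studied. *)
Definition frame_integral (f : pre_section V k r) (C : set (V ')) (e : 'I_k -> V)
    (w : 'I_r.+1 -> V ') : R[i] :=
  2^-1 * \sum_(s : bool) cintegral [set t | C ((-1) ^+ s *: affine w t)]
    (fun t => f (E, <[affine w t]>%VS) (e, affine w t, tail w)).

Lemma part_cintegral b (D : set (rtuple r)) h :
  part b (cintegral D h) = \int[lam r]_(t in D) part b (h t).
Proof. by case: b. Qed.

Lemma part_frame_integral b f C e w : part b (frame_integral f C e w) =
  2^-1 * (\int[lam r]_(t in [set t | C (affine w t)]) part b (f (E, <[affine w t]>%VS) (e, affine w t, tail w)) +
          \int[lam r]_(t in [set t | C (- affine w t)]) part b (f (E, <[affine w t]>%VS) (e, affine w t, tail w))).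
Proof.
rewrite /frame_integral (_ : 2^-1 = (2^-1)%:C%C :> R[i]); last by rewrite rmorphV ?rmorph_nat// unitfE.
rewrite partZ big_bool partD addrC; congr (_ * (_ + _)); rewrite part_cintegral.
  by rewrite expr0; under eq_fun do rewrite scale1r.
by rewrite expr1; under eq_fun do rewrite scaleN1r.
Qed.

Section frame_integral_theory.
Variables (C : set (V ')) (mC : measurable_cone C) (f : smooth_section V k r).

Lemma part_frame_integralE b e w : is_frame E e -> is_frame W w ->
  part b (frame_integral f C e w) = 2^-1 *
    (fine (projective_integral (part_density f e b (@pospart R)) C w) -
     fine (projective_integral (part_density f e b (@negpart R)) C w)).
Proof.
move=> fe fw; rewrite part_frame_integral; congr (_ * _).
have ap := absolute_pos R; have an := absolute_neg R.
rewrite !fine_projective_integral// opprD addrACA.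
have [i1 i2] := integrable_section mC fw f fe b; have [m1 m2] := measurable_cone_affine mC w.
by rewrite -!RintegralB//; try exact: integrable_part; congr (_ + _);
  apply: eq_Rintegral => t _; exact: pos_neg_part.
Qed.

(** The nonnegative case [projective_integral_basis] applies to the positive and the negative part
    of each of the real and imaginary parts. *)
Lemma frame_integral_basis e w w' : is_frame E e -> is_frame W w -> is_frame W w' ->
  frame_integral f C e w' = frame_integral f C e w.
Proof.
move=> fe fw fw'; have [A AE] := frame_lin_comb fw dW (frame_mem fw').
have A0 : \det A != 0 by apply: frame_lin_comb_det fw _; rewrite -AE.
apply: part_ext => b; rewrite !part_frame_integralE//; congr (_ * (fine _ - fine _)); rewrite AE;
  apply: (projective_integral_basis _ dnorm_homogeneous mC.1) => //;
  (try exact/is_density_part/absolute_pos); (try exact/is_density_part/absolute_neg);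
  apply: chart_measurable_part => //; rewrite -?AE//; by [exact: absolute_pos|exact: absolute_neg].
Qed.

Lemma frame_integral_bound b e w K : is_frame E e -> is_frame W w ->
  (forall s z, unit_cube z -> `|part b (local_rep (permuted b0 s) z f)| <= K) ->
  fine (log_mass R) * `|part b (frame_integral f C e w)| <=
  (r.+1%:R ^+ r.+1 * n`!%:R * K) * `|\det (frame_mx b0 e w)| * fine (lam r.+1 (shell dnorm C w)).
Proof.
move=> fe fw fK; rewrite part_frame_integralE//.
have lE : log_mass R = (fine (log_mass R))%:E.
  by rewrite fineK// ge0_fin_numE ?log_mass_lty// ltW// log_mass_gt0.
have H phi : absolute phi -> fine (log_mass R) * fine (projective_integral (part_density f e b phi) C w) <=
    (r.+1%:R ^+ r.+1 * n`!%:R * K) * `|\det (frame_mx b0 e w)| * fine (lam r.+1 (shell dnorm C w)).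
  move=> aphi; have := projective_integral_bound mC fw fe aphi fK.
  have p0 : (0 <= projective_integral (part_density f e b phi) C w)%E.
    by rewrite adde_ge0// integral_ge0// => t _; rewrite lee_fin; exact: absolute_ge0.
  have pE : projective_integral (part_density f e b phi) C w =
      (fine (projective_integral (part_density f e b phi) C w))%:E.
    by rewrite fineK// ge0_fin_numE// projective_integral_lty.
  have sE : lam r.+1 (shell dnorm C w) = (fine (lam r.+1 (shell dnorm C w)))%:E.
    by rewrite fineK// ge0_fin_numE// lebesgue_shell_lty.
  by rewrite {1}lE {1}pE {1}sE -!EFinM lee_fin.
have p0 phi : absolute phi -> 0 <= fine (projective_integral (part_density f e b phi) C w).
  move=> aphi; apply: fine_ge0.
  by rewrite adde_ge0// integral_ge0// => t _; rewrite lee_fin; exact: absolute_ge0.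
have Hp := H _ (absolute_pos R); have Hn := H _ (absolute_neg R).
have pp := p0 _ (absolute_pos R); have pn := p0 _ (absolute_neg R).
have l0 : 0 <= fine (log_mass R) by apply/fine_ge0/ltW/log_mass_gt0.
rewrite normrM ger0_norm ?invr_ge0//.
set a := fine (projective_integral (part_density f e b (@pospart R)) C w) in Hp pp *; set c := fine (projective_integral (part_density f e b (@negpart R)) C w) in Hn pn *.
(* Both [a] and [c] obey the same bound, and the factor one half of the double cover restores the
   constant. *)
have : `|a - c| <= a + c by apply: (le_trans (ler_normB _ _)); rewrite !ger0_norm.
set L := fine (log_mass R) in l0 Hp Hn *.
move=> h; apply: (@le_trans _ _ (L * (2^-1 * (a + c)))).
  by rewrite !ler_wpM2l.
by rewrite mulrCA mulrDr ler_pdivrMl// mulr_natl mulr2n lerD.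
Qed.

Lemma frame_integral_lin_comb e w (A : 'M[R]_k) : is_frame E e -> is_frame W w ->
  frame_integral f C (lin_comb A e) w = `|\det A|%:C%C * frame_integral f C e w.
Proof.
move=> fe fw; have /asboolP fs := valP f.
have [m1 m2] := measurable_cone_affine mC w.
apply: part_ext => b; rewrite partZ !part_frame_integral.
have [i1 i2] := integrable_section mC fw f fe b.
rewrite mulrCA; congr (_ * _); rewrite mulrDr -!RintegralZl//.
have E1 t : part b (section_val f (E, <[affine w t]>%VS) (lin_comb A e, affine w t, tail w)) =
    `|\det A| * part b (section_val f (E, <[affine w t]>%VS) (e, affine w t, tail w)).
  have [_ fb _ _] := section_fiber fs (in_Gk_line (affine_mem t fw) (affine_neq0 t fw)).
  by rewrite (lebesgue_det (fb (affine w t) (tail w)))// ?partZ//; exact: frame_mem fe.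
by congr (_ + _); apply: eq_Rintegral => t _; rewrite E1.
Qed.

End frame_integral_theory.

(** A complex scalar mixes real and imaginary parts, hence the terms in [~~ b]; additivity of the
    integrals rests on [integrable_section]. *)
Lemma frame_integral_lin (C : set (V ')) (c : R[i]) (f g : smooth_section V k r) e w :
  measurable_cone C -> is_frame E e -> is_frame W w ->
  frame_integral (c *: section_val f + section_val g) C e w = c * frame_integral f C e w + frame_integral g C e w.
Proof.
move=> mC fe fw; have [m1 m2] := measurable_cone_affine mC w.
have i1 := integrable_section mC fw f fe; have i2 := integrable_section mC fw g fe.
suff H b : part b (frame_integral (c *: section_val f + section_val g) C e w) =
    complex.Re c * part b (frame_integral f C e w) +
    (if b then - complex.Im c else complex.Im c) * part (~~ b) (frame_integral f C e w) +
    part b (frame_integral g C e w).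
  apply: part_ext => b; rewrite H partD; congr (_ + _).
  by rewrite partM.
set c1 := complex.Re c; set c2 := if b then _ else _.
have E1 t : part b ((c *: section_val f + section_val g) (E, <[affine w t]>%VS) (e, affine w t, tail w)) =
    c1 * part b (section_val f (E, <[affine w t]>%VS) (e, affine w t, tail w)) +
    c2 * part (~~ b) (section_val f (E, <[affine w t]>%VS) (e, affine w t, tail w)) +
    part b (section_val g (E, <[affine w t]>%VS) (e, affine w t, tail w)).
  rewrite [X in part b X](_ : _ = c * section_val f (E, <[affine w t]>%VS) (e, affine w t, tail w) +
    section_val g (E, <[affine w t]>%VS) (e, affine w t, tail w))//.
  by rewrite partD partM.
rewrite !part_frame_integral mulrCA [c2 * _]mulrCA -!mulrDr; congr (_ * _).
rewrite !mulrDr -!RintegralZl//; [|exact: (i1 _).2|exact: (i1 _).1|exact: (i1 _).2|exact: (i1 _).1].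
have RD (D : set (rtuple r)) : measurable D ->
    (forall b', (lam r).-integrable D (EFin \o (fun t => part b' (section_val f (E, <[affine w t]>%VS) (e, affine w t, tail w))))) ->
    (lam r).-integrable D (EFin \o (fun t => part b (section_val g (E, <[affine w t]>%VS) (e, affine w t, tail w)))) ->
   \int[lam r]_(t in D) part b ((c *: section_val f + section_val g) (E, <[affine w t]>%VS) (e, affine w t, tail w)) =
   \int[lam r]_(t in D) (c1 * part b (section_val f (E, <[affine w t]>%VS) (e, affine w t, tail w))) +
   \int[lam r]_(t in D) (c2 * part (~~ b) (section_val f (E, <[affine w t]>%VS) (e, affine w t, tail w))) +
   \int[lam r]_(t in D) part b (section_val g (E, <[affine w t]>%VS) (e, affine w t, tail w)).
  move=> mD if_ ig.
  have iZ a b' : (lam r).-integrable D (EFin \o (fun t => a * part b' (section_val f (E, <[affine w t]>%VS) (e, affine w t, tail w)))).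
    have := integrableZl mD a (if_ b'); exact: eq_integrable.
  rewrite -RintegralD// -RintegralD//.
    by apply: eq_Rintegral => t _; exact: E1.
  have := integrableD mD (iZ c1 b) (iZ c2 (~~ b)); exact: eq_integrable.
rewrite RD//; [|by move=> b'; exact: (i1 b').1|exact: (i2 b).1].
rewrite RD//; [|by move=> b'; exact: (i1 b').2|exact: (i2 b).2].
ring.
Qed.

End fiber.
End fiber_integrals.

(** * Polytopes and their faces *)

Section convex_combinations.
Variables (R : realType) (V : vectType R).
Implicit Types (A : set V) (s : seq V).

Definition simplex d : set 'rV[R]_d :=
  [set c | (forall i, 0 <= c ord0 i) /\ \sum_i c ord0 i = 1].

Lemma convex_setP A : convex_set (A : set (convex_lmodType V)) <->
  forall x y (t : R), 0 <= t -> t <= 1 -> A x -> A y -> A (t *: x + (1 - t) *: y).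
Proof.
split=> [cA x y t t0 t1 Ax Ay|cA x y l /set_mem Ax /set_mem Ay].
  by have := cA x y (Itv01 t0 t1); rewrite !inE; exact.
by apply/mem_set; exact: cA.
Qed.

Lemma convex_lincomb A d (p : 'I_d -> V) (c : 'rV[R]_d) :
  convex_set (A : set (convex_lmodType V)) -> simplex c -> (forall i, A (p i)) ->
  A (lincomb p c).
Proof.
move=> /convex_setP cA; elim: d p c => [|d IH] p c [c0 c1] Ap.
  by move: c1; rewrite big_ord0 => /esym/eqP; rewrite oner_eq0.
move: c1; rewrite big_ord_recl => c1; rewrite lincombS.
have s1 : \sum_(i < d) c ord0 (lift ord0 i) = 1 - c ord0 ord0 by rewrite -c1 addrAC subrr add0r.
have s0 : 0 <= \sum_(i < d) c ord0 (lift ord0 i) by apply: sumr_ge0.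
have [e1|ne1] := eqVneq (c ord0 ord0) 1.
  rewrite big1 ?addr0 ?e1 ?scale1r// => i _.
  have /eqP : \sum_(i < d) c ord0 (lift ord0 i) = 0 by rewrite s1 e1 subrr.
  rewrite psumr_eq0// => /allP/(_ i); rewrite mem_index_enum => /(_ isT)/eqP ->.
  by rewrite scale0r.
have n0 : 1 - c ord0 ord0 != 0 by rewrite subr_eq0 eq_sym.
have le1 : c ord0 ord0 <= 1 by rewrite -c1 lerDl.
rewrite (_ : \sum_j _ = (1 - c ord0 ord0) *:
    lincomb (fun i => p (lift ord0 i)) (\row_i (c ord0 (lift ord0 i) / (1 - c ord0 ord0)))).
  apply: cA => //; apply: IH => //; split=> [i|].
    by rewrite mxE divr_ge0// subr_ge0.
  by under eq_bigr do rewrite mxE; rewrite -mulr_suml s1 divff.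
rewrite -lincombZ; apply: eq_bigr => i _; rewrite !mxE.
by rewrite mulrC divfK.
Qed.

Definition hull s : set V := smallest (fun A : set (convex_lmodType V) => convex_set A) [set` s].

Lemma convex_hull s : convex_set (hull s : set (convex_lmodType V)).
Proof.
apply/convex_setP => x y t t0 t1 xs ys A [cA sA].
by move/convex_setP : (cA) => cA'; apply: cA' => //; [exact: xs|exact: ys].
Qed.

Lemma mem_hull s v : v \in s -> hull s v.
Proof. by move=> vs A [_ sA]; exact: sA. Qed.

Lemma hullE s : hull s = [set lincomb (tnth (in_tuple s)) c | c in @simplex (size s)].
Proof.
apply/seteqP; split => [x|_ [c c1 <-]]; last first.
  apply: convex_lincomb => //; first exact: convex_hull.
  by move=> i; apply: mem_hull; exact: (mem_tnth i (in_tuple s)).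
apply; split; last first.
  move=> v /= /(tnthP (in_tuple s))[i ->].
  exists (delta_mx ord0 i); first split.
  - by move=> j; rewrite mxE ler0n.
  - rewrite (bigD1 i)//= mxE !eqxx big1 ?addr0// => j ji.
    by rewrite mxE (negbTE ji).
  - rewrite /lincomb (bigD1 i)//= mxE !eqxx scale1r big1 ?addr0// => j ji.
    by rewrite mxE (negbTE ji) scale0r.
apply/convex_setP => _ _ t t0 t1 [c [c0 c1] <-] [c' [c'0 c'1] <-].
exists (t *: c + (1 - t) *: c'); first split.
- by move=> i; rewrite !mxE addr_ge0// mulr_ge0// subr_ge0.
- under eq_bigr do rewrite !mxE; rewrite big_split /= -!mulr_sumr c1 c'1.
  by rewrite !mulr1 addrC subrK.
rewrite -!lincombZ /lincomb -big_split; apply: eq_bigr => i _ /=.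
by rewrite !mxE scalerDl.
Qed.

Lemma linear_lincomb (U : lmodType R) (g : {linear V -> U}) d (p : 'I_d -> V) c :
  g (lincomb p c) = \sum_i c ord0 i *: g (p i).
Proof. by rewrite linear_sum; apply: eq_bigr => i _; rewrite linearZ. Qed.

Lemma hull_linear_le s (xi : 'Hom(V, R^o)) (m : R) :
  (forall v, v \in s -> xi v <= m) -> forall v, hull s v -> xi v <= m.
Proof.
move=> sm v; rewrite hullE => -[c [c0 c1] <-]; rewrite linear_lincomb.
rewrite -[m]mul1r -c1 mulr_suml; apply: ler_sum => i _.
by apply: ler_wpM2l => //; apply/sm/mem_tnth.
Qed.

(** A linear form attains its maximum over the hull at a generator, and a convex combination is
    maximal only if the generators below the maximum have coefficient 0. *)
Lemma face_hullE s (xi : 'Hom(V, R^o)) : s != [::] ->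
  exists2 m : R, (forall y, hull s y -> xi y <= m) &
   [set x | hull s x /\ forall y, hull s y -> xi y <= xi x] = hull [seq v <- s | xi v == m] /\
   [seq v <- s | xi v == m] != [::].
Proof.
move=> s0.
have i0 : 'I_(size s) by apply: (Ordinal (n := size s) (m := 0)); rewrite lt0n size_eq0.
have [i1 v1m] : exists i1 : 'I_(size s), forall i, xi (tnth (in_tuple s) i) <= xi (tnth (in_tuple s) i1).
  have := @arg_maxP _ R _ i0 predT (fun i => xi (tnth (in_tuple s) i)) isT.
  by case=> i1 _ H; exists i1 => i; exact: H.
set v1 := tnth (in_tuple s) i1 in v1m.
have v1s : v1 \in s by exact: (mem_tnth i1 (in_tuple s)).
exists (xi v1).
  by apply: hull_linear_le => v /(tnthP (in_tuple s))[i ->]; exact: v1m.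
have hm : forall y, hull s y -> xi y <= xi v1.
  by apply: hull_linear_le => v /(tnthP (in_tuple s))[i ->]; exact: v1m.
have v1f : v1 \in [seq v <- s | xi v == xi v1] by rewrite mem_filter eqxx v1s.
split; last by apply/negP => /eqP fn; rewrite fn in v1f.
apply/seteqP; split=> x.
  move=> [hx xmax]; have xm : xi x = xi v1.
    by apply/eqP; rewrite eq_le hm//= xmax//; exact: mem_hull.
  move: hx; rewrite hullE => -[c [c0 c1] cx].
  have cz i : c ord0 i = 0 \/ xi (tnth (in_tuple s) i) = xi v1.
    have : \sum_i c ord0 i * (xi v1 - xi (tnth (in_tuple s) i)) = 0.
      under eq_bigr do rewrite mulrBr; rewrite sumrB -mulr_suml c1 mul1r.
      by rewrite -xm -cx linear_lincomb subrr.
    move/eqP; rewrite psumr_eq0; last by move=> j _; rewrite mulr_ge0// subr_ge0.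
    move=> /allP/(_ i); rewrite mem_index_enum mulf_eq0 subr_eq0 => /(_ isT)/orP[/eqP|/eqP]; by [left|right].
  (* Generators below the maximum have coefficient 0, so they may be replaced by the maximizer [v1]
     without moving the point. *)
  have -> : x = lincomb (fun i => if xi (tnth (in_tuple s) i) == xi v1 then tnth (in_tuple s) i else v1) c.
    rewrite -cx; apply: eq_bigr => i _; case: eqP => // ne.
    by case: (cz i) => [->|//]; rewrite !scale0r.
  apply: convex_lincomb => //; first exact: convex_hull.
  by move=> i; apply: mem_hull; case: ifP => // h; rewrite mem_filter h mem_tnth.
have sub : hull [seq v <- s | xi v == xi v1] `<=` hull s.
  move=> y hy A [cA sA]; apply: hy; split => // v /=.
  by rewrite mem_filter => /andP[_ vs]; exact: sA.
move=> hx; split; first exact: sub.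
move=> y hy; apply: (le_trans (hm y hy)).
have h v : v \in [seq v <- s | xi v == xi v1] -> (- xi) v <= - xi v1.
  by rewrite mem_filter => /andP[/eqP <- _]; rewrite opp_lfunE.
by have := hull_linear_le h hx; rewrite opp_lfunE lerN2.
Qed.

(** Encoding a face by a mask of fixed length shows at once that there are finitely many faces and
    that each is a polytope. *)
Lemma face_hull s (F : set V) : s != [::] -> face (hull s) F ->
  exists2 m : (size s).-tuple bool, F = hull (mask m s) & mask m s != [::].
Proof.
move=> s0 [xi FE]; have [m _ [E n]] := face_hullE xi s0.
exists (map_tuple (fun v => xi v == m) (in_tuple s)); rewrite -filter_mask//.
by rewrite FE E.
Qed.

Lemma face_subset (P F : set V) : face P F -> F `<=` P.
Proof. by move=> [xi ->] x []. Qed.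

Lemma finite_kfaces k s : s != [::] -> finite_set (kfaces k (hull s)).
Proof.
move=> s0; apply: (@sub_finite_set _ _ ((fun m : (size s).-tuple bool => hull (mask m s)) @` setT)).
  by move=> F [/(face_hull s0)[m -> _] _]; exists m.
exact: finite_image.
Qed.

Lemma hull_neq0 s : s != [::] -> hull s !=set0.
Proof. by case: s => // v s _; exists v; apply: mem_hull; rewrite mem_head. Qed.

Section direction.
Variable F : set V.

(** [direction] is a choice with a default value, so existence is needed. A subspace of least
    dimension containing all differences works: intersecting it with another such subspace cannot
    lower its dimension. *)
Lemma is_direction_direction : is_direction F (direction F).
Proof.
apply: (@xgetPex _ 0%VS (is_direction F)).
pose Q := fun d => `[< exists E : {vspace V}, \dim E = d /\ forall x y, F x -> F y -> x - y \in E >].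
have exQ : exists d, Q d.
  by exists (\dim {:V}); apply/asboolP; exists fullv; split => // x y _ _; exact: memvf.
case: (ex_minnP exQ) => d /asboolP[E [dE EF]] dmin.
exists E; split=> // E' E'F.
have /dmin : Q (\dim (E :&: E')).
  by apply/asboolP; exists (E :&: E')%VS; split => // x y Fx Fy; rewrite memv_cap EF ?E'F.
rewrite -dE => h; have /eqP <- : (E :&: E')%VS == E by rewrite eqEdim capvSl.
exact: capvSr.
Qed.

Lemma direction_unique E : is_direction F E -> direction F = E.
Proof.
move=> [EF Emin]; have [DF Dmin] := is_direction_direction.
by apply/eqP; rewrite eqEsubv Dmin//= Emin.
Qed.

Lemma direction_sub x y : F x -> F y -> x - y \in direction F.
Proof. exact: is_direction_direction.1. Qed.

(* A maximal free family of differences spans the direction. *)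
Lemma direction_basis x0 : F x0 ->
  exists2 X : (\dim (direction F)).-tuple V, basis_of (direction F) X &
    forall i, F (x0 + tnth X i).
Proof.
move=> F0.
pose Q := fun d => `[< exists2 X : seq V, free X & size X = d /\ forall v, v \in X -> F (x0 + v) >].
have exQ : exists d, Q d.
  by exists 0; apply/asboolP; exists [::] => //; exact: nil_free.
have bQ d : Q d -> (d <= \dim {:V})%N.
  by move=> /asboolP[X fX [<- _]]; rewrite -(eqP fX); exact/dimvS/subvf.
case: (ex_maxnP exQ bQ) => d /asboolP[X fX [sX XF]] dmax.
have Xsub v : v \in X -> v \in direction F.
  by move=> /XF Fv; rewrite -[v](addKr x0) addrC; exact: direction_sub.
have spanX : forall v, F (x0 + v) -> v \in <<X>>%VS.
  move=> v Fv; apply: contrapT => /negP vX.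
  have /dmax : Q d.+1.
    apply/asboolP; exists (v :: X); first by rewrite free_cons vX fX.
    split; first by rewrite /= sX.
    by move=> u; rewrite inE => /predU1P[->//|]; exact: XF.
  by rewrite ltnn.
have dE : direction F = <<X>>%VS.
  apply/eqP; rewrite eqEsubv; apply/andP; split; last first.
    by apply/span_subvP => v; exact: Xsub.
  apply: is_direction_direction.2 => x y Fx Fy.
  rewrite -(subrKA x0) rpredD//; first by apply: spanX; rewrite addrCA subrr addr0.
  by rewrite -opprB rpredN; apply: spanX; rewrite addrCA subrr addr0.
have sXd : size X == \dim (direction F) by rewrite dE (eqP fX).
exists (Tuple sXd) => [|i]; first by apply/andP; split=> //=; apply/eqP; rewrite [RHS]dE.
exact/XF/(mem_tnth i (Tuple sXd)).
Qed.

(* The norm for which [hausdorff_dist] is taken. *)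
Definition nrm (v : V) : R := `|coords v|.

Lemma coords_linear : linear (@coords R V).
Proof. by move=> a u v; apply/rowP => i; rewrite !mxE linearD linearZ. Qed.

Lemma coordsB (u v : V) : coords (u - v) = coords u - coords v.
Proof. by rewrite -scaleN1r addrC coords_linear scaleN1r addrC. Qed.

Lemma coords_inj : injective (@coords R V).
Proof.
move=> u v uv; rewrite (coord_vbasis (memvf u)) (coord_vbasis (memvf v)).
by apply: eq_bigr => i _; move/rowP: uv => /(_ i); rewrite !mxE => ->.
Qed.

Lemma coord_le_nrm v i : `|coord (vbasis {:V}) i v| <= nrm v.
Proof.
rewrite /nrm [leRHS]mx_normrE.
have := le_bigmax 0 (fun ij : 'I_1 * 'I_(\dim {:V}) => `|coords v ij.1 ij.2|) (ord0, i).
by rewrite /= mxE.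
Qed.

Lemma nrm_leP v a : 0 <= a -> (nrm v <= a) <-> (forall i, `|coord (vbasis {:V}) i v| <= a).
Proof.
move=> a0; split => [h i|h]; first exact: le_trans (coord_le_nrm v i) h.
by rewrite /nrm [leLHS]mx_normrE; apply/bigmax_leP; split => // -[i j] _ /=; rewrite mxE.
Qed.

Lemma linear_le_nrm (U : normedModType R) (l : {linear V -> U}) :
  exists2 C : R, 0 < C & forall v, `|l v| <= C * nrm v.
Proof.
exists (1 + \sum_(i < \dim {:V}) `|l (vbasis {:V})`_i|) => [|v].
  by rewrite ltr_wpDr// sumr_ge0.
rewrite {1}(coord_vbasis (memvf v)) linear_sum mulrDl mul1r; apply: ler_wpDl; first exact: normr_ge0.
apply: (le_trans (ler_norm_sum _ _ _)); rewrite mulr_suml; apply: ler_sum => i _.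
by rewrite linearZ/= normrZ mulrC ler_wpM2l// coord_le_nrm.
Qed.

Lemma relint_neq0 : F !=set0 -> convex_set (F : set (convex_lmodType V)) -> relint F !=set0.
Proof.
move=> [x0 F0] cF; have [X bX FX] := direction_basis F0.
set d := \dim (direction F) in X bX FX.
pose q (i : 'I_d.+1) : V := if unlift ord0 i is Some j then x0 + tnth X j else x0.
have Fq i : F (q i) by rewrite /q; case: unliftP => [j _|_].
(* All barycentric coordinates of the barycenter equal a = 1 / (d + 1). Moving [d] of them by at
   most a^2 keeps them nonnegative, and the last one stays at least a^2 because d (a + a^2) = 1 -
   a^2. *)
pose a : R := d.+1%:R^-1.
have a0 : 0 < a by rewrite invr_gt0.
have key (x : 'I_d -> R) : (forall i, `|x i| <= a * a) ->
    F (x0 + \sum_i (a + x i) *: tnth X i).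
  move=> xa.
  have -> : x0 + \sum_i (a + x i) *: tnth X i =
    lincomb q (\row_i (if unlift ord0 i is Some j then a + x j else 1 - \sum_j (a + x j))).
    rewrite lincombS /q mxE unlift_none.
    rewrite (_ : \sum_(j < d) _ *: (match unlift ord0 (lift ord0 j) with Some _ => _ | None => _ end) =
      \sum_j ((a + x j) *: x0 + (a + x j) *: tnth X j)); last first.
      by apply: eq_bigr => j _; rewrite mxE liftK scalerDr.
    by rewrite [X in _ = _ + X]big_split /= [RHS]addrA -scaler_suml -scalerDl subrK scale1r.
  apply: convex_lincomb => //; split => [i|].
    rewrite mxE; case: unliftP => [j _|_].
      have := xa j; rewrite ler_norml => /andP[h _].
      have aa : a * a <= a by rewrite ger_pMr// invf_le1 ?ler1n.
      lra.
    rewrite subr_ge0 (le_trans (ler_sum _ (G := fun=> a + a * a) _))//.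
      by move=> j _; rewrite lerD2l (le_trans (ler_norm _)).
    rewrite sumr_const card_ord -[X in X <= _]mulr_natr.
    have -> : (d%:R : R) = a^-1 - 1 by rewrite invrK -natr1 addrK.
    have -> : (a + a * a) * (a^-1 - 1) = 1 - a * a by field; rewrite gt_eqF.
    by rewrite lerBlDr lerDl mulr_ge0// ltW.
  rewrite big_ord_recl mxE unlift_none.
  rewrite [X in _ + X](_ : _ = \sum_j (a + x j)) ?subrK//.
  by apply: eq_bigr => j _; rewrite mxE liftK.
have /choice[C CP] (i : 'I_d) : exists C : R, 0 < C /\ forall v, `|coord X i v| <= C * nrm v.
  by have [C C0 CP] := @linear_le_nrm R^o (coord X i); exists C.
pose M := 1 + \sum_i C i.
have C0 i : 0 < C i := (CP i).1.
have M0 : 0 < M by rewrite ltr_wpDr// sumr_ge0// => i _; exact: ltW.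
exists (x0 + \sum_i (a + 0) *: tnth X i); split.
  by apply: key => i; rewrite normr0 mulr_ge0// ltW.
exists (a * a / M) => [|v vF nv]; first by rewrite divr_gt0// mulr_gt0.
have -> : x0 + \sum_i (a + 0) *: tnth X i + v = x0 + \sum_i (a + coord X i v) *: tnth X i.
  rewrite -addrA; congr (_ + _).
  rewrite {1}(coord_basis bX vF) -big_split; apply: eq_bigr => i _ /=.
  by rewrite addr0 scalerDl -(tnth_nth 0).
apply: key => i; apply: (le_trans ((CP i).2 v)).
have : M * nrm v <= a * a by rewrite mulrC -ler_pdivlMr// ltW.
apply: le_trans; rewrite ler_wpM2r//; first exact: normr_ge0.
rewrite /M (bigD1 i)//= addrCA lerDl addr_ge0// sumr_ge0// => j _; exact: ltW.
Qed.

End direction.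

(** A form in the annihilator is constant on F, so the condition may be tested at any one point of
    F. Nonemptiness of the relative interior keeps the original condition from being vacuous. *)
Lemma gammaE (P F : set V) x0 : F x0 -> convex_set (F : set (convex_lmodType V)) ->
  gamma P F = [set xi | [/\ xi != 0, xi \in annihilator (direction F) &
    forall y, P y -> xi (y - x0) <= 0]].
Proof.
move=> F0 cF; have [x1 rx1] : relint F !=set0 by apply: relint_neq0 => //; exists x0.
have F1 : F x1 by case: rx1.
have E x y (xi : 'Hom(V, R^o)) : F x -> xi \in annihilator (direction F) -> xi (y - x) = xi (y - x0).
  move=> Fx /annihilatorP xa; have := xa _ (direction_sub Fx F0).
  by rewrite !linearB/= => /eqP; rewrite subr_eq0 => /eqP ->.
apply/seteqP; split => xi [xi0 xa H]; split => //.
  by move=> y Py; rewrite -(E _ _ _ F1 xa); exact: H.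
by move=> x [Fx _] y Py; rewrite (E _ _ _ Fx xa); exact: H.
Qed.

(** Nested faces of equal dimension have the same direction. The form supporting F is constant along
    it, so F' lies in the same supporting hyperplane. *)
Lemma kface_incl k s (F F' : set V) : s != [::] -> kfaces k (hull s) F -> kfaces k (hull s) F' ->
  F `<=` F' -> F = F'.
Proof.
move=> s0 [[xi FE] dF] [fF' dF'] FF'; apply/seteqP; split => // y F'y.
have [m hm [E ne]] := face_hullE xi s0.
have [x0 Fx0] : F !=set0 by rewrite FE E; exact: hull_neq0.
have dd : direction F = direction F'.
  apply/eqP; rewrite eqEdim dF dF' leqnn andbT.
  by apply: (is_direction_direction F).2 => x z Fx Fz; apply: direction_sub; exact: FF'.
have xiD : (direction F <= lker xi)%VS.
  apply: (is_direction_direction F).2 => x z; rewrite FE => -[hx mx] [hz mz].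
  by rewrite memv_ker linearB subr_eq0 eq_le mz//= mx.
have : y - x0 \in lker xi.
  by apply: (subvP xiD); rewrite dd; apply: direction_sub => //; exact: FF'.
rewrite memv_ker linearB subr_eq0 => /eqP yx.
have Py := face_subset fF' F'y.
by rewrite FE in Fx0 *; split => // z Pz; rewrite /= yx; exact: Fx0.2.
Qed.

End convex_combinations.

(** * Compactness and approximation of convex bodies *)

Section topology.
Variables (R : realType).

Lemma mulmx_continuous d m (M : 'M[R]_(d, m)) (v : 'rV[R]_m) :
  continuous (fun x : 'rV[R]_d => v + x *m M).
Proof.
move=> x A /nbhs_ballP[e /= e0 eA].
pose C := 1 + \sum_i \sum_j `|M i j|.
have C0 : 0 < C by rewrite ltr_wpDr// sumr_ge0// => i _; rewrite sumr_ge0.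
apply/nbhs_ballP; exists (e / C); first by rewrite /= divr_gt0.
move=> y; rewrite mx_norm_ball /ball_ /= => xy; apply: eA.
rewrite mx_norm_ball /ball_/= opprD addrACA subrr add0r -mulmxBl.
move: xy; rewrite ltr_pdivlMr// => xy; rewrite (le_lt_trans _ xy)//.
rewrite [leLHS]mx_normrE; apply/bigmax_leP; split => [|[i j] _ /=]; first by rewrite mulr_ge0// ltW.
rewrite mxE (le_trans (ler_norm_sum _ _ _))// /C mulrDr mulr1 ler_wpDl// mulr_sumr.
apply: ler_sum => l _; rewrite normrM; apply: ler_pM => //.
  rewrite [leRHS]mx_normrE.
  have := le_bigmax 0 (fun ij : 'I_1 * 'I_d => `|(x - y) ij.1 ij.2|) (i, l).
  by [].
by rewrite (bigD1 j)//= lerDl sumr_ge0.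
Qed.

Lemma compact_simplex d : compact (@simplex R d).
Proof.
have cc : compact [set v : 'rV[R]_d | forall i, `[(0 : R), 1]%classic (v ord0 i)].
  by apply: (@rV_compact _ _ (fun=> `[(0 : R), 1]%classic)) => _; exact: segment_compact.
have -> : @simplex R d = [set v : 'rV[R]_d | forall i, `[(0 : R), 1]%classic (v ord0 i)] `&`
    (fun x : 'rV[R]_d => 0 + x *m (const_mx 1 : 'M[R]_(d, 1))) @^-1` [set const_mx 1].
  apply/seteqP; split => c.
    move=> [c0 c1]; split => [i|].
      rewrite /= in_itv/= c0/= -c1 (bigD1 i)//= lerDl sumr_ge0//.
    apply/rowP => i; rewrite /= add0r !mxE -[RHS]c1.
    by apply: eq_bigr => j _; rewrite mxE mulr1.
  move=> [c0 /= c1]; split => [i|]; first by have := c0 i; rewrite /= in_itv/= => /andP[].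
  move/rowP: c1 => /(_ ord0); rewrite add0r !mxE => <-.
  by apply: eq_bigr => j _; rewrite mxE mulr1.
apply: compact_closedI => //; apply: preimage_closed; last first.
  exact: (accessible_closed_set1 (hausdorff_accessible (@norm_hausdorff R 'rV[R]_1))).
by move=> x _; exact: mulmx_continuous.
Qed.

End topology.

Section polytopes.
Variables (R : realType) (V : vectType R).

Lemma coords_lincomb d (p : 'I_d -> V) c : coords (lincomb p c) = c *m \matrix_i coords (p i).
Proof.
apply/rowP => j; rewrite !mxE linear_sum; apply: eq_bigr => i _.
by rewrite linearZ/= !mxE.
Qed.

Lemma coordsD (u v : V) : coords (u + v) = coords u + coords v.
Proof. by have := coords_linear 1 u v; rewrite !scale1r. Qed.

Lemma polytope_convex_body (P : set V) : polytope P -> convex_body P.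
Proof.
move=> [s s0 ->]; rewrite -/(hull s); split; [exact: hull_neq0|exact: convex_hull|].
have -> : (@coords R V) @` hull s = (fun c => 0 + c *m \matrix_i coords (tnth (in_tuple s) i)) @` @simplex R (size s).
  rewrite hullE; apply/seteqP; split => x [y].
    by move=> [c c1 <-] <-; exists c; rewrite // add0r coords_lincomb.
  move=> c1 <-; exists (lincomb (tnth (in_tuple s)) y); first by exists y.
  by rewrite add0r coords_lincomb.
apply: continuous_compact; last exact: compact_simplex.
by apply: continuous_subspaceT => x; exact: mulmx_continuous.
Qed.

Lemma measurable_convex_body (A : set V) (x0 : V) d (e : 'I_d -> V) : convex_body A ->
  measurable [set t : d.-tuple (measurableTypeR R) | A (x0 + lincomb e (rV_of t))].
Proof.
move=> [_ _ cA].
have clA : closed ((@coords R V) @` A) by apply: compact_closed => //; exact: norm_hausdorff.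
pose g (x : 'rV[R]_d) := coords x0 + x *m \matrix_i coords (e i).
have -> : [set t : d.-tuple (measurableTypeR R) | A (x0 + lincomb e (rV_of t))] =
    [set t | (g @^-1` ((@coords R V) @` A)) (rV_of t)].
  apply/seteqP; split => t /=; rewrite /g -coords_lincomb -coordsD; first by exists (x0 + lincomb e (rV_of t)).
  by move=> [a Aa /coords_inj <-].
apply: measurable_rV_of_closed; apply: preimage_closed => // x _.
exact: mulmx_continuous.
Qed.

Lemma nrm_sub (u v : V) : nrm (u - v) = `|coords u - coords v|.
Proof. by rewrite /nrm coordsB. Qed.

Lemma nrm_ge0 (u : V) : 0 <= nrm u. Proof. exact: normr_ge0. Qed.

Lemma convex_body_bounded (A : set V) : convex_body A -> exists2 rho : R, 0 < rho &
  forall v, A v -> nrm v <= rho.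
Proof.
move=> [_ _ /compact_bounded[M [_ MP]]]; exists (`|M| + 1); first by rewrite ltr_wpDl.
move=> v Av; apply: (MP (`|M| + 1)); last by exists v.
by rewrite (le_lt_trans (ler_norm _))// ltrDl.
Qed.

(** The hull of a finite net of points of A, which exists by compactness. Taking it inside A lets
    bounds on A carry over to the polytope. *)
Lemma polytope_approx (A : set V) (d : R) : convex_body A -> 0 < d ->
  exists P, [/\ polytope P, P `<=` A & forall a, A a -> exists2 p, P p & nrm (a - p) <= d].
Proof.
move=> [A0 cA coA] d0.
move: coA; rewrite compact_cover => /(_ _ ((@coords R V) @` A) (fun x => ball x d)) H.
have [||D DA cover] := H; first by move=> x _; exact: ball_open.
  by move=> x Ax; exists x => //; exact: ballxx.
have /finite_seqP[l Dl] := finite_fset D.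
rewrite /classical_sets.cover Dl in cover.
pose pre y : V := xget 0 [set v | A v /\ coords v = y].
have preP y : y \in l -> A (pre y) /\ coords (pre y) = y.
  move=> yl; have /set_mem[v Av vy] : y \in (@coords R V) @` A.
    by apply: DA; have : [set` l] y := yl; rewrite -Dl.
  by apply: (@xgetPex _ 0 [set v | A v /\ coords v = y]); exists v.
pose s := [seq pre y | y <- l].
have sA v : v \in s -> A v by move=> /mapP[y yD ->]; exact: (preP y yD).1.
have sapp a : A a -> exists2 p, p \in s & nrm (a - p) <= d.
  move=> Aa; have [y /= yD] : (\bigcup_(x in [set` l]) ball x d) (coords a) by apply: cover; exists a.
  rewrite mx_norm_ball /ball_ /= => yd; exists (pre y); first by apply/mapP; exists y.
  by rewrite nrm_sub (preP y yD).2 distrC ltW.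
have s0 : s != [::].
  have [a Aa] := A0; have [p ps _] := sapp a Aa.
  by apply: contraTneq ps => ->.
exists (hull s); split; first by exists s.
- by move=> v; apply; split => // u; exact: sA.
- by move=> a /sapp[p ps ap]; exists p => //; exact: mem_hull.
Qed.

End polytopes.

(** * Bound by disjoint pieces of a neighborhood *)

Section normal_cones.
Variables (R : realType) (V : vectType R).
Local Notation "V '" := ('Hom(V, R^o)) (at level 8, format "V '").
Local Notation rtuple d := (d.-tuple (measurableTypeR R)).

Lemma measurable_pairing d (w : 'I_d -> V ') (v : V) (D : set (measurableTypeR R)) : measurable D ->
  measurable [set z : rtuple d | D (lincomb w (rV_of z) v)].
Proof.
move=> mD; pose a : 'cV[R]_d := \col_j w j v.
have E (z : rtuple d) : lincomb w (rV_of z) v = (rV_of z *m a) ord0 ord0.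
  by rewrite /lincomb sum_lfunE mxE; apply: eq_bigr => j _; rewrite scale_lfunE !mxE.
rewrite (_ : mkset _ = [set z | D ((rV_of z *m a) ord0 ord0)]); last first.
  by apply/seteqP; split => z; rewrite /= E.
by apply: (measurable_preimage _ mD); exact: measurable_rV_of.
Qed.

Lemma coord_tcast m m' (e : m = m') (X : m.-tuple V) i v :
  coord (tcast e X) i v = coord X (cast_ord (esym e) i) v.
Proof. by case: m' / e i => i; rewrite tcast_id cast_ord_id. Qed.

Lemma gamma_cone (P F : set V) : cone (gamma P F).
Proof.
have H a xi : 0 < a -> gamma P F xi -> gamma P F (a *: xi).
  move=> a0 [x0 xa x1]; split; [by rewrite scaler_eq0 negb_or gt_eqF|by rewrite memvZ|].
  by move=> x Fx y Py; rewrite scale_lfunE pmulr_rle0// x1.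
move=> a xi a0; split => [/(H a^-1)|]; last exact: H.
by rewrite invr_gt0 scalerA mulVf ?gt_eqF// scale1r; apply.
Qed.

(** Finitely many linear conditions describe the cone: some value on a basis of V is nonzero, all
    values on a basis of the direction vanish, and the values at the generators minus one point of F
    are at most 0. *)
Lemma measurable_cone_gamma r s (F : set V) : s != [::] -> face (hull s) F ->
  measurable_cone r (gamma (hull s) F).
Proof.
move=> s0 fF; split => [|w]; first exact: gamma_cone.
have [m FE ne] := face_hull s0 fF.
have cF : convex_set (F : set (convex_lmodType V)) by rewrite FE; exact: convex_hull.
have [x0 Fx0] : F !=set0 by rewrite FE; exact: hull_neq0.
rewrite (gammaE _ Fx0 cF).
pose X z := lincomb w (rV_of z : 'rV[R]_(r.+1)).
rewrite (_ : mkset _ = ((~` \bigcap_(i in [set: 'I_(\dim {:V})]) [set z | [set (0 : R)] (X z (tnth (vbasis {:V}) i))]) `&`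
  \bigcap_(i in [set: 'I_(\dim (direction F))]) [set z | [set (0 : R)] (X z (vbasis (direction F))`_i)]) `&`
  \bigcap_(i in [set: 'I_(size s)]) [set z | `]-oo, (0 : R)]%classic (X z (tnth (in_tuple s) i - x0))]).
  apply: measurableI; last first.
    by apply: fin_bigcap_measurable => // i _; apply: measurable_pairing.
  apply: measurableI.
    by apply: measurableC; apply: fin_bigcap_measurable => // i _; apply: measurable_pairing.
  by apply: fin_bigcap_measurable => // i _; apply: measurable_pairing.
apply/seteqP; split => z.
  move=> [z0 za zs]; split; first split.
  - move=> H; move/eqP: z0; apply; apply: (dual_ext (vbasisP _)) => l.
    by rewrite (H l I) zero_lfunE.
  - move=> i _ /=; have /annihilatorP := za; apply.
    by apply/vbasis_mem/mem_nth; rewrite size_tuple.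
  - by move=> i _; rewrite /= in_itv/=; apply: zs; apply: mem_hull; exact: mem_tnth.
move=> [[z0 za] zs]; split.
- apply/eqP => z0'; apply: z0 => i _ /=; rewrite /X.
  by rewrite [lincomb _ _]z0' zero_lfunE.
- apply/annihilatorP => v /coord_vbasis ->; rewrite linear_sum big1// => i _.
  by rewrite linearZ/= [X in _ *: X](za i I) scaler0.
move=> y Py; rewrite linearB subr_le0; move: y Py; apply: hull_linear_le => v vs.
have [i ->] : exists i, v = tnth (in_tuple s) i by exact/tnthP.
by have := zs i I; rewrite /= in_itv/= linearB subr_le0.
Qed.

End normal_cones.

Section steiner.
Variables (R : realType) (V : vectType R) (k r : nat).
Local Notation "V '" := ('Hom(V, R^o)) (at level 8, format "V '").
Local Notation n := (k + r.+1)%N.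
Local Notation rtuple d := (d.-tuple (measurableTypeR R)).
Local Notation lam d := (@lebesgue_tuple R d).
Hypothesis dV : \dim {:V} = n.
Variables (b0 : n.-tuple V) (b0B : basis_of {:V} b0).
Hypothesis nrm_crd : forall v, nrm v = `|crd b0 v|.
Variables (s : seq V) (s0 : s != [::]).
Local Notation P := (hull s).

Definition face_frame (F : set V) : 'I_k -> V := fun i => (vbasis (direction F))`_i.
Definition normal_frame (F : set V) : 'I_r.+1 -> V ' :=
  fun i => (vbasis (annihilator (direction F)))`_i.
Definition face_point F (t : rtuple k) : V := xget 0 F + lincomb (face_frame F) (rV_of t).
Definition face_set F (G : set V) : set (rtuple k) := [set t | G (face_point F t)].

Lemma face_frame_frame F : kfaces k P F -> is_frame (direction F) (face_frame F).
Proof. by move=> [_ dF]; exact: vbasis_frame. Qed.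

Lemma normal_frame_frame F : kfaces k P F -> is_frame (annihilator (direction F)) (normal_frame F).
Proof. by move=> [_ dF]; apply: vbasis_frame; exact: dim_annihilator dV dF. Qed.

Lemma kface_polytope F : kfaces k P F -> polytope F.
Proof. by move=> [/(face_hull s0)[m -> ne] _]; exists (mask m s). Qed.

Lemma kface_xget F : kfaces k P F -> F (xget 0 F).
Proof. by move=> /kface_polytope/polytope_convex_body[[x Fx] _ _]; exact: (xgetPex 0 (ex_intro _ x Fx)). Qed.

Lemma measurable_face_set F G : kfaces k P G -> measurable (face_set F G).
Proof. by move=> /kface_polytope/polytope_convex_body bF; exact: measurable_convex_body. Qed.

(** A form [xi] exposing G is constant on G. If it varies along F, the intersection lies in a
    hyperplane of the parameter space; if not, one common point puts all of F into G, which forces F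
    = G. *)
Lemma face_set_null F G : kfaces k P F -> kfaces k P G -> G <> F ->
  lam k (face_set F F `&` face_set F G) = 0%E.
Proof.
move=> kF kG GF; have [[xi GE] _] := kG.
have mI : measurable (face_set F F `&` face_set F G) by apply: measurableI; exact: measurable_face_set.
have [z0 Gz0] : G !=set0 by exists (xget 0 G); exact: kface_xget.
have xG z : G z -> xi z = xi z0.
  by move=> Gz; apply: le_anti; move: Gz Gz0; rewrite GE => -[Pz z1] [Pz0 z2]; rewrite z1// z2.
pose a : 'cV[R]_k := \col_j xi (face_frame F j).
have xE t : xi (face_point F t) = xi (xget 0 F) + (rV_of t *m a) ord0 ord0.
  rewrite linearD /lincomb linear_sum mxE; congr (_ + _).
  by apply: eq_bigr => j _; rewrite linearZ/= !mxE.
have [a0|a0] := eqVneq a 0; last first.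
  apply/eqP; rewrite -measure_le0 -(lebesgue_hyperplane (xi z0 - xi (xget 0 F)) a0).
  apply: le_measure; [exact: mem_set| |].
    apply: mem_set; apply: (@measurable_preimage _ _ _ _ (fun t : rtuple k => (rV_of t *m a) ord0 ord0) [set (xi z0 - xi (xget 0 F) : measurableTypeR R)]) => //.
    exact: measurable_rV_of.
  by move=> t [_ /xG]; rewrite xE /= => <-; rewrite addrC addKr.
suff -> : face_set F F `&` face_set F G = set0 by rewrite measure0.
apply/seteqP; split => // t [Ft Gt]; apply: GF; apply/esym.
apply: (kface_incl s0 kF kG) => y Fy.
have yE : xi y = xi z0.
  have [x ->] : exists x, y = xget 0 F + lincomb (face_frame F) x.
    have [x xE'] := frame_span (face_frame_frame kF) kF.2 (direction_sub Fy (kface_xget kF)).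
    by exists x; rewrite -xE' addrC subrK.
  have := xG _ Gt; rewrite xE a0 mulmx0 mxE addr0 => <-.
  rewrite linearD /lincomb linear_sum big1 ?addr0// => j _; rewrite linearZ/=.
  by move/colP: a0 => /(_ j); rewrite !mxE => ->; rewrite scaler0.
move: Gz0; rewrite GE => -[Pz0 mz]; split; first exact: (face_subset kF.1).
by move=> z Pz; rewrite yE; exact: mz.
Qed.

(** Used instead of the relative interior: removing the other k-faces costs a null set and makes F
    recoverable from any remaining point, so the pieces are truly disjoint. *)
Definition face_open F : set (rtuple k) :=
  face_set F F `\` \bigcup_(G in kfaces k P `\ F) face_set F G.

Lemma measurable_face_open F : kfaces k P F -> measurable (face_open F).
Proof.
move=> kF; apply: measurableD; first exact: measurable_face_set.
apply: fin_bigcup_measurable; first by apply: finite_setD; exact: finite_kfaces.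
by move=> G [kG _]; exact: measurable_face_set.
Qed.

Lemma null_bigcup (I : choiceType) (A : set I) (N : I -> set (rtuple k)) : finite_set A ->
  (forall i, A i -> measurable (N i) /\ lam k (N i) = 0%E) -> lam k (\bigcup_(i in A) N i) = 0%E.
Proof.
move=> /finite_seqP[l ->]; elim: l => [|i l IH] H.
  by rewrite (_ : [set` [::]] = set0) ?bigcup_set0 ?measure0//; apply/seteqP; split.
have Hl j : [set` l] j -> measurable (N j) /\ lam k (N j) = 0%E.
  by move=> jl; apply: H; rewrite /= inE jl orbT.
rewrite (_ : [set` i :: l] = i |` [set` l]); last first.
  apply/seteqP; split => j /=; rewrite inE; first by move=> /orP[/eqP|]; [left|right].
  by move=> [->|->]; rewrite ?eqxx ?orbT.
rewrite bigcup_setU1; have [mi i0] := H i (mem_head _ _).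
have mU : measurable (\bigcup_(j in [set` l]) N j).
  by apply: fin_bigcup_measurable => [|j jl]; [exact: finite_seq|exact: (Hl j jl).1].
by rewrite setUC measureU0//; exact: IH.
Qed.

Lemma lebesgue_face_open F : kfaces k P F -> lam k (face_open F) = lam k (face_set F F).
Proof.
move=> kF; pose N := \bigcup_(G in kfaces k P `\ F) (face_set F F `&` face_set F G).
have fin : finite_set (kfaces k P `\ F) by apply: finite_setD; exact: finite_kfaces.
have HN G : (kfaces k P `\ F) G -> measurable (face_set F F `&` face_set F G) /\
    lam k (face_set F F `&` face_set F G) = 0%E.
  move=> [kG GF]; split; last exact: face_set_null.
  by apply: measurableI; exact: measurable_face_set.
have -> : face_set F F = face_open F `|` N.
  by rewrite /N -setI_bigcupr /face_open setUC setUIDK.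
rewrite measureU0//; [exact: measurable_face_open| |exact: null_bigcup].
by apply: fin_bigcup_measurable => // G kG; have [] := HN G kG.
Qed.

Local Notation M F := (frame_mx b0 (face_frame F) (normal_frame F)).
Local Notation sh F := (shell (dnorm b0) (gamma P F) (normal_frame F)).

(* Almost all points [x + xi] whose nearest point of [P] is [x] in [F] and for which
   [xi], a normal vector at [x], has norm between 1 and 2; [b0] identifies V and its
   dual. *)
Definition face_piece F : set (rtuple n) := [set q |
  let p : rtuple n := taff (invmx (M F)) (- crd b0 (xget 0 F) *m invmx (M F)) q in
  face_open F (tleft p) /\ sh F (tright p)].

(** Both blocks of rows are free and mutually orthogonal: if u Em + v Wm = 0, pairing with v Wm
    gives |v Wm|^2 = 0. *)
Lemma det_face_frame F : kfaces k P F -> \det (M F) != 0.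
Proof.
move=> kF; have fe := face_frame_frame kF; have fw := normal_frame_frame kF.
have Ef := frame_row_free b0B fe; have Wf := dual_frame_row_free b0B fw.
have EW : (\matrix_i crd b0 (face_frame F i)) *m (\matrix_j dcrd b0 (normal_frame F j))^T = 0.
  apply/matrixP => i j; have /annihilatorP := frame_mem fw j.
  move=> /(_ _ (frame_mem fe i)); rewrite -(pairingE b0B) mxE => h.
  by rewrite [RHS]mxE -[RHS]h; rewrite !mxE; apply: eq_bigr => l _; rewrite !mxE.
rewrite -unitfE -unitmxE -row_free_unit -kermx_eq0; apply/eqP/row_matrixP => i; rewrite row0.
set x := row i _; have : x *m M F = 0 by rewrite -row_mul mulmx_ker row0.
rewrite -[x]hsubmxK /frame_mx mul_row_col => xM.
set u := lsubmx x in xM *; set v := rsubmx x in xM *.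
set Em := (X in u *m X + _) in xM EW Ef; set Wm := (X in _ + v *m X) in xM EW Wf.
have sq0 (y : 'rV[R]_n) : y *m y^T = 0 -> y = 0.
  move=> /matrixP/(_ ord0 ord0); rewrite !mxE => /eqP.
  rewrite psumr_eq0 => [/allP h|j _]; last by rewrite mxE -expr2 sqr_ge0.
  apply/rowP => j; have := h j (mem_index_enum _); rewrite /= mxE mulf_eq0 orbb mxE.
  by move/eqP.
have v0 : v *m Wm = 0.
  apply: sq0; have : (u *m Em + v *m Wm) *m (v *m Wm)^T = 0 by rewrite xM mul0mx.
  by rewrite mulmxDl [X in X + _](_ : _ = 0) ?add0r// trmx_mul mulmxA -(mulmxA u) EW mulmx0 mul0mx.
have u0 : u *m Em = 0 by rewrite v0 addr0 in xM.
have -> : u = 0 by apply: (row_free_inj Ef); rewrite u0 mul0mx.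
have -> : v = 0 by apply: (row_free_inj Wf); rewrite v0 mul0mx.
exact: row_mx0.
Qed.

Lemma measurable_shell_face F : kfaces k P F -> measurable (sh F).
Proof.
move=> kF; exact: (measurable_shell b0 (measurable_cone_gamma r s0 kF.1)).
Qed.

Lemma measurable_face_piece F : kfaces k P F -> measurable (face_piece F).
Proof.
move=> kF; apply: measurableI.
  apply: (measurable_preimage (f := (@tleft R k r.+1) \o taff _ _)); last exact: measurable_face_open.
  by apply: measurableT_comp; [exact: measurable_tleft|exact: measurable_taff].
apply: (measurable_preimage (f := (@tright R k r.+1) \o taff _ _)); last exact: measurable_shell_face.
by apply: measurableT_comp; [exact: measurable_tright|exact: measurable_taff].
Qed.

(** The piece is the preimage of a product of a face and a shell under an affine map with linear
    part [invmx (M F)]. *)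
Lemma lebesgue_face_piece F : kfaces k P F ->
  lam n (face_piece F) = (`|\det (M F)|%:E * (lam k (face_set F F) * lam r.+1 (sh F)))%E.
Proof.
move=> kF; have d0 := det_face_frame kF.
rewrite -lebesgue_face_open// -lebesgue_tuple_prod; [|exact: measurable_face_open|exact: measurable_shell_face].
set A := [set z : rtuple n | _].
have mA : measurable A.
  apply: measurableI.
    by apply: measurable_preimage; [exact: measurable_tleft|exact: measurable_face_open].
  by apply: measurable_preimage; [exact: measurable_tright|exact: measurable_shell_face].
have di : \det (invmx (M F)) != 0 by rewrite det_inv invr_neq0.
have mi : measurable_fun setT (fun q : rtuple n => (\1_A q : R)%:E).
  by apply/measurable_EFinP; exact: measurable_indic.
have i0 (x : rtuple n) : (0 <= (\1_A x : R)%:E)%E by rewrite lee_fin.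
have := ge0_integral_taff (- crd b0 (xget 0 F) *m invmx (M F)) di mi i0.
rewrite (_ : \int[lam n]_t (\1_A t)%:E = lam n A)%E; last by rewrite integral_indic// setIT.
rewrite det_inv normfV invrK => <-.
rewrite -[in LHS](setIT (face_piece F)) -integral_indic//; last exact: measurable_face_piece.
Qed.

Lemma face_pieceP F q : kfaces k P F -> face_piece F q -> exists y xi,
  [/\ F y, forall G, kfaces k P G -> G <> F -> ~ G y, gamma P F xi, dnorm b0 xi <= 2
    & rV_of q = crd b0 y + dcrd b0 xi].
Proof.
move=> kF; rewrite /face_piece /=; set p : rtuple n := taff _ _ q; move=> [[Fp Gp] [/andP[_ d2] gp]].
exists (face_point F (tleft p)), (lincomb (normal_frame F) (rV_of (tright p))); split => //.
- by move=> G kG GF Gy; apply: Gp; exists G.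
have uM : M F \in unitmx by rewrite unitmxE unitfE det_face_frame.
have : rV_of p *m M F = rV_of q - crd b0 (xget 0 F).
  by rewrite /p /taff t_ofK -mulmxDl -mulmxA mulVmx// mulmx1.
clearbody p; have -> : crd b0 (face_point F (tleft p)) = crd b0 (xget 0 F) + rV_of (tleft p) *m \matrix_i crd b0 (face_frame F i).
  by rewrite -crd_lincomb; apply/rowP => i; rewrite !mxE linearD.
rewrite dcrd_lincomb /tleft /tright !t_ofK -{1}[rV_of p]hsubmxK mul_row_col => h.
by rewrite -addrA h addrC subrK.
Qed.

(** Uniqueness of the nearest point. If y + xi = y' + xi', then |y' - y|^2 = xi (y' - y) + xi' (y -
    y'), and both terms are at most 0 by normality, so y = y'. *)
Lemma trivIset_face_piece : trivIset (kfaces k P) face_piece.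
Proof.
move=> F F' kF kF' [q [qF qF']]; apply/eqP/negPn/negP => /eqP FF'.
have [y [xi [Fy _ gx _ qE]]] := face_pieceP kF qF.
have [y' [xi' [Fy' nG gx' _ qE']]] := face_pieceP kF' qF'.
have cF G : kfaces k P G -> convex_set (G : set (convex_lmodType V)).
  by move=> /kface_polytope/polytope_convex_body[].
have g1 : xi (y' - y) <= 0.
  by move: gx; rewrite (gammaE _ Fy (cF _ kF)) => -[_ _]; apply; exact: (face_subset kF'.1).
have g2 : xi' (y - y') <= 0.
  by move: gx'; rewrite (gammaE _ Fy' (cF _ kF')) => -[_ _]; apply; exact: (face_subset kF.1).
have dE : crd b0 (y' - y) = dcrd b0 (xi - xi').
  apply/rowP => i.
  have := congr1 (fun z : 'rV[R]_n => z ord0 i) (etrans (esym qE) qE').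
  by rewrite !mxE linearB/= add_lfunE opp_lfunE => h; apply/eqP; rewrite subr_eq addrAC eq_sym subr_eq addrC h addrC.
have yy : y' = y.
  apply/eqP; rewrite -subr_eq0; apply/eqP; apply: (crd_inj b0B).
  have := pairingE b0B (xi - xi') (y' - y); rewrite -dE mxE => h.
  have h0 : \sum_j crd b0 (y' - y) ord0 j ^+ 2 <= 0.
    rewrite (eq_bigr (fun j => crd b0 (y' - y) ord0 j * ((crd b0 (y' - y))^T j ord0))); last first.
      by move=> j _; rewrite expr2; congr (_ * _); rewrite [RHS]mxE.
    rewrite h add_lfunE opp_lfunE -linearN opprB.
    by rewrite -[leRHS]addr0 lerD.
  apply/rowP => j; apply/eqP; rewrite [X in _ == X]mxE linear0 -sqrf_eq0 eq_le sqr_ge0 andbT.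
  by apply: le_trans h0; rewrite (bigD1 j)//= lerDl sumr_ge0// => l _; rewrite sqr_ge0.
by apply: (nG F) => //; rewrite yy.
Qed.

Lemma face_piece_box F rho : kfaces k P F -> (forall v, P v -> nrm v <= rho) ->
  face_piece F `<=` @tbox R n (rho + 2).
Proof.
move=> kF Pr q /(face_pieceP kF)[y [xi [Fy _ _ d2 qE]]] i.
have -> : tnth q i = (rV_of q) ord0 i by rewrite mxE.
rewrite qE mxE (le_trans (ler_normD _ _))// lerD//.
  apply: le_trans (Pr y (face_subset kF.1 Fy)); rewrite nrm_crd.
  by move/mx_norm_leP: (lexx `|crd b0 y|); apply.
apply: le_trans d2; by move/mx_norm_leP: (lexx `|dcrd b0 xi|); apply.
Qed.

Lemma sum_face_piece rho : (forall v, P v -> nrm v <= rho) ->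
  \sum_(F \in kfaces k P) `|\det (M F)| * fine (lam k (face_set F F)) * fine (lam r.+1 (sh F)) <=
  fine (lam n (@tbox R n (rho + 2))).
Proof.
move=> Pr; have fin : finite_set (kfaces k P) by exact: finite_kfaces.
have H F : kfaces k P F -> ((`|\det (M F)| * fine (lam k (face_set F F)) * fine (lam r.+1 (sh F)))%:E <= lam n (face_piece F))%E.
  move=> kF; rewrite lebesgue_face_piece// -mulrA EFinM lee_wpmul2l ?lee_fin//.
  have : (0 <= lam k (face_set F F))%E by exact: measure_ge0.
  have s1 : (lam r.+1 (sh F) = (fine (lam r.+1 (sh F)))%:E)%E.
    rewrite fineK// ge0_fin_numE//; apply: (lebesgue_shell_lty b0B _ (normal_frame_frame kF)).
    exact: (measurable_cone_gamma r s0 kF.1).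
  rewrite {2}s1.
  (* Should the face have infinite measure, [fine] would return 0 and the inequality would hold
     trivially. *)
  case: (lam k (face_set F F)) => [x| |] x0; [by rewrite EFinM| |by []].
  by rewrite mul0r mule_ge0// lee_fin fine_ge0.
have bx := @lebesgue_tbox R n (rho + 2).
rewrite -lee_fin fineK; last by rewrite ge0_fin_numE.
rewrite -fsumEFin//.
apply: le_trans (_ : lam n (\bigcup_(F in kfaces k P) face_piece F) <= _)%E; last first.
  apply: le_measure; [|by apply: mem_set; exact: measurable_tbox|].
    by apply: mem_set; apply: fin_bigcup_measurable => // F kF; exact: measurable_face_piece.
  by move=> q [F kF]; exact: face_piece_box.
rewrite measure_fin_bigcup//; [|exact: trivIset_face_piece|by move=> F kF; exact: measurable_face_piece].
by apply: lee_fsum.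
Qed.

Lemma face_measureE (f : smooth_section V k r) F :
  face_measure (fiber_integral f (direction F) (gamma P F)) F =
  frame_integral (direction F) f (gamma P F) (face_frame F) (normal_frame F) *
  (fine (lam k (face_set F F)))%:C%C.
Proof.
rewrite /face_measure; congr (_ * (fine _)%:C%C); congr lebesgue_tuple.
have E t : lincomb (face_frame F) (rV_of t) = \sum_(i < k) tnth t i *: (vbasis (direction F))`_i.
  by apply: eq_bigr => i _; rewrite mxE.
by apply/seteqP; split => t; rewrite /face_set /face_point /= E.
Qed.

Lemma part_phi b (f : smooth_section V k r) : part b (phi f P) = \sum_(F \in kfaces k P)
  part b (frame_integral (direction F) f (gamma P F) (face_frame F) (normal_frame F)) *
  fine (lam k (face_set F F)).
Proof.
rewrite /phi !fsbig_finite; try exact: finite_kfaces.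
rewrite (big_morph _ (@partD R b) (@part0 R b)); apply: eq_bigr => F _.
by rewrite face_measureE mulrC partZ mulrC.
Qed.

(** [frame_integral_bound] estimates the coefficient of a face by the determinant times the shell
    volume; multiplied by the volume of the face this is the volume of its piece. *)
Lemma phi_bound b (f : smooth_section V k r) K rho : (forall v, P v -> nrm v <= rho) ->
  (forall s z, unit_cube z -> `|part b (local_rep (permuted b0 s) z f)| <= K) ->
  fine (log_mass R) * `|part b (phi f P)| <=
  (r.+1%:R ^+ r.+1 * n`!%:R * K) * fine (lam n (@tbox R n (rho + 2))).
Proof.
move=> Pr fK; have K0 : 0 <= K.
  apply: le_trans (normr_ge0 _) (fK 1%g (0, 0) _).
  by split => [i j|j]; rewrite mxE normr0.
have l0 : 0 <= fine (log_mass R) by apply/fine_ge0/ltW/log_mass_gt0.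
set c := r.+1%:R ^+ _ * _ * _; have c0 : 0 <= c by rewrite !mulr_ge0// exprn_ge0.
apply: (@le_trans _ _ (c * \sum_(F \in kfaces k P) `|\det (M F)| * fine (lam k (face_set F F)) * fine (lam r.+1 (sh F)))); last first.
  by rewrite ler_wpM2l// sum_face_piece.
have fin : finite_set (kfaces k P) by exact: finite_kfaces.
rewrite part_phi !fsbig_finite// -[fine (log_mass R)]ger0_norm// -normrM mulr_sumr mulr_sumr.
apply: (le_trans (ler_norm_sum _ _ _)); rewrite !big_seq; apply: ler_sum => F.
rewrite in_fset_set// => /set_mem kF; rewrite mulrA !normrM ger0_norm//.
rewrite [X in _ * X <= _]ger0_norm ?fine_ge0//.
rewrite [leRHS](_ : _ = (c * `|\det (M F)| * fine (lam r.+1 (sh F))) * fine (lam k (face_set F F))); last by ring.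
rewrite ler_wpM2r ?fine_ge0//.
exact: (frame_integral_bound b0B dV kF.2 (measurable_cone_gamma r s0 kF.1) (face_frame_frame kF) (normal_frame_frame kF) fK).
Qed.

End steiner.

(** * Extension by continuity *)

Section hausdorff.
Variables (R : realType) (V : vectType R).
Implicit Types (A B P : set V) (u v : set V -> R).

Definition hausdorff_close A B (eps : R) := [/\ 0 <= eps,
  forall a, A a -> exists2 b, B b & nrm (a - b) <= eps &
  forall b, B b -> exists2 a, A a & nrm (a - b) <= eps].

Lemma hausdorff_dist_le A B eps : hausdorff_close A B eps -> hausdorff_dist A B <= eps.
Proof. by move=> h; apply: ge_inf => //; exists 0 => x []. Qed.

Lemma hausdorff_dist_lt A B delta : convex_body A -> convex_body B ->
  hausdorff_dist A B < delta -> exists2 eps, hausdorff_close A B eps & eps < delta.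
Proof.
move=> bA bB; apply: inf_lt.
(* Boundedness makes the set of admissible radii nonempty, so its infimum can be approached from
   within. *)
have [M M0 AM] := convex_body_bounded bA; have [N N0 BN] := convex_body_bounded bB.
have H (a b : V) : A a -> B b -> nrm (a - b) <= M + N.
  move=> /AM aM /BN bN; rewrite nrm_sub; apply: le_trans (ler_normB _ _) _.
  by rewrite lerD.
have [[a0 Aa0] _ _] := bA; have [[b0 Bb0] _ _] := bB.
exists (M + N); split; first by rewrite addr_ge0// ltW.
  by move=> a Aa; exists b0 => //; exact: H.
by move=> b Bb; exists a0 => //; exact: H.
Qed.

Definition real_continuous u := forall A, convex_body A -> forall eps, 0 < eps ->
  exists2 delta : R, 0 < delta & forall B, convex_body B ->
    hausdorff_dist A B < delta -> `|u B - u A| < eps.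

Definition real_extends v := exists2 u, real_continuous u & forall P, polytope P -> u P = v P.

Lemma partB b (c c' : R[i]) : part b (c - c') = part b c - part b c'.
Proof. by case: b; case: c => x y; case: c'. Qed.

Lemma extends_part (phi : set V -> R[i]) :
  extends_by_continuity phi <-> forall b, real_extends (fun P => part b (phi P)).
Proof.
split => [[Phi cPhi PhiE] b|H].
  exists (fun A => part b (Phi A)) => [A bA eps e0|P pP]; last by rewrite PhiE.
  have [d d0 dP] := cPhi A bA eps e0; exists d => // B bB AB.
  by rewrite -partB -ltcR; apply: le_lt_trans (part_norm_le _ _) (dP B bB AB).
have [u cu uE] := H true; have [w cw wE] := H false.
exists (fun A => Complex (u A) (w A)) => [A bA eps e0|P pP]; last first.
  by apply: part_ext => -[]; rewrite /part /= ?uE ?wE.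
have e20 : 0 < eps / 2 by rewrite divr_gt0.
have [d d0 dP] := cu A bA _ e20; have [d' d'0 d'P] := cw A bA _ e20.
exists (Num.min d d') => [|B bB]; first by rewrite lt_min d0.
rewrite lt_min => /andP[h h']; apply: le_lt_trans (part_norm_ge _) _.
rewrite ltcR !partB /part /=; have := dP B bB h; have := d'P B bB h'; lra.
Qed.

Lemma real_extends_lin (a : R) v w : real_extends v -> real_extends w ->
  real_extends (fun P => a * v P + w P).
Proof.
move=> [u cu uE] [u' cu' uE']; exists (fun P => a * u P + u' P) => [A bA eps e0|P pP]; last by rewrite uE ?uE'.
have a1 : 0 < `|a| + 1 by rewrite ltr_wpDl.
have e20 : 0 < eps / 2 by rewrite divr_gt0.
have [d d0 dP] := cu A bA _ (divr_gt0 e20 a1); have [d' d'0 d'P] := cu' A bA _ e20.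
exists (Num.min d d') => [|B bB]; first by rewrite lt_min d0.
rewrite lt_min => /andP[h h'].
have -> : a * u B + u' B - (a * u A + u' A) = a * (u B - u A) + (u' B - u' A) by ring.
apply: le_lt_trans (ler_normD _ _) _; rewrite normrM.
have h1 : `|a| * `|u B - u A| <= eps / 2.
  have := dP B bB h; rewrite ltr_pdivlMr// => /ltW; apply: le_trans.
  by rewrite mulrC ler_wpM2l// lerDl.
have := d'P B bB h'; lra.
Qed.

Definition bounded_by A (rho : R) := forall a, A a -> nrm a <= rho.

(** The error may grow with [rho], since [phi_bound] involves the volume of a box around the
    polytope: the convergence is only locally uniform. *)
Definition approximates v (C : R -> R) (eps : R) u := real_continuous u /\
  forall P rho, polytope P -> bounded_by P rho -> `|v P - u P| <= eps * C rho.

(** Both functionals are compared with [v] at a polytope close to B. As it is contained in B, it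
    satisfies both size bounds [r1] and [r2]. *)
Lemma approximates_le v C e1 e2 u1 u2 B r1 r2 : convex_body B ->
  approximates v C e1 u1 -> approximates v C e2 u2 -> bounded_by B r1 -> bounded_by B r2 ->
  u1 B - e1 * C r1 <= u2 B + e2 * C r2.
Proof.
move=> bB [c1 a1] [c2 a2] b1 b2; apply/ler_addgt0Pr => e e0.
have e20 : 0 < e / 2 by rewrite divr_gt0.
have [d d0 dP] := c1 B bB _ e20; have [d' d'0 d'P] := c2 B bB _ e20.
pose m := Num.min d d'; have m0 : 0 < m by rewrite lt_min d0.
have m20 : 0 < m / 2 by rewrite divr_gt0.
have [P [pP PB BP]] := polytope_approx bB m20.
have dBP : hausdorff_dist B P < m.
  apply: (@le_lt_trans _ _ (m / 2)); last by rewrite ltr_pdivrMr// ltr_pMr// ltr1n.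
  apply: hausdorff_dist_le; split; [exact: ltW|exact: BP|].
  by move=> b Pb; exists b; [exact: PB|rewrite nrm_sub subrr normr0 ltW].
move: dBP; rewrite lt_min => /andP[dBP d'BP].
have := dP P (polytope_convex_body pP) dBP; have := d'P P (polytope_convex_body pP) d'BP.
have := a1 P r1 pP (fun a Pa => b1 a (PB a Pa)); have := a2 P r2 pP (fun a Pa => b2 a (PB a Pa)).
rewrite !ltr_norml !ler_norml => /andP[? ?] /andP[? ?] /andP[? ?] /andP[? ?]; lra.
Qed.

Lemma bounded_by_close A B rho (eps : R) : bounded_by A rho -> hausdorff_close A B eps ->
  bounded_by B (rho + eps).
Proof.
move=> Ar [_ _ h] b /h[a /Ar ar]; rewrite nrm_sub distrC => ab.
have -> : nrm b = `|coords a + (coords b - coords a)| by rewrite addrC subrK.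
by apply: le_trans (ler_normD _ _) _; rewrite lerD.
Qed.

(* The extension is the common point of the intervals
   [u A - eps C(rho), u A + eps C(rho)], which pairwise intersect. *)
Lemma real_extends_limit v (C : R -> R) : (forall rho, 0 <= C rho) ->
  (forall eps : R, 0 < eps -> exists u, approximates v C eps u) -> real_extends v.
Proof.
move=> C0 H.
pose S B := [set x | exists e u rho, [/\ 0 < e, approximates v C e u, bounded_by B rho & x = u B - e * C rho]].
have SP B e u rho : convex_body B -> 0 < e -> approximates v C e u -> bounded_by B rho ->
    `|sup (S B) - u B| <= e * C rho.
  move=> bB e0 au br; have ubS : ubound (S B) (u B + e * C rho).
    by move=> _ [e' [u' [r' [_ au' br' ->]]]]; exact: (approximates_le bB au' au br' br).
  rewrite ler_distl; apply/andP; split.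
    by apply: ub_le_sup; [exists (u B + e * C rho)|exists e, u, rho].
  by apply: ge_sup => //; exists (u B - e * C rho), e, u, rho.
exists (fun B => sup (S B)) => [A bA eps e0|P pP]; last first.
  have bP := polytope_convex_body pP; have [rho r0 Pr] := convex_body_bounded bP.
  (* The factor 2 accounts for the two errors relative to [u P]; the summand 1 keeps the divisor
     positive where [C rho] vanishes. *)
  have K0 : 0 < 2 * (C rho + 1) by rewrite mulr_gt0// ltr_wpDl.
  apply/eqP; rewrite -subr_eq0 -normr_le0; apply/ler_addgt0Pr => e e0; rewrite add0r.
  have d0 : 0 < e / (2 * (C rho + 1)) by rewrite divr_gt0.
  have [u au] := H _ d0; have := SP P _ u rho bP d0 au Pr; have := au.2 P rho pP Pr.
  set dd := e / _ in d0 *; have : dd * (2 * (C rho + 1)) = e by rewrite /dd divfK// gt_eqF.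
  move=> eE h1 h2; apply: (@le_trans _ _ (`|sup (S P) - u P| + `|v P - u P|)).
    by rewrite (distrC (v P)) -[X in `|X|](subrKA (u P)) ler_normD.
  by rewrite -eE; nra.
have [rho r0 Ar] := convex_body_bounded bA.
(* Three errors enter, each below eps / 4: the supremum against [u] at A and at B, and the variation
   of [u]. The radius rho + 1 covers every B at distance less than 1 from A. *)
have K0 : 0 < 4 * (C (rho + 1) + 1) by rewrite mulr_gt0// ltr_wpDl.
have d0 : 0 < eps / (4 * (C (rho + 1) + 1)) by rewrite divr_gt0.
have [u au] := H _ d0; have e40 : 0 < eps / 4 by rewrite divr_gt0.
have [d dd0 dP] := au.1 A bA _ e40.
exists (Num.min d 1) => [|B bB]; first by rewrite lt_min dd0 ltr01.
rewrite lt_min => /andP[dB /(hausdorff_dist_lt bA bB)[e1 cAB e11]].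
have Br : bounded_by B (rho + 1).
  by move=> b Bb; apply: le_trans (bounded_by_close Ar cAB Bb) _; rewrite lerD2l ltW.
have Ar' : bounded_by A (rho + 1).
  by move=> a Aa; apply: le_trans (Ar a Aa) _; rewrite lerDl.
have := SP A _ u _ bA d0 au Ar'; have := SP B _ u _ bB d0 au Br; have := dP B bB dB.
set x := eps / (4 * _) in d0 *; have xE : x * (4 * (C (rho + 1) + 1)) = eps by rewrite /x divfK// gt_eqF.
have : x * C (rho + 1) < eps / 4 by nra.
rewrite !ltr_norml !ler_norml => ? /andP[? ?] /andP[? ?] /andP[? ?]; apply/andP; split; lra.
Qed.

End hausdorff.

(** * Closedness and linearity of [Xi] *)

Section approximation.
Variables (R : realType) (V : vectType R) (k r : nat).
Local Notation n := (k + r.+1)%N.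
Hypothesis dV : \dim {:V} = n.
Variables (b0 : n.-tuple V) (b0B : basis_of {:V} b0).
Implicit Types f g : smooth_section V k r.

Lemma local_repB (b : n.-tuple V) z f g : local_rep b z (f - g) = local_rep b z f - local_rep b z g.
Proof. by []. Qed.

(** Only the jets of order 0, indexed by the empty list of directions, are used, on a compact cube;
    there are finitely many permutations, so the neighborhoods can be intersected. *)
Lemma nbhs_section f (e : R) : 0 < e -> nbhs f [set g | forall s z, unit_cube z ->
  forall b, `|part b (local_rep (permuted b0 s) z (f - g))| <= e].
Proof.
move=> e0; apply: (@filter_forall _ _ (fun s g => forall z, unit_cube z ->
  forall b, `|part b (local_rep (permuted b0 s) z (f - g))| <= e) (nbhs f)) => s.
pose bs : basis_tuple V k r := exist (fun b : _.-tuple V => basis_of {:V} b) _ (permutedP b0B s).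
pose i : basis_tuple V k r * seq (chart_dom R k r) := (bs, [::]).
pose E := [set xy : (R * R) * (R * R) | ball xy.1 e xy.2].
have ent : entourage E by exact: (entourage_ball _ (PosNum e0)).
have N : nbhs (jets f i) [set h : {family compact, chart_dom R k r -> (R * R)%type} |
    forall z, @unit_cube R k r z -> E (jets f i z, h z)].
  by apply: fam_nbhs => //; exact: compact_unit_cube.
have c1 : {for f, continuous (@jets R V k r)} by apply: initial_continuous.
have c2 := @proj_continuous _ (fun _ => {family compact, chart_dom R k r -> (R * R)%type}) i (jets f).
have N' : nbhs f (fun g : smooth_section V k r => forall z, @unit_cube R k r z ->
    E (jets f i z, jets g i z)) by exact: (c1 _ (c2 _ N)).
apply: (filterS _ N') => g H z zc b.
have [h1 h2] := H z zc; rewrite local_repB partB.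
by case: b; apply/ltW; [exact: h1|exact: h2].
Qed.

Lemma closure_section (S : set (smooth_section V k r)) f (e : R) : closure S f -> 0 < e ->
  exists2 g, S g & forall s z, unit_cube z ->
    forall b, `|part b (local_rep (permuted b0 s) z (f - g))| <= e.
Proof. by move=> cf e0; have [g [Sg H]] := cf _ (nbhs_section f e0); exists g. Qed.

Lemma phi_lin f g (c : R[i]) (P : set V) : polytope P -> phi (c *: f + g) P = c * phi f P + phi g P.
Proof.
move=> [s s0 ->]; rewrite -/(hull s); have fin := finite_kfaces k s0.
have phiE (u : smooth_section V k r) : phi u (hull s) =
    \sum_(F <- finmap.enum_fset (fset_set (kfaces k (hull s))))
    face_measure (fiber_integral u (direction F) (gamma (hull s) F)) F.
  by rewrite /phi fsbig_finite.
rewrite 3!phiE mulr_sumr -big_split [LHS]big_seq [RHS]big_seq.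
apply: eq_bigr => F.
rewrite in_fset_set// => /set_mem kF; rewrite /= !face_measureE.
rewrite mulrA -mulrDl; congr (_ * _).
exact: (frame_integral_lin b0B dV kF.2 c f g (measurable_cone_gamma r s0 kF.1)
  (face_frame_frame kF) (normal_frame_frame dV kF)).
Qed.

Hypothesis nrm_crd : forall v, nrm v = `|crd b0 v|.

Lemma closed_Xi : closed (Xi V k r).
Proof.
move=> f cf; apply/extends_part => b.
pose C0 := r.+1%:R ^+ r.+1 * n`!%:R : R; pose L := fine (log_mass R).
have L0 : 0 < L by rewrite fine_gt0// log_mass_gt0 log_mass_lty.
pose C rho := L^-1 * C0 * fine (@lebesgue_tuple R n (@tbox R n (rho + 2))).
have C0' : 0 <= C0 by rewrite mulr_ge0// exprn_ge0.
apply: (@real_extends_limit _ _ _ C) => [rho|e e0].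
  by apply: mulr_ge0; [apply: mulr_ge0 => //; rewrite invr_ge0 ltW|exact: fine_ge0].
have [g Xg fg] := closure_section cf e0.
have [u cu uE] := (extends_part (phi g)).1 Xg b.
exists u; split => // P rho pP br; rewrite uE// -partB.
have -> : phi f P - phi g P = phi (f - g) P.
  have := phi_lin (f - g) g 1 pP; rewrite scale1r subrK mul1r => ->.
  by rewrite addrK.
case: pP br => s s0 -> br.
have := phi_bound dV b0B nrm_crd s0 br (fun s' z zc => fg s' z zc b).
rewrite -ler_pdivlMl// => /le_trans; apply.
by rewrite /C le_eqVlt; apply/orP; left; apply/eqP; rewrite /C0 /L; ring.
Qed.

Lemma submod_Xi : submod_closed (fun f => f \in Xi V k r).
Proof.
split => [|c f g /set_mem Xf /set_mem Xg]; apply/mem_set.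
  apply/extends_part => b; exists (fun=> 0).
    by move=> A _ eps e0; exists 1 => // B _ _; rewrite subrr normr0.
  move=> P pP; have := phi_lin 0 0 0 pP; rewrite scale0r addr0 mul0r add0r => _.
  (* With scalar 1 and zero sections, [phi_lin] reads phi 0 = phi 0 + phi 0. *)
  have := phi_lin 0 0 1 pP; rewrite scale1r addr0 mul1r -[X in X = _]addr0.
  by move=> /addrI <-; rewrite part0.
apply/extends_part => b.
have ef := (extends_part (phi f)).1 Xf; have eg := (extends_part (phi g)).1 Xg.
have [u cu uE] := real_extends_lin (complex.Re c) (ef b)
  (real_extends_lin (if b then - complex.Im c else complex.Im c) (ef (~~ b)) (eg b)).
by exists u => // P pP; rewrite uE// phi_lin// partD partM addrA.
Qed.

End approximation.

(** * Invariance under GL(V) *)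

Section linear_images.
Variables (R : realType) (V : vectType R).
Local Notation "V '" := ('Hom(V, R^o)) (at level 8, format "V '").
Variables (h g : 'End(V)) (hK : cancel h g) (gK : cancel g h).

Lemma image_cancel (A : set V) : g @` (h @` A) = A.
Proof.
apply/seteqP; split => [_ [_ [a Aa <-] <-]|a Aa]; first by rewrite hK.
by exists (h a); [exists a|rewrite hK].
Qed.

Lemma image_inj : injective (fun A : set V => h @` A).
Proof. by move=> A B AB; rewrite -(image_cancel A) AB image_cancel. Qed.

Lemma image_convex (A : set V) : convex_set (A : set (convex_lmodType V)) ->
  convex_set (h @` A : set (convex_lmodType V)).
Proof.
move=> /convex_setP cA; apply/convex_setP => _ _ t t0 t1 [x Ax <-] [y Ay <-].
by exists (t *: x + (1 - t) *: y); [exact: cA|rewrite linearD !linearZ].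
Qed.

Lemma image_hull s : h @` hull s = hull (map h s).
Proof.
apply/seteqP; split.
  move=> _ [x sx <-]; suff : [set y | hull (map h s) (h y)] x by [].
  apply: sx; split => [|v vs]; last by apply: mem_hull; exact: map_f.
  apply/convex_setP => a b t t0 t1 /= ha hb; rewrite linearD !linearZ.
  by have /convex_setP := @convex_hull R V (map h s); exact.
move=> y; apply; split; first exact/image_convex/convex_hull.
by move=> _ /mapP[v vs ->]; exists v => //; exact: mem_hull.
Qed.

Lemma image_polytope (P : set V) : polytope P -> polytope (h @` P).
Proof.
move=> [s s0 ->]; exists (map h s); first by case: s s0.
by rewrite -/(hull s) image_hull.
Qed.

Lemma image_convex_body (A : set V) : convex_body A -> convex_body (h @` A).
Proof.
move=> [[a Aa] cA coA]; split; [by exists (h a), a|exact: image_convex|].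
pose M := \matrix_(i < \dim {:V}) coords (h (vbasis {:V})`_i).
have hE v : coords (h v) = 0 + coords v *m M.
  have vE : v = lincomb (fun i : 'I_(\dim {:V}) => (vbasis {:V})`_i) (coords v).
    by rewrite {1}(coord_vbasis (memvf v)); apply: eq_bigr => i _; rewrite mxE.
  by rewrite add0r {1}vE linear_lincomb -/(lincomb _ _) coords_lincomb.
rewrite (_ : _ @` _ = (fun x => 0 + x *m M) @` ((@coords R V) @` A)).
  apply: continuous_compact => //; apply: continuous_subspaceT => x; exact: mulmx_continuous.
apply/seteqP; split => [_ [_ [v Av <-] <-]|_ [_ [v Av <-] <-]].
  by exists (coords v); [exists v|rewrite hE].
by exists (h v); [exists v|rewrite hE].
Qed.

Lemma image_nrm : exists2 L : R, 0 < L & forall v, nrm (h v) <= L * nrm v.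
Proof.
pose c (i : 'I_(\dim {:V})) : {linear V -> R^o} := (coord (vbasis {:V}) i \o h)%FUN.
have /choice[L LP] i : exists L : R, 0 < L /\ forall v, `|c i v| <= L * nrm v.
  by have [L L0 LP] := linear_le_nrm (c i); exists L.
exists (1 + \sum_i L i) => [|v]; first by rewrite ltr_wpDr// sumr_ge0// => i _; exact: (ltW (LP i).1).
have L0 : 0 <= 1 + \sum_i L i by rewrite addr_ge0// sumr_ge0// => i _; exact: (ltW (LP i).1).
apply/nrm_leP => [|i]; first by rewrite mulr_ge0// nrm_ge0.
apply: le_trans ((LP i).2 v) _; rewrite ler_wpM2r ?nrm_ge0// (bigD1 i)//= addrCA lerDl addr_ge0// sumr_ge0// => j _.
exact: (ltW (LP j).1).
Qed.

(** A linear map is Lipschitz for the Hausdorff distance, with the constant of [image_nrm]. *)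
Lemma image_real_continuous (u : set V -> R) : real_continuous u ->
  real_continuous (fun A => u (h @` A)).
Proof.
move=> cu A bA eps e0; have [d d0 dP] := cu _ (image_convex_body bA) eps e0.
have [L L0 LP] := image_nrm; exists (d / L) => [|B bB AB]; first by rewrite divr_gt0.
apply: dP; first exact: image_convex_body.
have [e [e00 c1 c2] ed] := hausdorff_dist_lt bA bB AB.
apply: (@le_lt_trans _ _ (L * e)); last by rewrite mulrC -ltr_pdivlMr.
apply: hausdorff_dist_le; split; first by rewrite mulr_ge0// ltW.
  move=> _ [a /c1[b Bb ab] <-]; exists (h b); first by exists b.
  by rewrite -linearB (le_trans (LP _))// ler_wpM2l// ltW.
move=> _ [b /c2[a Aa ab] <-]; exists (h a); first by exists a.
by rewrite -linearB (le_trans (LP _))// ler_wpM2l// ltW.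
Qed.

Lemma direction_image (F : set V) : direction (h @` F) = (h @: direction F)%VS.
Proof.
apply: direction_unique; split => [_ _ [x Fx <-] [y Fy <-]|E' E'F].
  by rewrite -linearB memv_img// direction_sub.
have : (direction F <= g @: E')%VS.
  apply: (is_direction_direction F).2 => x y Fx Fy.
  by rewrite -(hK (x - y)) memv_img// linearB E'F//; [exists x|exists y].
move=> /(limgS h); rewrite -limg_comp (_ : (h \o g)%VF = \1%VF) ?lim1g//.
by apply/lfunP => v; rewrite comp_lfunE gK id_lfunE.
Qed.

Lemma dim_image (E : {vspace V}) : \dim (h @: E) = \dim E.
Proof.
apply: limg_dim_eq; have /eqP -> : lker h == 0%VS by apply/lker0P; exact: can_inj hK.
exact: capv0.
Qed.

Lemma face_image (P F : set V) : face P F -> face (h @` P) (h @` F).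
Proof.
move=> [xi ->]; exists (xi \o g)%VF; apply/seteqP; split.
  move=> _ [x [Px mx] <-]; split; first by exists x.
  by move=> _ [y Py <-]; rewrite !comp_lfunE !hK; exact: mx.
move=> _ [[x Px <-] mx]; exists x => //; split => // y Py.
by have := mx (h y) (ex_intro2 _ _ y Py erefl); rewrite !comp_lfunE !hK.
Qed.

Lemma kfaces_image k (P F : set V) : kfaces k P F -> kfaces k (h @` P) (h @` F).
Proof. by move=> [fF dF]; split; [exact: face_image|rewrite direction_image dim_image]. Qed.

Lemma annihilator_image (E : {vspace V}) (xi : V ') : xi \in annihilator E ->
  transpose g xi \in annihilator (h @: E).
Proof.
move=> /annihilatorP xE; apply/annihilatorP => _ /memv_imgP[v vE ->].
by rewrite comp_lfunE hK xE.
Qed.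

Lemma transpose_cancel : cancel (transpose g : V ' -> V ') (transpose h).
Proof. by move=> xi; apply/lfunP => v; rewrite !comp_lfunE hK. Qed.

Lemma gamma_image s (F : set V) (xi : V ') : s != [::] -> face (hull s) F ->
  gamma (hull s) F xi -> gamma (h @` hull s) (h @` F) (transpose g xi).
Proof.
move=> s0 fF; have [m FE ne] := face_hull s0 fF.
have cF : convex_set (F : set (convex_lmodType V)) by rewrite FE; exact: convex_hull.
have [x0 Fx0] : F !=set0 by rewrite FE; exact: hull_neq0.
have hF : (h @` F) (h x0) by exists x0.
rewrite (gammaE _ Fx0 cF) (gammaE _ hF (image_convex cF)) => -[xi0 xa xP]; split.
- apply: contra_neq xi0 => t0; rewrite -(transpose_cancel xi) t0.
  by apply/lfunP => v; rewrite comp_lfunE !zero_lfunE.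
- by rewrite direction_image annihilator_image.
- by move=> _ [y Py <-]; rewrite -linearB comp_lfunE hK; exact: xP.
Qed.

Lemma image_frame d (E : {vspace V}) (e : 'I_d -> V) : is_frame E e -> is_frame (h @: E)%VS (h \o e).
Proof.
move=> [eE ef]; split => [i|x]; first exact: memv_img.
have -> : lincomb (h \o e) x = h (lincomb e x) by rewrite linear_lincomb.
by rewrite -[X in _ = X](linear0 h) => /(can_inj hK)/ef.
Qed.

Lemma transpose_frame d (E : {vspace V}) (w : 'I_d -> V ') : is_frame (annihilator E) w ->
  is_frame (annihilator (h @: E)) (transpose g \o w).
Proof.
move=> [wE wf]; split => [i|x]; first exact/annihilator_image/wE.
have -> : lincomb (transpose g \o w) x = transpose g (lincomb w x) by rewrite linear_lincomb.
move=> t0; apply: wf; rewrite -(transpose_cancel (lincomb w x)) t0.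
by apply/lfunP => v; rewrite comp_lfunE !zero_lfunE.
Qed.

End linear_images.

Section invariance.
Variables (R : realType) (V : vectType R) (k r : nat).
Local Notation "V '" := ('Hom(V, R^o)) (at level 8, format "V '").
Local Notation n := (k + r.+1)%N.
Local Notation lam d := (@lebesgue_tuple R d).
Hypothesis dV : \dim {:V} = n.
Variables (b0 : n.-tuple V) (b0B : basis_of {:V} b0).
Variables (a : GL V).
Implicit Types f : smooth_section V k r.
Local Notation g := (sval a).
Local Notation h := (GLinv a).

Let gK : cancel h g. Proof. exact: lker0_lfunVK (svalP a). Qed.
Let hK : cancel g h. Proof. exact: lker0_lfunK (svalP a). Qed.

(** No change of variables is involved: the affine chart of the transported frame is the transported
    affine chart, so the domains and the integrands coincide. *)
Lemma frame_integral_act f E (C C' : set (V ')) (e : 'I_k -> V) (w : 'I_r.+1 -> V ') :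
  (forall xi, C xi <-> C' (transpose g xi)) ->
  frame_integral E (act a f) C e w = frame_integral (h @: E)%VS f C' (h \o e) (transpose g \o w).
Proof.
move=> CC'; have wE t : affine (transpose g \o w) t = transpose g (affine w t).
  rewrite [RHS]linearD /= linear_sum; congr (_ + _).
  by apply: eq_bigr => j _; rewrite [RHS]linearZ.
rewrite /frame_integral; congr (_ * _); apply: eq_bigr => s _; congr cintegral.
  have tZ c xi : transpose g (c *: xi) = c *: transpose g xi by exact: linearZ.
  by apply/seteqP; split => t /=; rewrite wE -tZ => /CC'.
apply/funext => t; rewrite wE /act /= limg_line lfunE.
by [].
Qed.

(** The transported frames differ from the ones chosen for the image face. Changing the normal frame
    costs nothing; changing the tangent frame by [A] costs |det A|, which the change of parameters
    on the face compensates. *)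
Lemma face_measure_act f s F : s != [::] -> kfaces k (hull s) F ->
  face_measure (fiber_integral (act a f) (direction F) (gamma (hull s) F)) F =
  face_measure (fiber_integral f (direction (h @` F)) (gamma (hull (map h s)) (h @` F))) (h @` F).
Proof.
move=> s0 kF; have hs0 : map h s != [::] by case: s s0 {kF}.
have kF' : kfaces k (hull (map h s)) (h @` F).
  by rewrite -image_hull; exact: kfaces_image.
rewrite !face_measureE.
have fe := face_frame_frame kF; have fw := normal_frame_frame dV kF.
have fe' := face_frame_frame kF'; have fw' := normal_frame_frame dV kF'.
have dE : direction (h @` F) = (h @: direction F)%VS by exact: direction_image gK hK _.
have mC := measurable_cone_gamma r hs0 kF'.1.
rewrite (@frame_integral_act _ _ _ (gamma (hull (map h s)) (h @` F))) -?dE; last first.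
  move=> xi; rewrite -image_hull; split; first exact: (gamma_image gK hK s0 kF.1).
  rewrite image_hull => H.
  have := gamma_image hK gK hs0 kF'.1 H; rewrite -image_hull !(image_cancel gK).
  by rewrite (transpose_cancel gK).
have fe1 : is_frame (direction (h @` F)) (h \o (@face_frame R V k F)) by rewrite dE; exact: image_frame gK _ _ _ fe.
have fw1 : is_frame (annihilator (direction (h @` F))) (transpose g \o (@normal_frame R V r F)).
  by rewrite dE; exact: transpose_frame gK _ _ _ fw.
have [A AE] := frame_lin_comb fe' kF'.2 (frame_mem fe1).
have A0 : \det A != 0 by apply: frame_lin_comb_det fe' _; rewrite -AE.
rewrite AE (frame_integral_lin_comb b0B dV kF'.2 mC _ _ fe' fw1).
rewrite (frame_integral_basis b0B dV kF'.2 mC f fe' fw' fw1).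
set I := frame_integral _ _ _ _ _.
(* The base points picked by [xget] need not correspond under [h]; [y] is the translation between
   them. *)
have [y yE] : exists y, h (xget 0 F) - xget 0 (h @` F) = lincomb (@face_frame R V k (h @` F)) y.
  apply: (frame_span fe' kF'.2); apply: direction_sub; last exact: (kface_xget hs0 kF').
  by exists (xget 0 F) => //; exact: (kface_xget s0 kF).
have TE : face_set F F = [set t | face_set (h @` F) (h @` F) (taff A y t)].
  have E t : h (face_point F t) = face_point (h @` F) (taff A y t).
    rewrite /face_point linearD linear_lincomb /taff t_ofK.
    have -> : \sum_i rV_of t ord0 i *: h (@face_frame R V k F i) = lincomb (h \o (@face_frame R V k F)) (rV_of t) by [].
    rewrite AE /lincomb /lin_comb lincombM addrC.
    rewrite [X in _ + X = _](_ : _ = lincomb (@face_frame R V k (h @` F)) y + xget 0 (h @` F)); last by rewrite -yE subrK.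
    rewrite addrA addrC; congr (_ + _); rewrite /lincomb -big_split; apply: eq_bigr => i _.
    by rewrite /= -scalerDl !mxE.
  apply/seteqP; split => t; rewrite /face_set /= -E; first by exists (face_point F t).
  by move=> [x Fx /(can_inj gK) <-].
have mT := measurable_face_set hs0 (h @` F) kF'.
have lE : (lam k (face_set F F) = (`|\det A|^-1)%:E * lam k (face_set (h @` F) (h @` F)))%E.
  set T := face_set (h @` F) (h @` F) in TE mT *.
  have mi : measurable_fun setT (fun q : k.-tuple (measurableTypeR R) => (\1_T q : R)%:E).
    by apply/measurable_EFinP; exact: measurable_indic.
  have i0 (x : k.-tuple (measurableTypeR R)) : (0 <= (\1_T x : R)%:E)%E by rewrite lee_fin.
  have := ge0_integral_taff y A0 mi i0.
  rewrite (_ : \int[lam k]_t (\1_T t)%:E = lam k T)%E; last by rewrite integral_indic// setIT.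
  move=> <-; rewrite TE -[in LHS](setIT [set t | _]) -integral_indic//.
  by apply: (@measurable_preimage _ _ _ _ (taff A y)) => //; exact: measurable_taff.
rewrite lE; have : (0 <= lam k (face_set (h @` F) (h @` F)))%E by exact: measure_ge0.
have Ai : 0 < `|\det A|^-1 by rewrite invr_gt0 normr_gt0.
(* An infinite measure would make both sides 0, because [fine] sends it to 0. *)
case: (lam k (face_set (h @` F) (h @` F))) => [x| |]//= x0.
  rewrite -mulrA mulrCA -rmorphM /= mulrA divff ?mul1r// normr_eq0//.
by rewrite gt0_muley ?lte_fin//= !mulr0.
Qed.

Lemma phi_act f P : polytope P -> phi (act a f) P = phi f (h @` P).
Proof.
move=> [s s0 ->]; rewrite -/(hull s) image_hull /phi.
have hs0 : map h s != [::] by case: s s0.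
rewrite (reindex_fsbig (fun F : set V => h @` F) (kfaces k (hull s)) (kfaces k (hull (map h s)))).
  by apply: eq_fsbigr => F /set_mem kF; exact: face_measure_act.
split => [F kF|F F' _ _ /(image_inj gK)//|G kG].
  by rewrite -image_hull; exact: (kfaces_image gK hK).
exists (g @` G); last exact: (image_cancel hK).
by have := kfaces_image hK gK kG; rewrite -image_hull (image_cancel gK).
Qed.

Lemma act_Xi : act a @` Xi V k r `<=` Xi V k r.
Proof.
move=> _ [f Xf <-]; apply/extends_part => b; have [u cu uE] := (extends_part (phi f)).1 Xf b.
exists (fun A => u (h @` A)); first exact: image_real_continuous.
by move=> P pP; rewrite phi_act// uE//; exact: image_polytope.
Qed.

End invariance.

Section main.
Variables (R : realType) (V : vectType R).

Lemma exists_coordinates n (dV : \dim {:V} = n) : exists2 b0 : n.-tuple V, basis_of {:V} b0 &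
  forall v i, coord b0 i v = coord (vbasis {:V}) (cast_ord (esym dV) i) v.
Proof.
exists (tcast dV (vbasis {:V})) => [|v i]; last exact: coord_tcast.
by rewrite val_tcast; exact: vbasisP.
Qed.

Lemma Xi_properties k r : \dim {:V} = (k + r.+1)%N ->
  [/\ closed (Xi V k r), forall g : GL V, act g @` Xi V k r `<=` Xi V k r
    & submod_closed (fun f => f \in Xi V k r)].
Proof.
move=> dV; have [b0 b0B b0E] := exists_coordinates dV.
split; [|by move=> g; exact: (act_Xi dV b0B)|exact: (submod_Xi dV b0B)].
(* [b0] is the basis defining [coords], re-indexed along [dV], so the two sup norms agree. *)
apply: (closed_Xi dV b0B) => v; apply/eqP; rewrite eq_le; apply/andP; split.
  apply/nrm_leP => // i; rewrite -(cast_ordK (dV) i) -[X in coord _ X]/(cast_ord (esym dV) (cast_ord dV i)).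
  rewrite -b0E; have /mx_norm_leP := lexx `|crd b0 v|.
  by move=> /(_ (normr_ge0 _) (cast_ord dV i)); rewrite mxE.
by apply/mx_norm_leP => [|i]; [exact: nrm_ge0|rewrite mxE b0E; exact: coord_le_nrm].
Qed.

End main.

Theorem proposition0p9 (R : realType) (V : vectType R) (n k : nat)
  (dimV : \dim {:V} = n) (n_ge3 : (3 <= n)%N) (k_ge1 : (1 <= k)%N)
  (k_le : (k <= n - 2)%N) :
  [/\ closed (Xi V k (n - k - 1)),
      forall g : GL V, act g @` Xi V k (n - k - 1) `<=` Xi V k (n - k - 1)
    & submod_closed (fun f => f \in Xi V k (n - k - 1))].
Proof.
(* Since k <= n - 2, the truncated subtraction is exact and k + (n - k - 1).+1 = n. *)
apply: Xi_properties; rewrite dimV subn1 prednK ?subn_gt0; last first.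
  by apply: (leq_ltn_trans k_le); rewrite ltn_subrL; case: n n_ge3 {dimV k_le}.
rewrite subnKC//; apply: (leq_trans k_le); exact: leq_subr.
Qed.
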